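(* Let $\kappa\in\mathcal{B}^2$ be a bivariate Bernstein function. Then the bivariate Bernstein-gamma function $W_\kappa$ associated with $\kappa$ exists and is unique, and the following product, defined for $(\zeta,z)\in\mathbb{C}_{[0,\infty)}\times\mathbb{C}_{(0,\infty)}$ by $$F(\zeta,z)=\frac{e^{-\gamma_\kappa(\zeta) z}}{\kappa(\zeta,z)}\prod_{k=1}^{\infty}\frac{\kappa(\zeta,k)}{\kappa(\zeta,k+z)}\,e^{\frac{\kappa'_z(\zeta,k)}{\kappa(\zeta,k)}z},\qquad \gamma_\kappa(\zeta)=\lim_{n\to\infty}\Big(\sum_{k=1}^{n}\frac{\kappa'_z(\zeta,k)}{\kappa(\zeta,k)}-\log_0\big(\kappa(\zeta,n)\big)\Big),$$ satisfies the recurrence $F(\zeta,z+1)=\kappa(\zeta,z)F(\zeta,z)$ for $\zeta\in\mathbb{C}_{[0,\infty)}$, $z\in\mathbb{C}_{(0,\infty)}$. In particular, for $(\zeta,z)\in\mathbb{C}_{[0,\infty)}\times\mathbb{C}_{(0,\infty)}$, $$W_\kappa(\zeta,z)=\frac{e^{-\gamma_\kappa(\zeta) z}}{\kappa(\zeta,z)}\prod_{k=1}^{\infty}\frac{\kappa(\zeta,k)}{\kappa(\zeta,k+z)}\,e^{\frac{\kappa'_z(\zeta,k)}{\kappa(\zeta,k)}z},$$ so that the product is indeed a product representation of $W_\kappa$. Moreover, $\gamma_\kappa\in\mathtt{A}_{[0,\infty)}$, that is, $\gamma_\kappa$ is holomorphic on $\mathbb{C}_{(0,\infty)}$ and can be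 extended continuously to the line $i\mathbb{R}$, and for $(\zeta,z)\in\mathbb{C}_{[0,\infty)}\times\mathbb{C}_{(0,\infty)}$, $$W_\kappa(\zeta,z)=\frac{1}{\kappa(\zeta,z)}\lim_{n\to\infty}e^{z\log_0\kappa(\zeta,n)}\prod_{k=1}^{n}\frac{\kappa(\zeta,k)}{\kappa(\zeta,k+z)}.$$
   Context: Notation: $\mathbb{C}_{(0,\infty)}=\{z\in\mathbb{C}:\Re z>0\}$, $\mathbb{C}_{[0,\infty)}=\{z\in\mathbb{C}:\Re z\ge 0\}$; $\log_0$ is the principal branch of the logarithm on $\mathbb{C}\setminus(-\infty,0]$, $\log_0(z)=\ln|z|+i\arg z$; $\kappa'_z$ denotes the derivative of $\kappa$ in its second argument. A function $\kappa$ is a bivariate Bernstein function, $\kappa\in\mathcal{B}^2$, if for all $\zeta,z\in\mathbb{C}_{[0,\infty)}$, $$\kappa(\zeta,z)=\kappa(0,0)+d_1\zeta+d_2z+\int_0^\infty\int_0^\infty\big(1-e^{-\zeta x_1-zx_2}\big)\mu(dx_1,dx_2),$$ where $\kappa(0,0),d_1,d_2\in[0,\infty)$ and $\mu$ is a measure on $(0,\infty)\times(0,\infty)$ such that $\int_0^\infty\int_0^\infty\min\{x_1,1\}\min\{x_2,1\}\,\mu(dx_1,dx_2)<\infty$. The class $\mathcal{B}^2$ is identified with the class of bivariate Laplace exponents of possibly killed bivariate subordinators. $W_\kappa$ is the bivariate Bernstein-gamma function associated with $\kappa$ if: (i) $W_\kappa(\zeta,z+1)=\kappa(\zeta,z)W_\kappa(\zeta,z)$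 for all $\zeta\in\mathbb{C}_{[0,\infty)}$, $z\in\mathbb{C}_{(0,\infty)}$; (ii) $W_\kappa(\zeta,1)=1$ for each $\zeta\in\mathbb{C}_{[0,\infty)}$; (iii) $W_\kappa$ is holomorphic as a function of two variables on $\mathbb{C}_{(0,\infty)}\times\mathbb{C}_{(0,\infty)}$; (iv) for any $q\in[0,\infty)$ the function $W_\kappa(q,\cdot)$ is the Mellin transform of a positive random variable, where the Mellin transform of a positive random variable $Y$ is $z\mapsto\mathbb{E}[Y^{z-1}]$.
   Formalization: Assumes κ(0,·) is not identically 0 (excludes only κ = d₁ζ, where W(0,2)=0 is impossible); uniqueness at ζ = iy, y≠0, is claimed only among functions continuous in ζ up to iℝ, since multiplying W(iy,z) by e^{2πiz} preserves (i)–(iv). *)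

(* Defs.v *)
From HB Require Import structures.
From mathcomp Require Import all_boot all_order all_algebra.
From mathcomp Require Import all_classical all_reals all_analysis.
From mathcomp Require Import complex.

Set Implicit Arguments.
Unset Strict Implicit.
Unset Printing Implicit Defensive.

Import Order.TTheory GRing.Theory Num.Theory numFieldNormedType.Exports.

Local Open Scope classical_set_scope.
Local Open Scope ring_scope.
Local Open Scope complex_scope.

(* The complex numbers are [R[i]] over an arbitrary [R : realType].  The
   topology and normed structure on them is reached through the regular module
   [R[i]^o], so [derivable] and [differentiable] below are over the field [R[i]],
   i.e. they mean complex differentiability. *)

Section Complex.
Context {R : realType}.

Definition half_plane : set R[i] := [set z | 0 < complex.Re z].

Definition closed_half_plane : set R[i] := [set z | 0 <= complex.Re z].

Definition cexp (z : R[i]) : R[i] :=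
  (expR (complex.Re z))%:C * (cos (complex.Im z) +i* sin (complex.Im z)).

Definition cmod (z : R[i]) : R :=
  Num.sqrt (complex.Re z ^+ 2 + complex.Im z ^+ 2).

(* Values in ]-pi, pi] for z != 0. *)
Definition carg (z : R[i]) : R :=
  if 0 <= complex.Im z then acos (complex.Re z / cmod z)
  else - acos (complex.Re z / cmod z).

Definition log0 (z : R[i]) : R[i] := ln (cmod z) +i* carg z.

(* y ^ w for real y > 0. *)
Definition rcpow (y : R) (w : R[i]) : R[i] := cexp (w * (ln y)%:C).

End Complex.

Section ComplexIntegral.
Context {d : measure_display} {T : measurableType d} {R : realType}.

Definition cintegrable (mu : {measure set T -> \bar R}) (D : set T)
    (f : T -> R[i]) : Prop :=
  mu.-integrable D (fun x => (complex.Re (f x))%:E) /\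
  mu.-integrable D (fun x => (complex.Im (f x))%:E).

Definition cintegral (mu : {measure set T -> \bar R}) (D : set T)
    (f : T -> R[i]) : R[i] :=
  (\int[mu]_(x in D) complex.Re (f x)) +i*
  (\int[mu]_(x in D) complex.Im (f x)).

End ComplexIntegral.

Section BivariateBernstein.
Context {R : realType}.
Implicit Types (kappa W : R[i] -> R[i] -> R[i]).

Definition quadrant : set (R * R) := `]0, +oo[ `*` `]0, +oo[.

(* Only the restriction of [mu] to the open quadrant matters.  The condition on
   min(x1, 1) min(x2, 1) does not by itself make 1 - e^(- zeta x1 - z x2)
   integrable (mu may have infinite mass near a point (0, x2) with x2 > 0), so
   the existence of the integral is part of the definition. *)
Definition bivariate_bernstein kappa : Prop :=
  exists (d1 d2 : R) (mu : {measure set (R * R) -> \bar R}),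
  [/\ 0 <= kappa 0 0, 0 <= d1, 0 <= d2,
      (\int[mu]_(x in quadrant)
         (Num.min x.1 1 * Num.min x.2 1)%:E < +oo)%E
    & forall zeta z : R[i], closed_half_plane zeta -> closed_half_plane z ->
      let f (x : R * R) := 1 - cexp (- zeta * x.1%:C - z * x.2%:C) in
      cintegrable mu quadrant f /\
      kappa zeta z = kappa 0 0 + d1%:C * zeta + d2%:C * z
                     + cintegral mu quadrant f].

Definition mellin_of_positive_rv (M : R[i] -> R[i]) : Prop :=
  exists (d : measure_display) (T : measurableType d) (P : probability T R)
         (Y : {RV P >-> R}),
  (forall t, 0 < Y t) /\
  forall z, half_plane z ->
    cintegrable P setT (fun t => rcpow (Y t) (z - 1)) /\
    M z = cintegral P setT (fun t => rcpow (Y t) (z - 1)).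

Definition bernstein_gamma kappa W : Prop :=
  [/\ forall zeta z : R[i], closed_half_plane zeta -> half_plane z ->
        W zeta (z + 1) = kappa zeta z * W zeta z,
      forall zeta : R[i], closed_half_plane zeta -> W zeta 1 = 1,
      forall zeta z : R[i], half_plane zeta -> half_plane z ->
        differentiable
          ((fun p => W p.1 p.2) : R[i]^o * R[i]^o -> R[i]^o) ((zeta, z) : R[i]^o * R[i]^o)
    & forall q : R, 0 <= q -> mellin_of_positive_rv (W q%:C)].

(* [bernstein_gamma] does not constrain W at zeta = i y, y != 0, beyond the
   recurrence and the value at z = 1 (it survives multiplication by
   e^(2 pi i z) there); continuity up to the boundary in zeta does. *)
Definition boundary_continuous W : Prop :=
  forall z, half_plane z ->
    {within (closed_half_plane : set R[i]^o),
      continuous ((fun zeta => W zeta z) : R[i]^o -> R[i]^o)}.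

Definition classA (f : R[i] -> R[i]) : Prop :=
  (forall zeta : R[i], half_plane zeta ->
     derivable (f : R[i]^o -> R[i]^o) zeta 1) /\
  {within (closed_half_plane : set R[i]^o),
    continuous (f : R[i]^o -> R[i]^o)}.

Definition dkappa kappa (zeta z : R[i]) : R[i] :=
  derive1 (kappa zeta : R[i] -> R[i]^o) z.

Definition gamma_seq kappa (zeta : R[i]) (n : nat) : R[i]^o :=
  \sum_(1 <= k < n.+1) dkappa kappa zeta k%:R / kappa zeta k%:R
  - log0 (kappa zeta n%:R).

Definition gamma_kappa kappa (zeta : R[i]) : R[i] := limn (gamma_seq kappa zeta).

Definition weierstrass_seq kappa (zeta z : R[i]) (n : nat) : R[i]^o :=
  \prod_(1 <= k < n.+1)
    (kappa zeta k%:R / kappa zeta (k%:R + z)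
     * cexp (dkappa kappa zeta k%:R / kappa zeta k%:R * z)).

Definition weierstrass kappa (zeta z : R[i]) : R[i] :=
  cexp (- gamma_kappa kappa zeta * z) / kappa zeta z
  * limn (weierstrass_seq kappa zeta z).

Definition gauss_seq kappa (zeta z : R[i]) (n : nat) : R[i]^o :=
  cexp (z * log0 (kappa zeta n%:R))
  * \prod_(1 <= k < n.+1) (kappa zeta k%:R / kappa zeta (k%:R + z)).

End BivariateBernstein.

(* Main.v *)
Require Import Defs.
From HB Require Import structures.
From mathcomp Require Import all_boot all_order all_algebra.
From mathcomp Require Import all_classical all_reals all_analysis.
From mathcomp Require Import measurable_realfun.
From mathcomp Require Import complex.
From mathcomp Require Import ring lra.

(* All estimates on kappa(zeta, z) are made relative to phi(x) = Re kappa(0, x):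
   one has Re kappa(zeta, z) >= phi(Re z) > 0, and the Levy form bounds the first
   and second Taylor remainders in z by phi(x) |h| / x and phi(x) |h|^2 / x^2 up to
   constants.  Hence log_0 kappa(zeta, k) has increments O(1/k) and second-order
   remainders O(1/k^2), uniformly in zeta, so that gamma_kappa and the logarithm of
   the product converge with error O(1/n); holomorphy passes to the limit by
   Cauchy's estimate, joint holomorphy comes from separate holomorphy and local
   boundedness, and the recurrence is read off the Gauss form of the product.

   Uniqueness: for real q >= 0 a Mellin transform is log-convex on (0, oo), so the
   Bohr-Mollerup argument identifies W(q, x) with the Gauss limit; the identity
   theorem, used first in z and then in zeta, and continuity give the rest.

   Existence of the random variable: kappa(q, x) is a pointwise limit of
   B - s(x) with s a finite positive combination of exponentials, so by geometric
   series 1 / kappa(q, j + x), then the Gauss products and W(q, 1 + x), are limits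
   of such combinations.  Normalised at x = 0, they give lists l of reals with
   W(q, 1 + r) the limit of the averages of e^(r b), b in l.  Along an ultrafilter
   the quantile functions of l converge at every point of (0, 1); since integrals of
   bounded monotone functions are uniformly approximated by Riemann sums, the
   truncated moments converge as well, and Y = e^f for the limit quantile function f
   and a uniform variable on (0, 1). *)

Set Implicit Arguments.
Unset Strict Implicit.
Unset Printing Implicit Defensive.

Import Order.TTheory GRing.Theory Num.Theory numFieldNormedType.Exports.

Local Open Scope classical_set_scope.
Local Open Scope ring_scope.
Local Open Scope complex_scope.

(** * Complex derivatives, exponential and logarithm *)

(** Two features of the setting shape the estimates. Re kappa stays above phi > 0, so the principal
    logarithm applies to every factor, and phi cancels in the bounds on log kappa, which become
    absolute: hence the uniformity in zeta up to the imaginary axis, where kappa(., z) is only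
    continuous. And kappa is given through an integral, so every bound on it comes from comparing
    exponentials with 1 - e^(- x y), a function known to be mu-integrable.

    The random variable solves a moment problem on the real axis; the identity theorem passes to
    complex z. The unknown is r = z - 1 > -1, which makes r = 0 an interior point: W(q, 1) = 1 gives
    total mass one, and moments on both sides of 0 keep mass from escaping to -oo or +oo. The
    ultrafilter does the work of Helly's selection theorem, at all points at once. Dominated
    convergence can fail along an ultrafilter; Riemann sums of monotone functions replace it, since
    their error depends only on a bound of the function and on the mesh. *)

Section ComplexModulus.
Context {R : realType}.
Implicit Types (z w : R[i]) (x y : R).

Lemma normE z : `|z| = (cmod z)%:C.
Proof. by rewrite normc_def. Qed.

Lemma cmod_ge0 z : 0 <= cmod z.
Proof. exact: sqrtr_ge0. Qed.

Lemma cmodM z w : cmod (z * w) = cmod z * cmod w.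
Proof. by apply: complexI; rewrite rmorphM /= -!normE normrM. Qed.

Lemma cmodD z w : cmod (z + w) <= cmod z + cmod w.
Proof. by rewrite -lecR rmorphD /= -!normE ler_normD. Qed.

Lemma cmodN z : cmod (- z) = cmod z.
Proof. by apply: complexI; rewrite -!normE normrN. Qed.

Lemma cmodB z w : cmod (z - w) <= cmod z + cmod w.
Proof. by rewrite -(cmodN w) cmodD. Qed.

Lemma cmodBC z w : cmod (z - w) = cmod (w - z).
Proof. by rewrite -cmodN opprB. Qed.

Lemma cmodV z : cmod z^-1 = (cmod z)^-1.
Proof.
apply: complexI; rewrite -normE normfV normE.
by rewrite (fmorphV (real_complex R)).
Qed.

Lemma cmod_real x : cmod x%:C = `|x|.
Proof. by rewrite /cmod /= expr0n /= addr0 sqrtr_sqr. Qed.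

Lemma cmod0 : cmod (0 : R[i]) = 0.
Proof. by rewrite -(rmorph0 (real_complex R)) cmod_real normr0. Qed.

Lemma cmod1 : cmod (1 : R[i]) = 1.
Proof. by rewrite -(rmorph1 (real_complex R)) cmod_real normr1. Qed.

Lemma cmod_eq0 z : (cmod z == 0) = (z == 0).
Proof. by rewrite -(inj_eq (@complexI R)) -normE normr_eq0. Qed.

Lemma cmod_gt0 z : (0 < cmod z) = (z != 0).
Proof. by rewrite lt_def cmod_ge0 andbT cmod_eq0. Qed.

Lemma cmod_i : cmod ('i : R[i]) = 1.
Proof. by rewrite /cmod /= expr0n expr1n add0r sqrtr1. Qed.

Lemma normRe_le z : `|complex.Re z| <= cmod z.
Proof. by rewrite -sqrtr_sqr ler_wsqrtr// lerDl sqr_ge0. Qed.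

Lemma normIm_le z : `|complex.Im z| <= cmod z.
Proof. by rewrite -sqrtr_sqr ler_wsqrtr// lerDr sqr_ge0. Qed.

Lemma Re_le z : complex.Re z <= cmod z.
Proof. exact: le_trans (ler_norm _) (normRe_le z). Qed.

Lemma cmod_leD z : cmod z <= `|complex.Re z| + `|complex.Im z|.
Proof.
rewrite {1}(complexE z); apply: le_trans (cmodD _ _) _.
by rewrite cmodM cmod_i mul1r !cmod_real.
Qed.

Lemma ReD z w : complex.Re (z + w) = complex.Re z + complex.Re w.
Proof. by case: z; case: w. Qed.
Lemma ImD z w : complex.Im (z + w) = complex.Im z + complex.Im w.
Proof. by case: z; case: w. Qed.
Lemma ReN z : complex.Re (- z) = - complex.Re z.
Proof. by case: z. Qed.
Lemma ImN z : complex.Im (- z) = - complex.Im z.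
Proof. by case: z. Qed.
Lemma ReB z w : complex.Re (z - w) = complex.Re z - complex.Re w.
Proof. by rewrite ReD ReN. Qed.
Lemma ImB z w : complex.Im (z - w) = complex.Im z - complex.Im w.
Proof. by rewrite ImD ImN. Qed.
Lemma ReM z w : complex.Re (z * w) =
  complex.Re z * complex.Re w - complex.Im z * complex.Im w.
Proof. by case: z; case: w. Qed.
Lemma ImM z w : complex.Im (z * w) =
  complex.Re z * complex.Im w + complex.Im z * complex.Re w.
Proof. by case: z => a b; case: w. Qed.

Lemma complex_eqP z w :
  complex.Re z = complex.Re w -> complex.Im z = complex.Im w -> z = w.
Proof. by case: z => a b; case: w => c d /= -> ->. Qed.

Lemma cmod_lt_eps0 z : (forall e, 0 < e -> cmod z <= e) -> z = 0.
Proof.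
move=> h; apply/eqP; rewrite -cmod_eq0 eq_le cmod_ge0 andbT.
by apply/ler_addgt0Pr => e e0; rewrite add0r h.
Qed.

Lemma complex_gt0P (e : R[i]) : 0 < e -> exists2 r : R, 0 < r & e = r%:C.
Proof.
case: e => a b; rewrite ltcE /= => /andP[/eqP -> a0]; by exists a.
Qed.

(** Turns a bound on a modulus into a bound on a real part; the mean value inequality and the
    modulus bound for integrals both rotate by such a [u]. *)
Lemma complex_unit_of z : exists2 u : R[i], cmod u = 1 & u * z = (cmod z)%:C.
Proof.
have [->|z0] := eqVneq z 0.
  by exists 1; rewrite ?cmod1 // mul1r cmod0.
exists ((cmod z)%:C / z); last by rewrite divfK.
by rewrite cmodM cmodV cmod_real ger0_norm ?cmod_ge0 // divff // cmod_eq0.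
Qed.

End ComplexModulus.

Section ComplexDerivative.
Context {R : realType}.
Implicit Types (f g : R[i] -> R[i]) (z w h A B : R[i]).

(** The difference quotient is multiplied out: h = 0 needs no exclusion, and every bound is an
    inequality between reals. *)
Definition is_cderiv f z A := forall e : R, 0 < e -> exists2 d : R, 0 < d &
  forall h, cmod h < d -> cmod (f (z + h) - f z - A * h) <= e * cmod h.

Lemma is_cderivP f z A :
  is_cderiv f z A <-> is_derive (z : R[i]^o) 1 (f : R[i]^o -> R[i]^o) A.
Proof.
have E h : h != 0 -> h^-1 * (f (h + z) - f z) - A
    = h^-1 * (f (z + h) - f z - A * h).
  by move=> h0; rewrite [h + z]addrC; field.
have key : is_cderiv f z A <->
    (fun h : R[i]^o => h^-1 *: (((f : R[i]^o -> R[i]^o) \o shift (z : R[i]^o)) (h *: (1 : R[i]^o)) - f z))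
    @ (0 : R[i]^o)^' --> (A : R[i]^o).
  split=> [H|/cvgrPdist_le H].
    apply/cvgrPdist_le => e' e'0.
    have [e e0 ->] := complex_gt0P e'0.
    have [d d0 Hd] := H _ e0.
    rewrite near_withinE; apply/nbhs_ballP; exists (d%:C); first by rewrite /= ltcR.
    move=> h; rewrite /ball /= sub0r normrN => hd h0.
    rewrite scaler1 distrC [_ *: _]/(_ * _) E // normE lecR cmodM cmodV.
    have hp : 0 < cmod h by rewrite cmod_gt0.
    rewrite mulrC ler_pdivrMr //; apply: Hd.
    by move: hd; rewrite normE ltcR.
  move=> e e0; have /H : 0 < e%:C by rewrite ltcR.
  rewrite near_withinE => /nbhs_ballP[d' /= /complex_gt0P[d d0 ->] Hd].
  exists d => // h hd; have [->|h0] := eqVneq h 0.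
    by rewrite addr0 mulr0 subr0 subrr cmod0 mulr0.
  have := Hd h; rewrite /ball /= sub0r normrN normE ltcR => /(_ hd h0).
  rewrite scaler1 distrC [_ *: _]/(_ * _) E // normE lecR cmodM cmodV.
  by rewrite mulrC ler_pdivrMr // cmod_gt0.
rewrite key; split => [H|[dfz <-]].
  have dv : derivable (f : R[i]^o -> R[i]^o) z 1 by apply/cvg_ex; exists A.
  apply: DeriveDef; first exact: dv.
  exact: (cvg_lim (@norm_hausdorff _ R[i]^o) H).
exact: dfz.
Qed.

Definition holo f z := exists A, is_cderiv f z A.

Lemma holoP f z : holo f z <-> derivable (f : R[i]^o -> R[i]^o) z 1.
Proof.
split=> [[A /is_cderivP[]] //|H].
by exists ('D_1 (f : R[i]^o -> R[i]^o) z); apply/is_cderivP; apply: derivableP.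
Qed.

Lemma is_cderiv_eq f z A B : is_cderiv f z A -> A = B -> is_cderiv f z B.
Proof. by move=> ? <-. Qed.

Lemma is_cderiv_cst c z : is_cderiv (fun=> c) z 0.
Proof. by apply/is_cderivP; apply: is_derive_cst. Qed.

Lemma is_cderiv_id z : is_cderiv id z 1.
Proof. by apply/is_cderivP; apply: is_derive_id. Qed.

Lemma is_cderivD f g z A B : is_cderiv f z A -> is_cderiv g z B ->
  is_cderiv (fun w => f w + g w) z (A + B).
Proof.
by move=> /is_cderivP ? /is_cderivP ?; apply/is_cderivP; apply: is_deriveD.
Qed.

Lemma is_cderivN f z A : is_cderiv f z A -> is_cderiv (fun w => - f w) z (- A).
Proof. by move=> /is_cderivP ?; apply/is_cderivP; apply: is_deriveN. Qed.

Lemma is_cderivB f g z A B : is_cderiv f z A -> is_cderiv g z B ->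
  is_cderiv (fun w => f w - g w) z (A - B).
Proof. by move=> ? ?; apply: is_cderivD => //; apply: is_cderivN. Qed.

Lemma is_cderivM f g z A B : is_cderiv f z A -> is_cderiv g z B ->
  is_cderiv (fun w => f w * g w) z (f z * B + g z * A).
Proof.
by move=> /is_cderivP ? /is_cderivP ?; apply/is_cderivP.
Qed.

Lemma is_cderivZ f z A c : is_cderiv f z A -> is_cderiv (fun w => c * f w) z (c * A).
Proof.
move=> H; apply: is_cderiv_eq (is_cderivM (is_cderiv_cst c z) H) _.
by rewrite mulr0 addr0.
Qed.

Lemma cderiv_cont f z A : is_cderiv f z A -> forall e : R, 0 < e ->
  exists2 d : R, 0 < d & forall h, cmod h < d -> cmod (f (z + h) - f z) <= e.
Proof.
move=> H e e0; have [d d0 Hd] := H _ (@ltr01 R).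
have K0 : 0 < 1 + cmod A by rewrite ltr_pwDl // cmod_ge0.
exists (Num.min d (e / (1 + cmod A))); first by rewrite lt_min d0 divr_gt0.
move=> h; rewrite lt_min => /andP[/Hd h1 h2].
have -> : f (z + h) - f z = (f (z + h) - f z - A * h) + A * h by ring.
apply: le_trans (cmodD _ _) _; apply: le_trans (lerD h1 (lexx _)) _.
rewrite cmodM -mulrDl mulrC -ler_pdivlMr //; exact: ltW.
Qed.

Lemma is_cderiv_comp f g z A B : is_cderiv f (g z) A -> is_cderiv g z B ->
  is_cderiv (fun w => f (g w)) z (A * B).
Proof.
move=> Hf Hg e e0; have A0 := cmod_ge0 A; have B0 := cmod_ge0 B.
pose e2 := e / (2 * (1 + cmod A)).
have e20 : 0 < e2 by rewrite divr_gt0 // mulr_gt0 // ltr_pwDl.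
have [d2 d20 Hd2] := Hg _ e20.
have [d3 d30 Hd3] := Hg _ (@ltr01 R).
pose e1 := e / (2 * (1 + cmod B)).
have e10 : 0 < e1 by rewrite divr_gt0 // mulr_gt0 // ltr_pwDl.
have [d1 d10 Hd1] := Hf _ e10.
have d1'0 : 0 < d1 / 2 by rewrite divr_gt0.
have [d4 d40 Hd4] := cderiv_cont Hg d1'0.
exists (Num.min (Num.min d2 d3) d4); first by rewrite !lt_min d20 d30.
move=> h; rewrite !lt_min => /andP[/andP[h2 h3] h4].
set k := g (z + h) - g z.
have -> : g (z + h) = g z + k by rewrite /k; ring.
have kd : cmod k < d1.
  by apply: le_lt_trans (Hd4 _ h4) _; rewrite ltr_pdivrMr // ltr_pMr // ltr1n.
have -> : f (g z + k) - f (g z) - A * B * h =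
  (f (g z + k) - f (g z) - A * k) + A * (k - B * h) by ring.
apply: le_trans (cmodD _ _) _; rewrite cmodM.
have k1 : cmod k <= (1 + cmod B) * cmod h.
  have -> : k = (k - B * h) + B * h by ring.
  apply: le_trans (cmodD _ _) _; rewrite mulrDl cmodM lerD //.
  exact: Hd3.
have H1 : cmod (f (g z + k) - f (g z) - A * k) <= e / 2 * cmod h.
  apply: le_trans (Hd1 _ kd) _.
  apply: le_trans (ler_wpM2l (ltW e10) k1) _.
  rewrite /e1 mulrA le_eqVlt; apply/orP; left; apply/eqP; congr (_ * _).
  field; apply: lt0r_neq0; lra.
have H2 : cmod A * cmod (k - B * h) <= e / 2 * cmod h.
  apply: le_trans (ler_wpM2l A0 (Hd2 _ h2)) _.
  rewrite mulrA ler_wpM2r ?cmod_ge0 // /e2.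
  rewrite mulrA ler_pdivrMr; last by rewrite mulr_gt0 // ltr_pwDl.
  nra.
lra.
Qed.

Lemma is_cderivV z : z != 0 -> is_cderiv (fun w => w^-1) z (- z^-2).
Proof.
move=> z0; have zp : 0 < cmod z by rewrite cmod_gt0.
(* The remainder is [h ^+ 2 / (z ^+ 2 * (z + h))] with |z + h| >= |z| / 2, whence the cube of
   |z|. *)
move=> e e0; exists (Num.min (cmod z / 2) (e * (cmod z) ^+ 3 / 2)).
  by rewrite lt_min !divr_gt0 // mulr_gt0 // exprn_gt0.
move=> h; rewrite lt_min => /andP[h1 h2].
have zh : cmod z / 2 <= cmod (z + h).
  have := cmodB (z + h) h; rewrite addrK; lra.
have zh0 : z + h != 0 by rewrite -cmod_gt0; lra.
have -> : (z + h)^-1 - z^-1 - - z^-2 * h = h ^+ 2 / (z ^+ 2 * (z + h)).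
  by field; rewrite z0 zh0.
rewrite cmodM cmodV expr2 !cmodM -[leRHS]mulrC -mulrA.
apply: ler_wpM2l; first exact: cmod_ge0.
rewrite ler_pdivrMr; last by rewrite !mulr_gt0 //; lra.
apply: le_trans (ltW h2) _.
have -> : e * cmod z ^+ 3 / 2 = e * (cmod z * cmod z * (cmod z / 2)) by ring.
by rewrite ler_pM2l // ler_pM2l // mulr_gt0.
Qed.

Lemma holo_cst c z : holo (fun=> c) z.
Proof. by exists 0; apply: is_cderiv_cst. Qed.
Lemma holo_id z : holo id z.
Proof. by exists 1; apply: is_cderiv_id. Qed.
Lemma holoD f g z : holo f z -> holo g z -> holo (fun w => f w + g w) z.
Proof. by move=> [A ?] [B ?]; exists (A + B); apply: is_cderivD. Qed.
Lemma holoN f z : holo f z -> holo (fun w => - f w) z.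
Proof. by move=> [A ?]; exists (- A); apply: is_cderivN. Qed.
Lemma holoB f g z : holo f z -> holo g z -> holo (fun w => f w - g w) z.
Proof. by move=> [A ?] [B ?]; exists (A - B); apply: is_cderivB. Qed.
Lemma holoM f g z : holo f z -> holo g z -> holo (fun w => f w * g w) z.
Proof. by move=> [A ?] [B ?]; eexists; apply: is_cderivM; eassumption. Qed.
Lemma holo_comp f g z : holo f (g z) -> holo g z -> holo (fun w => f (g w)) z.
Proof. by move=> [A ?] [B ?]; exists (A * B); apply: is_cderiv_comp. Qed.
Lemma holoV f z : f z != 0 -> holo f z -> holo (fun w => (f w)^-1) z.
Proof.
move=> fz0 hf; apply: (@holo_comp (fun w => w^-1)) => //.
by exists (- (f z)^-2); apply: is_cderivV.
Qed.
Lemma holo_sum (I : Type) (r : seq I) (F : I -> R[i] -> R[i]) z :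
  (forall i, holo (F i) z) -> holo (fun w => \sum_(i <- r) F i w) z.
Proof.
move=> H; elim: r => [|i r IH].
  have -> : (fun w => \sum_(i <- [::]) F i w) = fun=> 0.
    by apply/funext => w; rewrite big_nil.
  exact: holo_cst.
have -> : (fun w => \sum_(i <- i :: r) F i w) = fun w => F i w + \sum_(i <- r) F i w.
  by apply/funext => w; rewrite big_cons.
exact: holoD.
Qed.

Lemma holo_cont f z : holo f z -> forall e : R, 0 < e ->
  exists2 d : R, 0 < d & forall h, cmod h < d -> cmod (f (z + h) - f z) <= e.
Proof. by move=> [A /cderiv_cont]. Qed.

Lemma near_holo f g z (r : R) : 0 < r ->
  (forall h, cmod h < r -> f (z + h) = g (z + h)) -> holo f z -> holo g z.
Proof.
move=> r0 fg [A HA]; exists A => e e0; have [d d0 Hd] := HA _ e0.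
exists (Num.min d r); first by rewrite lt_min d0.
move=> h; rewrite lt_min => /andP[h1 h2]; rewrite -fg //.
have := fg 0; rewrite addr0 cmod0 => <- //; exact: Hd.
Qed.

End ComplexDerivative.

(** * The mean value inequality for complex derivatives *)

Section MeanValue.
Context {R : realType}.
Implicit Types (f : R[i] -> R[i]) (z w h u v : R[i]).

Lemma is_rderivP (g : R -> R) (t a : R) :
  (forall e : R, 0 < e -> exists2 d : R, 0 < d &
    forall h : R, `|h| < d -> `|g (t + h) - g t - a * h| <= e * `|h|) <->
  is_derive t 1 g a.
Proof.
have E (h : R) : h != 0 -> h^-1 * (g (h + t) - g t) - a
    = h^-1 * (g (t + h) - g t - a * h).
  by move=> h0; rewrite [h + t]addrC; field.
have key : (forall e : R, 0 < e -> exists2 d : R, 0 < d &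
      forall h : R, `|h| < d -> `|g (t + h) - g t - a * h| <= e * `|h|) <->
    (fun h : R => h^-1 *: ((g \o shift t) (h *: (1 : R)) - g t)) @ (0 : R)^' --> a.
  split=> [H|/cvgrPdist_le H].
    apply/cvgrPdist_le => e e0; have [d d0 Hd] := H _ e0.
    rewrite near_withinE; apply/nbhs_ballP; exists d => // h.
    rewrite /ball /= sub0r normrN => hd h0.
    rewrite scaler1 distrC [_ *: _]/(_ * _) E // normrM normfV.
    by rewrite mulrC ler_pdivrMr ?normr_gt0 //; apply: Hd.
  move=> e /H; rewrite near_withinE => /nbhs_ballP[d /= d0 Hd].
  exists d => // h hd; have [->|h0] := eqVneq h 0.
    by rewrite addr0 mulr0 subr0 subrr normr0 mulr0.
  have := Hd h; rewrite /ball /= sub0r normrN => /(_ hd h0).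
  rewrite scaler1 distrC [_ *: _]/(_ * _) E // normrM normfV.
  by rewrite mulrC ler_pdivrMr // normr_gt0.
rewrite key; split => [H|[dfz <-]].
  have dv : derivable g t 1 by apply/cvg_ex; exists a.
  apply: DeriveDef; first exact: dv.
  exact: (cvg_lim (@norm_hausdorff _ R) H).
exact: dfz.
Qed.

Lemma is_derive_Re_line f u a v (t : R) A : is_cderiv f (a + t%:C * v) A ->
  is_derive t 1 (fun s : R => complex.Re (u * f (a + s%:C * v)))
    (complex.Re (u * (A * v))).
Proof.
move=> H; apply/is_rderivP => e e0.
have K0 : 0 < 1 + cmod u * cmod v by rewrite ltr_pwDl // mulr_ge0 ?cmod_ge0.
have e10 : 0 < e / (1 + cmod u * cmod v) by rewrite divr_gt0.
have [d d0 Hd] := H _ e10.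
have v10 : 0 < 1 + cmod v by rewrite ltr_pwDl // cmod_ge0.
exists (d / (1 + cmod v)); first by rewrite divr_gt0.
move=> h; rewrite ltr_pdivlMr // => hd.
have hv : cmod (h%:C * v) < d.
  rewrite cmodM cmod_real; apply: le_lt_trans hd.
  by rewrite ler_wpM2l // lerDr.
have /= {}Hd := Hd _ hv.
have -> : complex.Re (u * f (a + (t + h)%:C * v)) - complex.Re (u * f (a + t%:C * v))
   - complex.Re (u * (A * v)) * h = complex.Re
   (u * (f (a + t%:C * v + h%:C * v) - f (a + t%:C * v) - A * (h%:C * v))).
  have -> : complex.Re (u * (A * v)) * h = complex.Re (u * (A * (h%:C * v))).
    have -> : u * (A * (h%:C * v)) = (u * (A * v)) * h%:C by ring.
    by rewrite [RHS]ReM /= mulr0 subr0.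
  rewrite -!ReB; congr complex.Re; rewrite rmorphD /=.
  have -> : a + (t%:C + h%:C) * v = a + t%:C * v + h%:C * v by ring.
  ring.
apply: le_trans (normRe_le _) _; rewrite cmodM.
apply: le_trans (ler_wpM2l (cmod_ge0 _) Hd) _.
rewrite cmodM cmod_real.
have -> : cmod u * (e / (1 + cmod u * cmod v) * (`|h| * cmod v)) =
  (e * `|h|) * (cmod u * cmod v / (1 + cmod u * cmod v)) by ring.
have q1 : cmod u * cmod v / (1 + cmod u * cmod v) <= 1.
  by rewrite ler_pdivrMr // mul1r lerDr.
by rewrite ler_piMr // mulr_ge0 // ltW.
Qed.

(** The mean value theorem is false for complex values. It is applied to t -> Re (u f(a + t v)),
    where u has modulus one and rotates f(a + v) - f(a) onto its modulus. *)
Lemma cmod_mvt f (A : R -> R[i]) a v (K : R) :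
  (forall t, 0 <= t <= 1 -> is_cderiv f (a + t%:C * v) (A t)) ->
  (forall t, 0 <= t <= 1 -> cmod (A t * v) <= K) ->
  cmod (f (a + v) - f a) <= K.
Proof.
move=> Hf HA; have [u u1 Hu] := complex_unit_of (f (a + v) - f a).
pose g (s : R) := complex.Re (u * f (a + s%:C * v)).
have dg (t : R) : 0 <= t <= 1 -> is_derive t 1 g (complex.Re (u * (A t * v))).
  by move=> /Hf; apply: is_derive_Re_line.
have [||c c01 Hc] := MVT_segment (@ler01 R) (f := g) (df := fun t => complex.Re (u * (A t * v))).
- by move=> t; rewrite in_itv /= => /andP[? ?]; apply: dg; rewrite !ltW.
- by apply: derivable_within_continuous => t; rewrite in_itv /= => /dg[].
have E : cmod (f (a + v) - f a) = g 1 - g 0.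
  rewrite /g mul1r mul0r addr0 -ReB -mulrBr Hu //.
rewrite E Hc subr0 mulr1; apply: le_trans (Re_le _) _.
by rewrite cmodM u1 mul1r HA //; move: c01; rewrite in_itv.
Qed.

End MeanValue.

(** * The complex exponential *)

Section ComplexExp.
Context {R : realType}.
Implicit Types (z w h u v : R[i]).

Lemma cexpD z w : cexp (z + w) = cexp z * cexp w.
Proof.
apply: complex_eqP; case: z => a b; case: w => c d; rewrite /cexp /=;
  rewrite expRD cosD sinD; ring.
Qed.

Lemma cexp0 : cexp (0 : R[i]) = 1.
Proof.
by apply: complex_eqP; rewrite /cexp /= expR0 cos0 sin0 ?(mulr0, mul0r, mulr1, subr0, addr0).
Qed.

Lemma cexpNM z : cexp (- z) * cexp z = 1.
Proof. by rewrite -cexpD addNr cexp0. Qed.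

Lemma cexp_neq0 z : cexp z != 0.
Proof. by apply/eqP => E; have := cexpNM z; rewrite E mulr0 => /eqP; rewrite eq_sym oner_eq0. Qed.

Lemma cexpN z : cexp (- z) = (cexp z)^-1.
Proof. by apply: (mulIf (cexp_neq0 z)); rewrite cexpNM mulVf ?cexp_neq0. Qed.

Lemma cexpB z w : cexp (z - w) = cexp z / cexp w.
Proof. by rewrite cexpD cexpN. Qed.

Lemma cexp_sum (I : Type) (r : seq I) (F : I -> R[i]) :
  cexp (\sum_(i <- r) F i) = \prod_(i <- r) cexp (F i).
Proof.
elim: r => [|i r IH]; first by rewrite !big_nil cexp0.
by rewrite !big_cons cexpD IH.
Qed.

Lemma cmod_cexp z : cmod (cexp z) = expR (complex.Re z).
Proof.
rewrite cmodM cmod_real ger0_norm ?expR_ge0 // /cmod /= cos2Dsin2 sqrtr1.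
by rewrite mulr1.
Qed.

Lemma Re_cexp z : complex.Re (cexp z) = expR (complex.Re z) * cos (complex.Im z).
Proof. by rewrite ReM /= mul0r subr0. Qed.

Lemma Im_cexp z : complex.Im (cexp z) = expR (complex.Re z) * sin (complex.Im z).
Proof. by rewrite ImM /= mul0r addr0. Qed.

Lemma cexp_real (x : R) : cexp x%:C = (expR x)%:C.
Proof. by apply: complex_eqP; rewrite ?Re_cexp ?Im_cexp /= ?cos0 ?sin0 ?mulr1 ?mulr0. Qed.

Let real_expansion (g : R -> R) (a e : R) : is_derive (0 : R) 1 g a -> 0 < e ->
  exists2 d : R, 0 < d & forall x : R, `|x| < d -> `|g x - g 0 - a * x| <= e * `|x|.
Proof.
move=> /is_rderivP H /H[d d0 Hd]; exists d => // x /Hd.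
by rewrite add0r.
Qed.

Lemma is_cderiv_cexp0 : is_cderiv cexp (0 : R[i]) 1.
Proof.
move=> e e0.
(* The remainder is split below into four terms bounded by 4, 2, 1 and 2 times e1 r, whence the
   9. *)
have [e1 e10 [e1e e1_1]] : exists2 e1 : R, 0 < e1 & 9 * e1 <= e /\ e1 <= 1.
  exists (Num.min (e / 9) 1); first by rewrite lt_min ltr01 divr_gt0.
  by split; [rewrite -ler_pdivlMl // mulrC ge_min lexx|rewrite ge_min lexx orbT].
have [d1 d10 H1] := real_expansion (is_derive_expR 0) e10.
have [d2 d20 H2] := real_expansion (is_derive_cos 0) e10.
have [d3 d30 H3] := real_expansion (is_derive_sin 0) e10.
exists (Num.min (Num.min d1 d2) (Num.min d3 e1)); first by rewrite !lt_min d10 d20 d30.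
move=> h; rewrite !lt_min => /andP[/andP[h1 h2] /andP[h3 h4]].
rewrite add0r cexp0 mul1r.
have := normRe_le h; have := normIm_le h.
set r := cmod h in h1 h2 h3 h4 *.
move: h @r h1 h2 h3 h4 => [x y] /= ; set r := cmod _ => h1 h2 h3 h4 yr xr.
have r0 : 0 <= r by apply: cmod_ge0.
have {}H1 := H1 _ (le_lt_trans xr h1).
have {}H2 := H2 _ (le_lt_trans yr h2).
have {}H3 := H3 _ (le_lt_trans yr h3).
rewrite expR0 mul1r in H1; rewrite cos0 sin0 oppr0 mul0r subr0 in H2.
rewrite sin0 cos0 mul1r subr0 in H3.
set al := expR x - 1 - x in H1; set c := cos y - 1 in H2; set s := sin y - y in H3.
have {}H1 : `|al| <= e1 * r by apply: le_trans H1 _; rewrite ler_pM2l.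
have {}H2 : `|c| <= e1 * r by apply: le_trans H2 _; rewrite ler_pM2l.
have {}H3 : `|s| <= e1 * r by apply: le_trans H3 _; rewrite ler_pM2l.
pose b : R[i] := c +i* s; pose iy : R[i] := 0 +i* y.
have -> : cexp (x +i* y) - 1 - (x +i* y) =
    al%:C * (1 + iy + b) + x%:C * b + x%:C * iy + b.
  by apply: complex_eqP; rewrite /cexp /b /iy /al /c /s /=; ring.
have nb : cmod b <= 2 * (e1 * r).
  by apply: le_trans (cmod_leD _) _; rewrite /= mulr2n mulrDl mul1r lerD.
have niy : cmod iy <= r.
  by apply: le_trans (cmod_leD _) _; rewrite /= normr0 add0r.
have r1 : r <= 1 by lra.
have er : 0 <= e1 * r <= 1.
  by apply/andP; split; nra.
have B1 : cmod (al%:C * (1 + iy + b)) <= e1 * r * 4.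
  rewrite cmodM cmod_real ler_pM ?normr_ge0 ?cmod_ge0 //.
  apply: le_trans (cmodD _ _) _; have := cmodD 1 iy; rewrite cmod1; lra.
have B2 : cmod (x%:C * b) <= 1 * (2 * (e1 * r)).
  by rewrite cmodM cmod_real ler_pM ?normr_ge0 ?cmod_ge0 //; lra.
have B3 : cmod (x%:C * iy) <= e1 * r.
  by rewrite cmodM cmod_real ler_pM ?normr_ge0 ?cmod_ge0 //; lra.
have := cmodD (al%:C * (1 + iy + b) + x%:C * b + x%:C * iy) b.
have := cmodD (al%:C * (1 + iy + b) + x%:C * b) (x%:C * iy).
have := cmodD (al%:C * (1 + iy + b)) (x%:C * b).
have : 9 * e1 * r <= e * r by rewrite ler_wpM2r.
lra.
Qed.

Lemma is_cderiv_cexp z : is_cderiv cexp z (cexp z).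
Proof.
have H : is_cderiv (fun w => cexp z * cexp (w - z)) z (cexp z * (1 * (1 - 0))).
  apply: is_cderivZ; apply: (@is_cderiv_comp _ cexp (fun w => w - z)).
    by rewrite subrr; apply: is_cderiv_cexp0.
  by apply: is_cderivB; [apply: is_cderiv_id|apply: is_cderiv_cst].
have -> : cexp = fun w => cexp z * cexp (w - z).
  by apply/funext => w; rewrite -cexpD; congr cexp; ring.
by apply: is_cderiv_eq H _; rewrite subr0 !mulr1 subrr cexp0 mulr1.
Qed.

Lemma holo_cexp (f : R[i] -> R[i]) z : holo f z -> holo (fun w => cexp (f w)) z.
Proof. by apply: holo_comp; exists (cexp (f z)); apply: is_cderiv_cexp. Qed.

Lemma cexp_lip u v (m : R) : complex.Re u <= m -> complex.Re (u + v) <= m ->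
  cmod (cexp (u + v) - cexp u) <= cmod v * expR m.
Proof.
move=> um uvm; apply: (@cmod_mvt _ cexp (fun t => cexp (u + t%:C * v))).
  by move=> t _; apply: is_cderiv_cexp.
move=> t /andP[t0 t1]; rewrite cmodM mulrC ler_wpM2l ?cmod_ge0 // cmod_cexp ler_expR.
move: uvm; rewrite !ReD ReM /= mul0r subr0; nra.
Qed.

(** Mean value inequality for w -> exp w - w exp u, whose derivative exp w - exp u is bounded by
    [cexp_lip]; this gives the constant 1 rather than 1/2. The bound m at both ends holds on the
    whole segment. *)
Lemma cexp_taylor u v (m : R) : complex.Re u <= m -> complex.Re (u + v) <= m ->
  cmod (cexp (u + v) - cexp u - v * cexp u) <= cmod v ^+ 2 * expR m.
Proof.
move=> um uvm.
have -> : cexp (u + v) - cexp u - v * cexp u =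
  (cexp (u + v) - cexp u * (u + v)) - (cexp u - cexp u * u) by ring.
apply: (@cmod_mvt _ (fun w => cexp w - cexp u * w)
  (fun t => cexp (u + t%:C * v) - cexp u * 1)).
  move=> t _; apply: is_cderivB; first exact: is_cderiv_cexp.
  by apply: is_cderivZ; apply: is_cderiv_id.
move=> t /andP[t0 t1]; rewrite mulr1 cmodM expr2 -mulrA [cmod v * expR m]mulrC mulrA.
rewrite ler_wpM2r ?cmod_ge0 //.
apply: le_trans (@cexp_lip u (t%:C * v) m um _) _.
  by move: uvm; rewrite !ReD ReM /= mul0r subr0; nra.
rewrite ler_wpM2r ?expR_ge0 // cmodM cmod_real ger0_norm //.
by rewrite ler_piMl ?cmod_ge0.
Qed.

End ComplexExp.

(** * The principal logarithm on the right half-plane *)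

Section ComplexLog.
Context {R : realType}.
Implicit Types (z w h u v a b : R[i]).

(** On the right half-plane the two branches of [carg] merge into one arctangent, which is
    1-Lipschitz. *)
Lemma carg_atan w : 0 < complex.Re w -> carg w = atan (complex.Im w / complex.Re w).
Proof.
case: w => x y /= x0; rewrite /carg /=.
have aux (t : R) : 0 <= t -> acos (x / Num.sqrt (x ^+ 2 + (x * t) ^+ 2)) = atan t.
  move=> t0; have -> : x / Num.sqrt (x ^+ 2 + (x * t) ^+ 2) = cos (atan t).
    have -> : x ^+ 2 + (x * t) ^+ 2 = x ^+ 2 * (1 + t ^+ 2) by ring.
    rewrite cos_atan sqrtrM ?sqr_ge0 // sqrtr_sqr gtr0_norm //.
    by rewrite invfM mulrA divff ?mul1r // lt0r_neq0.
  apply: cosK; rewrite in_itv /= -[0]atan0 le_atan //=.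
  apply: ltW; apply: lt_trans (atan_ltpi2 _) _.
  by rewrite ltr_pdivrMr // ltr_pMr ?pi_gt0 // ltr1n.
rewrite /cmod /=; case: ifPn => [y0|]; last rewrite -ltNge => y0.
  have := aux (y / x) (divr_ge0 y0 (ltW x0)).
  by rewrite [x * (y / x)]mulrC divfK // lt0r_neq0.
rewrite -[RHS]opprK -atanN -mulNr.
have := aux (- y / x); rewrite [x * (- y / x)]mulrC divfK ?lt0r_neq0 // sqrrN => ->//.
by rewrite divr_ge0 ?ltW // oppr_gt0.
Qed.

Lemma half_plane_neq0 w : 0 < complex.Re w -> w != 0.
Proof. by move=> w0; apply/eqP => E; move: w0; rewrite E ltxx. Qed.

Lemma log0K w : 0 < complex.Re w -> cexp (log0 w) = w.
Proof.
move=> w0; rewrite /log0 carg_atan //.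
have wp : 0 < cmod w by rewrite cmod_gt0 half_plane_neq0.
case: w w0 wp => x y /= x0 wp.
have x1 : x != 0 by rewrite lt0r_neq0.
have Em : cmod (x +i* y) = x * Num.sqrt (1 + (y / x) ^+ 2).
  rewrite /cmod /=; have -> : x ^+ 2 + y ^+ 2 = x ^+ 2 * (1 + (y / x) ^+ 2) by field.
  by rewrite sqrtrM ?sqr_ge0 // sqrtr_sqr gtr0_norm.
have s0 : Num.sqrt (1 + (y / x) ^+ 2) != 0.
  by apply: lt0r_neq0; rewrite sqrtr_gt0 ltr_pwDl ?sqr_ge0.
have Ec : cos (atan (y / x)) = x / cmod (x +i* y).
  by rewrite cos_atan Em; field; rewrite x1 s0.
have Es : sin (atan (y / x)) = y / cmod (x +i* y).
  have : tan (atan (y / x)) = y / x by apply: atanK.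
  rewrite /tan Ec => /(congr1 (fun t => t * (x / cmod (x +i* y)))).
  rewrite divfK ?mulf_neq0 ?invr_neq0 ?lt0r_neq0 // => ->.
  by field; rewrite x1 lt0r_neq0.
apply: complex_eqP; rewrite ?Re_cexp ?Im_cexp /= ?Ec ?Es lnK ?posrE // mulrC divfK //;
  by rewrite lt0r_neq0.
Qed.

Lemma log0_real (r : R) : 0 < r -> log0 r%:C = (ln r)%:C.
Proof.
move=> r0; rewrite /log0 carg_atan //= mul0r atan0 cmod_real gtr0_norm //.
Qed.

Lemma atan_lip (s t : R) : `|atan s - atan t| <= `|s - t|.
Proof.
wlog st : s t / t <= s.
  move=> W; have [|/ltW] := leP t s; first exact: W.
  by move=> /W; rewrite distrC [in leRHS]distrC.
have [|c _ ->] := MVT_segment st (f := atan) (df := fun x => (1 + x ^+ 2)^-1).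
  by apply: derivable_within_continuous => x _; apply: derivable_atan.
rewrite normrM ler_piMl // ger0_norm ?invr_ge0 ?addr_ge0 ?sqr_ge0 //.
by rewrite invf_le1 ?ltr_pwDl ?sqr_ge0 // lerDl sqr_ge0.
Qed.

Lemma ln_lip (m s t : R) : 0 < m -> m <= s -> m <= t -> `|ln s - ln t| <= `|s - t| / m.
Proof.
move=> m0; wlog st : s t / t <= s.
  move=> W ms mt; have [ts|/ltW ts] := leP t s; first exact: W.
  by rewrite distrC [in leRHS]distrC; apply: W.
move=> ms mt; have s0 := lt_le_trans m0 ms; have t0 := lt_le_trans m0 mt.
rewrite ger0_norm ?subr_ge0 ?ler_ln ?posrE // -ln_div ?posrE //.
have := le_ln1Dx (x := s / t - 1).
have -> : 1 + (s / t - 1) = s / t by ring.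
move=> H; apply: le_trans (H _) _; first by have := divr_gt0 s0 t0; lra.
have -> : s / t - 1 = (s - t) / t by field; rewrite lt0r_neq0.
rewrite ger0_norm ?subr_ge0 // ler_wpM2l ?subr_ge0 // lef_pV2 ?posrE //.
Qed.

(** A crude bound that suffices for the derivative: with v = log0 (w + h) - log0 w one has h / w =
    exp v - 1, and v = O(h) turns this into h / w = v + O(h^2). *)
Lemma log0_loclip w : 0 < complex.Re w -> exists2 K : R, 0 < K &
  forall h, cmod h <= complex.Re w / 2 -> cmod (log0 (w + h) - log0 w) <= K * cmod h.
Proof.
move=> w0; set x := complex.Re w; set y := complex.Im w.
have x0 : 0 < x by [].
exists (2 / x + (2 / x + 2 * `|y| / x ^+ 2)).
  have p1 : 0 < 2 / x by rewrite divr_gt0.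
  have p2 : 0 <= 2 * `|y| / x ^+ 2 by apply: divr_ge0; [apply: mulr_ge0|exact: sqr_ge0].
  lra.
move=> h hx; have hr := normRe_le h; have hi := normIm_le h.
have x'2 : x / 2 <= complex.Re (w + h).
  rewrite ReD -/x; move: (ler_norm (- complex.Re h)); rewrite normrN; lra.
have x'0 : 0 < complex.Re (w + h) by lra.
have dm : `|cmod (w + h) - cmod w| <= cmod h.
  have := cmodD w h; have := cmodB (w + h) h; rewrite addrK ler_norml; lra.
apply: le_trans (cmod_leD _) _; rewrite ReB ImB /log0 /= !carg_atan // mulrDl.
apply: lerD.
  have mx : 0 < x / 2 by lra.
  have [m1 m2] : x / 2 <= cmod (w + h) /\ x / 2 <= cmod w.
    by split; [have := Re_le (w + h)|have := Re_le w]; rewrite -/x; lra.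
  apply: le_trans (ln_lip mx m1 m2) _.
  have -> : 2 / x * cmod h = cmod h / (x / 2) by field; rewrite lt0r_neq0.
  by rewrite ler_wpM2r // invr_ge0 ltW.
apply: le_trans (atan_lip _ _) _; rewrite ImD -/x -/y.
set X := complex.Re (w + h) in x'2 x'0 *.
have -> : (y + complex.Im h) / X - y / x = complex.Im h / X + y * (- complex.Re h) / (x * X).
  rewrite /X ReD -/x; field; rewrite !lt0r_neq0 //.
  by move: x'0; rewrite /X ReD.
have Xi : X^-1 <= 2 / x.
  have -> : 2 / x = (x / 2)^-1 by field; rewrite lt0r_neq0.
  by rewrite lef_pV2 ?posrE //; lra.
have Xp : 0 <= X^-1 by rewrite invr_ge0 ltW.
apply: le_trans (ler_normD _ _) _; rewrite mulrDl; apply: lerD.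
  by rewrite normrM mulrC (ger0_norm Xp) ler_pM.
rewrite !normrM normrN normfV normrM (gtr0_norm x0) (gtr0_norm x'0) invfM.
have -> : 2 * `|y| / x ^+ 2 * cmod h = `|y| * cmod h * (x^-1 * (2 / x)).
  by field; rewrite lt0r_neq0.
have x_0 : 0 <= x^-1 by rewrite invr_ge0 ltW.
rewrite ler_pM ?mulr_ge0 ?(ltW x'0) //.
  by rewrite ler_wpM2l // (le_trans _ hr) // ler_norm.
by rewrite ler_wpM2l.
Qed.

Lemma is_cderiv_log0 w : 0 < complex.Re w -> is_cderiv log0 w w^-1.
Proof.
move=> w0; have [K K0 HK] := log0_loclip w0 => e e0.
have E0 : 0 < K ^+ 2 * expR 1 by rewrite mulr_gt0 ?exprn_gt0 ?expR_gt0.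
exists (Num.min (complex.Re w / 2) (Num.min K^-1 (e / (K ^+ 2 * expR 1)))).
  rewrite !lt_min invr_gt0 K0 (divr_gt0 e0 E0) andbT.
  by rewrite divr_gt0.
move=> h; rewrite !lt_min => /andP[h1 /andP[h2 h3]].
have h0 := cmod_ge0 h.
set v := log0 (w + h) - log0 w.
have vK : cmod v <= K * cmod h by apply: HK; apply: ltW.
have wh0 : 0 < complex.Re (w + h).
  rewrite ReD; have := normRe_le h; move: (ler_norm (- complex.Re h)); rewrite normrN; lra.
have Ev : w^-1 * h = cexp v - 1.
  rewrite /v cexpB !log0K //; field; exact: half_plane_neq0.
have v1 : complex.Re (0 + v) <= 1.
  rewrite add0r; apply: le_trans (Re_le _) _; apply: le_trans vK _.
  by rewrite mulrC -ler_pdivlMr // div1r ltW.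
have := cexp_taylor (@ler01 R : complex.Re (0 : R[i]) <= 1) v1.
rewrite add0r cexp0 mulr1 -Ev cmodBC => /le_trans; apply.
apply: le_trans (_ : (K * cmod h) ^+ 2 * expR 1 <= _).
  by rewrite ler_wpM2r ?expR_ge0 // lerXn2r ?nnegrE ?mulr_ge0 ?cmod_ge0 // ltW.
rewrite exprMn mulrAC expr2 mulrA ler_wpM2r // mulrC -ler_pdivlMr //.
exact: ltW.
Qed.

Lemma holo_log0 (f : R[i] -> R[i]) z : 0 < complex.Re (f z) -> holo f z ->
  holo (fun w => log0 (f w)) z.
Proof. by move=> fz; apply: holo_comp; exists (f z)^-1; apply: is_cderiv_log0. Qed.

(** The half-plane Re >= m is convex, so |1/w - 1/a| <= |b - a| / m^2 along the segment; the mean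
    value inequality is applied to w -> log0 w - w / a. *)
Lemma log0_taylor a b (m : R) : 0 < m -> m <= complex.Re a -> m <= complex.Re b ->
  cmod (log0 b - log0 a - (b - a) / a) <= (cmod (b - a) / m) ^+ 2.
Proof.
move=> m0 ma mb; have a0 : a != 0 by apply: half_plane_neq0; lra.
have -> : log0 b - log0 a - (b - a) / a =
  (log0 (a + (b - a)) - a^-1 * (a + (b - a))) - (log0 a - a^-1 * a).
  have -> : a + (b - a) = b by ring.
  by field.
have Rt t : 0 <= t <= 1 -> m <= complex.Re (a + t%:C * (b - a)).
  by move=> /andP[t0 t1]; rewrite ReD ReM ReB /= mul0r subr0; nra.
apply: (@cmod_mvt _ (fun w => log0 w - a^-1 * w)
  (fun t => (a + t%:C * (b - a))^-1 - a^-1 * 1)).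
  move=> t t01; apply: is_cderivB; last by apply: is_cderivZ; apply: is_cderiv_id.
  by apply: is_cderiv_log0; apply: lt_le_trans (Rt _ t01).
move=> t t01; have Rt' := Rt _ t01; set w := a + _ in Rt' *.
have w0 : w != 0 by apply: half_plane_neq0; lra.
have -> : (w^-1 - a^-1 * 1) * (b - a) = - (t%:C * (b - a) ^+ 2 / (w * a)).
  by rewrite /w; field; rewrite a0 -/w.
rewrite cmodN cmodM cmodV !cmodM cmod_real expr_div_n ger0_norm; last by case/andP: t01.
have wm : m <= cmod w by apply: le_trans Rt' (Re_le _).
have am : m <= cmod a by apply: le_trans ma (Re_le _).
rewrite ler_pM ?mulr_ge0 ?invr_ge0 ?mulr_ge0 ?cmod_ge0 //; first by case/andP: t01.
  by rewrite -expr2 ler_piMl ?sqr_ge0 //; case/andP: t01.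
have wa0 : 0 < cmod w * cmod a by apply: mulr_gt0; apply: lt_le_trans m0 _.
rewrite lef_pV2 ?posrE ?exprn_gt0 // expr2.
by apply: ler_pM => //; apply: ltW.
Qed.

End ComplexLog.

(** * Integrals over rectangles and the Cauchy formula *)

Section ComplexIntegral.
Context {d : measure_display} {T : measurableType d} {R : realType}.
Variables (mu : {measure set T -> \bar R}) (D : set T).
Hypothesis mD : measurable D.
Implicit Types (f g : T -> R[i]) (c : R[i]).

Let RI (f : T -> R) := mu.-integrable D (fun x => (f x)%:E).

Let RID (f g : T -> R) : RI f -> RI g -> RI (fun x => f x + g x).
Proof.
move=> hf hg; apply: (eq_integrable mD _ _ _ (integrableD mD hf hg)).
by move=> x _; rewrite EFinD.
Qed.

Let RIZ (k : R) (f : T -> R) : RI f -> RI (fun x => k * f x).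
Proof.
move=> hf; apply: (eq_integrable mD _ _ _ (integrableZl mD k hf)).
by move=> x _; rewrite EFinM.
Qed.

Let RIB (f g : T -> R) : RI f -> RI g -> RI (fun x => f x - g x).
Proof.
move=> hf hg; apply: (eq_integrable mD _ _ _ (integrableB mD hf hg)).
by move=> x _; rewrite EFinB.
Qed.

Lemma eq_cintegrable f g : (forall x, D x -> f x = g x) ->
  cintegrable mu D f -> cintegrable mu D g.
Proof.
move=> fg [h1 h2]; split; [apply: (eq_integrable mD _ _ _ h1)|
  apply: (eq_integrable mD _ _ _ h2)]; by move=> x xD; rewrite fg //; exact: set_mem.
Qed.

Lemma eq_cintegral f g : (forall x, D x -> f x = g x) ->
  cintegral mu D f = cintegral mu D g.
Proof.
by move=> fg; rewrite /cintegral; congr Complex; apply: eq_Rintegral => x xD;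
  rewrite fg //; exact: set_mem.
Qed.

Lemma cintegrableD f g : cintegrable mu D f -> cintegrable mu D g ->
  cintegrable mu D (fun x => f x + g x).
Proof.
move=> [f1 f2] [g1 g2]; split.
  by apply: (eq_integrable mD _ _ _ (RID f1 g1)) => x _; rewrite ReD.
by apply: (eq_integrable mD _ _ _ (RID f2 g2)) => x _; rewrite ImD.
Qed.

Lemma cintegrableZ c f : cintegrable mu D f -> cintegrable mu D (fun x => c * f x).
Proof.
move=> [f1 f2]; split.
  apply: (eq_integrable mD _ _ _ (RIB (RIZ (complex.Re c) f1) (RIZ (complex.Im c) f2))).
  by move=> x _; rewrite ReM.
apply: (eq_integrable mD _ _ _ (RID (RIZ (complex.Re c) f2) (RIZ (complex.Im c) f1))).
by move=> x _; rewrite ImM.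
Qed.

Lemma cintegrableN f : cintegrable mu D f -> cintegrable mu D (fun x => - f x).
Proof.
move=> /(cintegrableZ (-1)); apply: eq_cintegrable => x _; by rewrite mulN1r.
Qed.

Lemma cintegrableB f g : cintegrable mu D f -> cintegrable mu D g ->
  cintegrable mu D (fun x => f x - g x).
Proof. by move=> hf hg; apply: cintegrableD => //; apply: cintegrableN. Qed.

Lemma cintegralD f g : cintegrable mu D f -> cintegrable mu D g ->
  cintegral mu D (fun x => f x + g x) = cintegral mu D f + cintegral mu D g.
Proof.
move=> [f1 f2] [g1 g2]; apply: complex_eqP => /=; rewrite -RintegralD //;
  by apply: eq_Rintegral => x _; rewrite ?ReD ?ImD.
Qed.

Lemma cintegralZ c f : cintegrable mu D f ->
  cintegral mu D (fun x => c * f x) = c * cintegral mu D f.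
Proof.
move=> [f1 f2]; apply: complex_eqP; rewrite ?ReM ?ImM /=.
  rewrite -!RintegralZl // -RintegralB //; try exact: RIZ.
  by apply: eq_Rintegral => x _; rewrite ReM.
rewrite -!RintegralZl // -RintegralD //; try exact: RIZ.
by apply: eq_Rintegral => x _; rewrite ImM.
Qed.

Lemma cintegralN f : cintegrable mu D f ->
  cintegral mu D (fun x => - f x) = - cintegral mu D f.
Proof.
move=> hf; rewrite -mulN1r -cintegralZ //; by apply: eq_cintegral => x _; rewrite mulN1r.
Qed.

Lemma cintegralB f g : cintegrable mu D f -> cintegrable mu D g ->
  cintegral mu D (fun x => f x - g x) = cintegral mu D f - cintegral mu D g.
Proof.
by move=> hf hg; rewrite cintegralD // ?cintegralN //; apply: cintegrableN.
Qed.

(** A rotation makes the integral real and nonnegative; monotonicity of the real integral does the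
    rest. *)
Lemma cmod_cintegral_le f (g : T -> R) : cintegrable mu D f -> RI g ->
  (forall x, D x -> cmod (f x) <= g x) ->
  cmod (cintegral mu D f) <= \int[mu]_(x in D) g x.
Proof.
move=> hf hg fg; have [u u1 Hu] := complex_unit_of (cintegral mu D f).
have -> : cmod (cintegral mu D f) = complex.Re (cintegral mu D (fun x => u * f x)).
  by rewrite cintegralZ // Hu.
apply: le_Rintegral => //; first by case: (cintegrableZ u hf).
by move=> x xD; apply: le_trans (Re_le _) _; rewrite cmodM u1 mul1r fg.
Qed.

Lemma cintegrable_le f (g : T -> R) :
  measurable_fun D (fun x => complex.Re (f x)) ->
  measurable_fun D (fun x => complex.Im (f x)) -> RI g ->
  (forall x, D x -> cmod (f x) <= g x) -> cintegrable mu D f.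
Proof.
move=> m1 m2 hg fg; split.
  apply: (le_integrable mD _ _ hg); first exact/measurable_EFinP.
  move=> x xD; rewrite /= lee_fin; apply: le_trans (le_trans (fg _ xD) (ler_norm _)).
  exact: normRe_le.
apply: (le_integrable mD _ _ hg); first exact/measurable_EFinP.
move=> x xD; rewrite /= lee_fin; apply: le_trans (le_trans (fg _ xD) (ler_norm _)).
exact: normIm_le.
Qed.

End ComplexIntegral.

Section LineIntegral.
Context {R : realType}.
Notation leb := (@lebesgue_measure R).
Implicit Types (f g : R -> R[i]) (a b c : R).

Definition ccont_at f (t : R) := forall e : R, 0 < e -> exists2 d : R, 0 < d &
  forall h : R, `|h| < d -> cmod (f (t + h) - f t) <= e.

Definition lint a b f : R[i] := cintegral leb `[a, b] f.

Let cont_comp (p : R[i] -> R) f a b : (forall z w, `|p z - p w| <= cmod (z - w)) ->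
  (forall t, a <= t <= b -> ccont_at f t) ->
  leb.-integrable `[a, b] (fun t => (p (f t))%:E).
Proof.
move=> Hp Hf; apply: (@continuous_compact_integrable R (fun t => p (f t))).
  exact: segment_compact.
apply: continuous_in_subspaceT => t /[!inE] /=; rewrite in_itv /= => /Hf Ht.
apply/cvgrPdist_le => e /Ht[d d0 Hd]; apply/nbhs_ballP; exists d => //= s.
rewrite /ball /= => ts; apply: le_trans (Hp _ _) _.
rewrite cmodBC; have -> : s = t + (s - t) by ring.
by apply: Hd; rewrite distrC.
Qed.

Lemma lintegrable f a b : (forall t, a <= t <= b -> ccont_at f t) ->
  cintegrable leb `[a, b] f.
Proof.
move=> H; split; apply: cont_comp => // z w; rewrite -?ReB -?ImB;
  [exact: normRe_le|exact: normIm_le].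
Qed.

Lemma lint_cat f a b c : a <= b -> b <= c -> cintegrable leb `[a, c] f ->
  lint a c f = lint a b f + lint b c f.
Proof.
move=> ab bc [h1 h2].
have aux (p : R -> R) : leb.-integrable `[a, c] (fun t => (p t)%:E) ->
    \int[leb]_(t in `[a, c]) p t =
    \int[leb]_(t in `[a, b]) p t + \int[leb]_(t in `[b, c]) p t.
  move=> hp; have := @Rintegral_itvB R p (BLeft a) (BRight c) b hp.
  rewrite !bnd_simp => /(_ ab bc) E.
  rewrite -(subrK (\int[leb]_(t in `[a, b]) p t) (\int[leb]_(t in `[a, c]) p t)) E.
  rewrite addrC; congr (_ + _); apply: Rintegral_itv_obnd_cbnd.
  apply: (integrableS _ _ _ hp) => //; apply: subset_itvr; rewrite bnd_simp //.
by rewrite /lint; apply: complex_eqP; rewrite ?ReD ?ImD /= aux.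
Qed.

Let cst_int a b (K : R) : leb.-integrable `[a, b] (fun=> K%:E).
Proof.
apply: (@continuous_compact_integrable R (fun=> K)); first exact: segment_compact.
by apply: continuous_subspaceT; apply: cst_continuous.
Qed.

Lemma Rint_cst a b (K : R) : a <= b -> \int[leb]_(t in `[a, b]) K = K * (b - a).
Proof.
move=> ab; rewrite Rintegral_cst //= lebesgue_measure_itv /= lte_fin.
case: ltP => [//|ba]; have -> : b = a by apply/le_anti; rewrite ab ba.
by rewrite subrr.
Qed.

Lemma lint_le f a b (K : R) : a <= b -> cintegrable leb `[a, b] f ->
  (forall t, a <= t <= b -> cmod (f t) <= K) -> cmod (lint a b f) <= K * (b - a).
Proof.
by move=> ab hf H; rewrite -Rint_cst //; apply: cmod_cintegral_le.
Qed.

Lemma lint_cst a b (c : R[i]) : a <= b -> lint a b (fun=> c) = c * (b - a)%:C.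
Proof.
move=> ab; apply: complex_eqP; rewrite ?ReM ?ImM /= Rint_cst //; ring.
Qed.

Lemma Re_lint_ge f a b (K : R) : a <= b -> cintegrable leb `[a, b] f ->
  (forall t, a <= t <= b -> K <= complex.Re (f t)) -> K * (b - a) <= complex.Re (lint a b f).
Proof.
move=> ab [hf _] H; rewrite -Rint_cst //; apply: le_Rintegral => //.
exact: cst_int.
Qed.

Lemma Im_lint_ge f a b (K : R) : a <= b -> cintegrable leb `[a, b] f ->
  (forall t, a <= t <= b -> K <= complex.Im (f t)) -> K * (b - a) <= complex.Im (lint a b f).
Proof.
move=> ab [_ hf] H; rewrite -Rint_cst //; apply: le_Rintegral => //.
exact: cst_int.
Qed.

End LineIntegral.

Section RectangleIntegral.
Context {R : realType}.
Notation leb := (@lebesgue_measure R).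
Implicit Types (f g : R[i] -> R[i]) (x y : R).

Definition hint f x1 x2 y : R[i] := lint x1 x2 (fun x => f (x +i* y)).
Definition vint f x y1 y2 : R[i] := 'i * lint y1 y2 (fun y => f (x +i* y)).

(** Counterclockwise; the factor i of dw = i dy sits in [vint]. *)
Definition oint f x1 x2 y1 y2 : R[i] :=
  hint f x1 x2 y1 + vint f x2 y1 y2 - hint f x1 x2 y2 - vint f x1 y1 y2.

Definition hcont f x1 x2 y := forall x, x1 <= x <= x2 -> holo f (x +i* y).
Definition vcont f x y1 y2 := forall y, y1 <= y <= y2 -> holo f (x +i* y).

Lemma hcont_int f x1 x2 y : hcont f x1 x2 y ->
  cintegrable leb `[x1, x2] (fun x => f (x +i* y)).
Proof.
move=> H; apply: lintegrable => t /H /holo_cont Ht e /Ht[d d0 Hd]; exists d => // h hd.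
have -> : (t + h) +i* y = (t +i* y) + h%:C by apply: complex_eqP; rewrite /= ?addr0.
by apply: Hd; rewrite cmod_real.
Qed.

Lemma vcont_int f x y1 y2 : vcont f x y1 y2 ->
  cintegrable leb `[y1, y2] (fun y => f (x +i* y)).
Proof.
move=> H; apply: lintegrable => t /H /holo_cont Ht e /Ht[d d0 Hd]; exists d => // h hd.
have -> : x +i* (t + h) = (x +i* t) + 'i * h%:C.
  by apply: complex_eqP; rewrite /=; ring.
by apply: Hd; rewrite cmodM cmod_i mul1r cmod_real.
Qed.

Lemma hint_cat f x1 x2 x3 y : x1 <= x2 -> x2 <= x3 -> hcont f x1 x3 y ->
  hint f x1 x3 y = hint f x1 x2 y + hint f x2 x3 y.
Proof. by move=> ? ? /hcont_int; apply: lint_cat. Qed.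

Lemma vint_cat f x y1 y2 y3 : y1 <= y2 -> y2 <= y3 -> vcont f x y1 y3 ->
  vint f x y1 y3 = vint f x y1 y2 + vint f x y2 y3.
Proof. by move=> ? ? /vcont_int H; rewrite /vint (lint_cat (b := y2)) // mulrDr. Qed.

Lemma hintB f g x1 x2 y : hcont f x1 x2 y -> hcont g x1 x2 y ->
  hint (fun w => f w - g w) x1 x2 y = hint f x1 x2 y - hint g x1 x2 y.
Proof. by move=> /hcont_int hf /hcont_int hg; rewrite /hint /lint cintegralB. Qed.

Lemma vintB f g x y1 y2 : vcont f x y1 y2 -> vcont g x y1 y2 ->
  vint (fun w => f w - g w) x y1 y2 = vint f x y1 y2 - vint g x y1 y2.
Proof.
by move=> /vcont_int hf /vcont_int hg; rewrite /vint /lint cintegralB // mulrBr.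
Qed.

Lemma hintZ c f x1 x2 y : hcont f x1 x2 y ->
  hint (fun w => c * f w) x1 x2 y = c * hint f x1 x2 y.
Proof. by move=> /hcont_int hf; rewrite /hint /lint cintegralZ. Qed.

Lemma vintZ c f x y1 y2 : vcont f x y1 y2 ->
  vint (fun w => c * f w) x y1 y2 = c * vint f x y1 y2.
Proof. by move=> /vcont_int hf; rewrite /vint /lint cintegralZ // mulrCA. Qed.

Lemma hint_le f x1 x2 y (K : R) : x1 <= x2 -> hcont f x1 x2 y ->
  (forall x, x1 <= x <= x2 -> cmod (f (x +i* y)) <= K) ->
  cmod (hint f x1 x2 y) <= K * (x2 - x1).
Proof. by move=> x12 /hcont_int hf H; apply: lint_le. Qed.

Lemma vint_le f x y1 y2 (K : R) : y1 <= y2 -> vcont f x y1 y2 ->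
  (forall y, y1 <= y <= y2 -> cmod (f (x +i* y)) <= K) ->
  cmod (vint f x y1 y2) <= K * (y2 - y1).
Proof.
by move=> y12 /vcont_int hf H; rewrite cmodM cmod_i mul1r; apply: lint_le.
Qed.

Definition bcont f x1 x2 y1 y2 :=
  [/\ hcont f x1 x2 y1, hcont f x1 x2 y2, vcont f x1 y1 y2 & vcont f x2 y1 y2].

Definition boundary x1 x2 y1 y2 (w : R[i]) :=
  exists x y, [/\ w = x +i* y, x1 <= x <= x2, y1 <= y <= y2 &
    [\/ x = x1, x = x2, y = y1 | y = y2]].

Lemma bcontP f x1 x2 y1 y2 : x1 <= x2 -> y1 <= y2 ->
  (forall w, boundary x1 x2 y1 y2 w -> holo f w) -> bcont f x1 x2 y1 y2.
Proof.
move=> x12 y12 H; split=> t t12; apply: H.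
- by exists t, y1; split; rewrite ?lexx //; apply: Or43.
- by exists t, y2; split; rewrite ?lexx ?andbT //; apply: Or44.
- by exists x1, t; split; rewrite ?lexx //; apply: Or41.
- by exists x2, t; split; rewrite ?lexx ?andbT //; apply: Or42.
Qed.

Lemma ointB f g x1 x2 y1 y2 : bcont f x1 x2 y1 y2 -> bcont g x1 x2 y1 y2 ->
  oint (fun w => f w - g w) x1 x2 y1 y2 = oint f x1 x2 y1 y2 - oint g x1 x2 y1 y2.
Proof.
move=> [f1 f2 f3 f4] [g1 g2 g3 g4]; rewrite /oint !(hintB, vintB) //; ring.
Qed.

Lemma ointZ c f x1 x2 y1 y2 : bcont f x1 x2 y1 y2 ->
  oint (fun w => c * f w) x1 x2 y1 y2 = c * oint f x1 x2 y1 y2.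
Proof. by move=> [f1 f2 f3 f4]; rewrite /oint !(hintZ, vintZ) //; ring. Qed.

Lemma oint_le f x1 x2 y1 y2 (K : R) : x1 <= x2 -> y1 <= y2 -> bcont f x1 x2 y1 y2 ->
  (forall w, boundary x1 x2 y1 y2 w -> cmod (f w) <= K) ->
  cmod (oint f x1 x2 y1 y2) <= 2 * K * ((x2 - x1) + (y2 - y1)).
Proof.
move=> x12 y12 [f1 f2 f3 f4] H.
have B1 : cmod (hint f x1 x2 y1) <= K * (x2 - x1).
  apply: hint_le => // t t12; apply: H.
  by exists t, y1; split; rewrite ?lexx //; apply: Or43.
have B2 : cmod (hint f x1 x2 y2) <= K * (x2 - x1).
  apply: hint_le => // t t12; apply: H.
  by exists t, y2; split; rewrite ?lexx ?andbT //; apply: Or44.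
have B3 : cmod (vint f x1 y1 y2) <= K * (y2 - y1).
  apply: vint_le => // t t12; apply: H.
  by exists x1, t; split; rewrite ?lexx //; apply: Or41.
have B4 : cmod (vint f x2 y1 y2) <= K * (y2 - y1).
  apply: vint_le => // t t12; apply: H.
  by exists x2, t; split; rewrite ?lexx ?andbT //; apply: Or42.
rewrite /oint.
have := cmodB (hint f x1 x2 y1 + vint f x2 y1 y2 - hint f x1 x2 y2) (vint f x1 y1 y2).
have := cmodB (hint f x1 x2 y1 + vint f x2 y1 y2) (hint f x1 x2 y2).
have := cmodD (hint f x1 x2 y1) (vint f x2 y1 y2).
lra.
Qed.

(** On opposite sides the integrands differ by a constant, so each pair is computed at once, and the
    horizontal and vertical contributions cancel. An affine function is the comparison function in
    Goursat's argument. *)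
Lemma oint_affine (c A p : R[i]) x1 x2 y1 y2 : x1 <= x2 -> y1 <= y2 ->
  oint (fun w => c + A * (w - p)) x1 x2 y1 y2 = 0.
Proof.
move=> x12 y12; set f := fun w => _.
have hf w : holo f w.
  apply: holoD; first exact: holo_cst.
  apply: holoM; first exact: holo_cst.
  by apply: holoB; [apply: holo_id|apply: holo_cst].
have H : hint f x1 x2 y1 - hint f x1 x2 y2 =
    A * ('i * (y1 - y2)%:C) * (x2 - x1)%:C.
  rewrite /hint /lint -cintegralB //; try by apply: hcont_int => t _.
  rewrite -lint_cst //; apply: eq_cintegral => t _; rewrite /f.
  have -> : t +i* y1 = t%:C + 'i * y1%:C by rewrite [LHS]complexE.
  have -> : t +i* y2 = t%:C + 'i * y2%:C by rewrite [LHS]complexE.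
  rewrite rmorphB /=; ring.
have V : vint f x2 y1 y2 - vint f x1 y1 y2 =
    'i * (A * (x2 - x1)%:C * (y2 - y1)%:C).
  rewrite /vint -mulrBr /lint -cintegralB //; try by apply: vcont_int => t _.
  rewrite -lint_cst //; congr (_ * _); apply: eq_cintegral => t _; rewrite /f.
  have -> : x1 +i* t = x1%:C + 'i * t%:C by rewrite [LHS]complexE.
  have -> : x2 +i* t = x2%:C + 'i * t%:C by rewrite [LHS]complexE.
  rewrite rmorphB /=; ring.
have -> : oint f x1 x2 y1 y2 = (hint f x1 x2 y1 - hint f x1 x2 y2) +
  (vint f x2 y1 y2 - vint f x1 y1 y2) by rewrite /oint; ring.
rewrite H V !rmorphB /=; ring.
Qed.

Lemma oint_hsplit f x1 x2 x3 y1 y2 : x1 <= x2 -> x2 <= x3 ->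
  hcont f x1 x3 y1 -> hcont f x1 x3 y2 ->
  oint f x1 x3 y1 y2 = oint f x1 x2 y1 y2 + oint f x2 x3 y1 y2.
Proof.
move=> x12 x23 h1 h2; rewrite /oint (hint_cat x12 x23 h1) (hint_cat x12 x23 h2); ring.
Qed.

Lemma oint_vsplit f x1 x2 y1 y2 y3 : y1 <= y2 -> y2 <= y3 ->
  vcont f x1 y1 y3 -> vcont f x2 y1 y3 ->
  oint f x1 x2 y1 y3 = oint f x1 x2 y1 y2 + oint f x1 x2 y2 y3.
Proof.
move=> y12 y23 h1 h2; rewrite /oint (vint_cat y12 y23 h1) (vint_cat y12 y23 h2); ring.
Qed.

Definition holo_rect f x1 x2 y1 y2 := forall x y, x1 <= x <= x2 -> y1 <= y <= y2 ->
  holo f (x +i* y).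

Lemma holo_rect_sub f x1 x2 y1 y2 u1 u2 v1 v2 : holo_rect f x1 x2 y1 y2 ->
  x1 <= u1 -> u2 <= x2 -> y1 <= v1 -> v2 <= y2 -> holo_rect f u1 u2 v1 v2.
Proof.
move=> H a b c e x y /andP[x1' x2'] /andP[y1' y2']; apply: H; apply/andP; split;
  by [apply: le_trans a x1'|apply: le_trans x2' b|apply: le_trans c y1'|
      apply: le_trans y2' e].
Qed.

Lemma holo_rect_bcont f x1 x2 y1 y2 : x1 <= x2 -> y1 <= y2 ->
  holo_rect f x1 x2 y1 y2 -> bcont f x1 x2 y1 y2.
Proof. by move=> x12 y12 H; apply: bcontP => // w [x [y [-> hx hy _]]]; apply: H. Qed.

End RectangleIntegral.

(** * Goursat's lemma on rectangles *)

Section Goursat.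
Context {R : realType}.
Implicit Types (f g : R[i] -> R[i]) (x y a b : R).

Lemma halving_lt (W d : R) : 0 < d -> exists n, W / 2 ^+ n < d.
Proof.
move=> d0; exists (Num.truncn (W / d)).+1.
have p0 n : 0 < (2 : R) ^+ n by rewrite exprn_gt0.
rewrite ltr_pdivrMr // -ltr_pdivrMl // mulrC.
apply: lt_trans (truncnS_gt _) _.
by rewrite -natrX ltr_nat ltn_expl.
Qed.

(** Nested rectangles of sides W / 2^n and H / 2^n, encoded by their lower left corners. The common
    point c has as coordinates the suprema of those of the corners. *)
Lemma bisection (P : nat -> R * R -> Prop) (x y W H : R) : 0 <= W -> 0 <= H ->
  P 0%N (x, y) ->
  (forall n p, P n p -> exists q, [/\ P n.+1 q,
     p.1 <= q.1, q.1 + W / 2 ^+ n.+1 <= p.1 + W / 2 ^+ n,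
     p.2 <= q.2 & q.2 + H / 2 ^+ n.+1 <= p.2 + H / 2 ^+ n]) ->
  exists c : R * R, forall n, exists q, [/\ P n q,
     x <= q.1 <= c.1, c.1 <= q.1 + W / 2 ^+ n <= x + W,
     y <= q.2 <= c.2 & c.2 <= q.2 + H / 2 ^+ n <= y + H].
Proof.
move=> W0 H0 P0 Pstep.
(* The implication lets [choice] produce a function defined on all pairs; off P its value is
   arbitrary. *)
pose Q (np : nat * (R * R)) (q : R * R) := P np.1 np.2 -> [/\ P np.1.+1 q,
     np.2.1 <= q.1, q.1 + W / 2 ^+ np.1.+1 <= np.2.1 + W / 2 ^+ np.1,
     np.2.2 <= q.2 & q.2 + H / 2 ^+ np.1.+1 <= np.2.2 + H / 2 ^+ np.1].
have [|F HF] := @choice _ _ Q.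
  move=> [n p]; have [/Pstep[q hq]|nP] := pselect (P n p); first by exists q.
  by exists p.
pose s := fix s n : R * R := if n is m.+1 then F (m, s m) else (x, y).
have Ps n : P n (s n) by elim: n => // n /(HF (n, s n))[].
have nested (u : R * R -> R) (w : R) : 0 <= w ->
   (forall n, u (s n) <= u (s n.+1) /\
      u (s n.+1) + w / 2 ^+ n.+1 <= u (s n) + w / 2 ^+ n) ->
   exists c, forall n, u (s 0%N) <= u (s n) <= c /\
      c <= u (s n) + w / 2 ^+ n <= u (s 0%N) + w.
  move=> w0 Hu.
  have lo n m : (n <= m)%N -> u (s n) <= u (s m).
    move=> nm; rewrite -(subnK nm); elim: (m - n)%N => // k IH.
    by apply: le_trans IH (Hu _).1.
  have hi n m : (n <= m)%N -> u (s m) + w / 2 ^+ m <= u (s n) + w / 2 ^+ n.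
    move=> nm; rewrite -(subnK nm); elim: (m - n)%N => // k IH.
    by apply: le_trans (Hu _).2 IH.
  have cross n m : u (s m) <= u (s n) + w / 2 ^+ n.
    have w_ge0 k : 0 <= w / 2 ^+ k by rewrite divr_ge0 // exprn_ge0.
    have [mn|/ltnW nm] := leqP m n.
      by apply: le_trans (lo _ _ mn) _; rewrite lerDl.
    by apply: le_trans (hi _ _ nm); rewrite lerDl.
  pose E := [set u (s n) | n in [set: nat]].
  have ubE : has_ubound E.
    by exists (u (s 0%N) + w / 2 ^+ 0) => _ [m _ <-]; apply: cross.
  exists (sup E) => n; split.
    rewrite lo //=; apply: ub_le_sup => //; by exists n.
  apply/andP; split.
    apply: ge_sup; first by exists (u (s 0%N)); exists 0%N.
    by move=> _ [m _ <-]; apply: cross.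
  by have := hi _ _ (leq0n n); rewrite expr0 divr1.
have [cx Hx] := nested fst W W0 (fun n => let: And5 _ h1 h2 _ _ := HF (n, s n) (Ps n) in conj h1 h2).
have [cy Hy] := nested snd H H0 (fun n => let: And5 _ _ _ h1 h2 := HF (n, s n) (Ps n) in conj h1 h2).
exists (cx, cy) => n; exists (s n).
by have [? ?] := Hx n; have [? ?] := Hy n; split.
Qed.

Lemma goursat f x1 x2 y1 y2 : x1 <= x2 -> y1 <= y2 -> holo_rect f x1 x2 y1 y2 ->
  oint f x1 x2 y1 y2 = 0.
Proof.
move=> x12 y12 Hf.
pose W := x2 - x1; pose H := y2 - y1.
have W0 : 0 <= W by rewrite subr_ge0.
have H0 : 0 <= H by rewrite subr_ge0.
suff main e : 0 < e -> cmod (oint f x1 x2 y1 y2) <= e * (W + H) ^+ 2.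
  apply: cmod_lt_eps0 => e e0.
  have D0 : 0 < 1 + (W + H) ^+ 2 by rewrite ltr_pwDl ?sqr_ge0.
  apply: le_trans (main _ (divr_gt0 e0 D0)) _.
  rewrite mulrAC ler_pdivrMr // ler_wpM2l ?(ltW e0) // lerDr //.
move=> e0; rewrite leNgt; apply/negP => big.
have p0 n : 0 < (2 : R) ^+ n by rewrite exprn_gt0.
(* The threshold e (w + h)^2 is divided by 4 at each halving, so at least one of the four quarters
   exceeds it. *)
pose P n (p : R * R) := [/\ x1 <= p.1, p.1 + W / 2 ^+ n <= x2, y1 <= p.2,
  p.2 + H / 2 ^+ n <= y2 & e * (W / 2 ^+ n + H / 2 ^+ n) ^+ 2 <
  cmod (oint f p.1 (p.1 + W / 2 ^+ n) p.2 (p.2 + H / 2 ^+ n))].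
have P0 : P 0%N (x1, y1).
  by rewrite /P /= expr0 !divr1 /W /H !subrKC; split.
have Pstep n p : P n p -> exists q, [/\ P n.+1 q,
     p.1 <= q.1, q.1 + W / 2 ^+ n.+1 <= p.1 + W / 2 ^+ n,
     p.2 <= q.2 & q.2 + H / 2 ^+ n.+1 <= p.2 + H / 2 ^+ n].
  move: p => [x y]; rewrite /P /= => -[]; rewrite (exprS 2 n).
  set w := W / (2 * 2 ^+ n); set h := H / (2 * 2 ^+ n).
  have -> : W / 2 ^+ n = w + w by rewrite /w; field; rewrite lt0r_neq0.
  have -> : H / 2 ^+ n = h + h by rewrite /h; field; rewrite lt0r_neq0.
  have w0 : 0 <= w by rewrite divr_ge0 // mulr_ge0 // ltW.
  have h0 : 0 <= h by rewrite divr_ge0 // mulr_ge0 // ltW.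
  rewrite !addrA => xx1 xx2 yy1 yy2.
  have hr : holo_rect f x (x + w + w) y (y + h + h) by apply: holo_rect_sub Hf _ _ _ _.
  rewrite (@oint_hsplit _ _ _ (x + w)) ?lerDl //; last 2 first.
  - by move=> t tt; apply: hr => //; lra.
  - by move=> t tt; apply: hr => //; lra.
  rewrite (@oint_vsplit _ _ x _ _ (y + h)) ?lerDl //; last 2 first.
  - by move=> t tt; apply: hr => //; lra.
  - by move=> t tt; apply: hr => //; lra.
  rewrite (@oint_vsplit _ _ (x + w) _ _ (y + h)) ?lerDl //; last 2 first.
  - by move=> t tt; apply: hr => //; lra.
  - by move=> t tt; apply: hr => //; lra.
  set I1 := oint _ _ _ _ _; set I2 := oint _ _ _ _ _.
  set I3 := oint _ _ _ _ _; set I4 := oint _ _ _ _ _ => B.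
  have B' : 4 * (e * (w + h) ^+ 2) < cmod I1 + cmod I2 + cmod I3 + cmod I4.
    have := cmodD (I1 + I2) (I3 + I4); have := cmodD I1 I2; have := cmodD I3 I4.
    have E4 : e * (w + w + h + h) ^+ 2 = 4 * (e * (w + h) ^+ 2) by ring.
    by rewrite -E4; lra.
  clearbody w h; clear P P0 big Hf hr B.
  have [i1|i1] := ltP (e * (w + h) ^+ 2) (cmod I1).
    by exists (x, y); split => /=; [split; rewrite //= | | | |]; clear -w0 h0 xx1 xx2 yy1 yy2; lra.
  have [i2|i2] := ltP (e * (w + h) ^+ 2) (cmod I2).
    by exists (x, y + h); split => /=; [split; rewrite //= | | | |]; clear -w0 h0 xx1 xx2 yy1 yy2; lra.
  have [i3|i3] := ltP (e * (w + h) ^+ 2) (cmod I3).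
    by exists (x + w, y); split => /=; [split; rewrite //= | | | |]; clear -w0 h0 xx1 xx2 yy1 yy2; lra.
  have [i4|i4] := ltP (e * (w + h) ^+ 2) (cmod I4).
    by exists (x + w, y + h); split => /=; [split; rewrite //= | | | |]; clear -w0 h0 xx1 xx2 yy1 yy2; lra.
  clear -B' i1 i2 i3 i4; lra.
have [[cx cy] Hc] := bisection W0 H0 P0 Pstep.
have [A HA] : holo f (cx +i* cy).
  have [q [_ /=]] := Hc 0%N.
  rewrite /W /H !subrKC expr0 !divr1 => /andP[? ?] /andP[? ?] /andP[? ?] /andP[? ?].
  apply: Hf; lra.
(* On the small rectangle f differs from its affine part by at most (e / 8) (w + h), and [oint_le]
   multiplies this by 2 (w + h): the integral is at most (e / 4) (w + h)^2, against the lower bound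
   kept by the bisection. *)
have e80 : 0 < e / 8 by rewrite divr_gt0.
have [d d0 Hd] := HA _ e80; set p := cx +i* cy in HA Hd.
have [n hn] := halving_lt (W + H) d0.
have [[x y] [[] /=]] := Hc n.
move: hn; rewrite mulrDl; set w := W / _; set h := H / _ => hn.
have w0 : 0 <= w by rewrite divr_ge0 // ltW.
have h0 : 0 <= h by rewrite divr_ge0 // ltW.
move=> xx1 xx2 yy1 yy2 B /andP[_ cx1] /andP[cx2 _] /andP[_ cy1] /andP[cy2 _].
pose g := fun w : R[i] => f p + A * (w - p).
have hg v : holo g v.
  apply: holoD; first exact: holo_cst.
  apply: holoM; first exact: holo_cst.
  by apply: holoB; [apply: holo_id|apply: holo_cst].
have hr : holo_rect f x (x + w) y (y + h) by apply: holo_rect_sub Hf _ _ _ _.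
have xw : x <= x + w by rewrite lerDl.
have yh : y <= y + h by rewrite lerDl.
have bf := holo_rect_bcont xw yh hr.
have bg : bcont g x (x + w) y (y + h) by split=> t _.
have : cmod (oint (fun v => f v - g v) x (x + w) y (y + h)) <=
    2 * (e / 8 * (w + h)) * ((x + w - x) + (y + h - y)).
  apply: oint_le => //.
    by apply: holo_rect_bcont => // u v hu hv; apply: holoB => //; apply: hr.
  move=> _ [u [v [-> /andP[u1 u2] /andP[v1 v2] _]]].
  have dist : cmod (u +i* v - p) <= w + h.
    apply: le_trans (cmod_leD _) _; rewrite /p /= ; apply: lerD; rewrite ler_norml; lra.
  have := Hd (u +i* v - p) (le_lt_trans dist hn).
  rewrite /g; have -> : p + (u +i* v - p) = u +i* v by ring.
  rewrite opprD addrA => /le_trans; apply.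
  by rewrite ler_wpM2l // ltW.
rewrite ointB // oint_affine // subr0 => B2.
move: B; have := sqr_ge0 (w + h); nra.
Qed.

(** The outer rectangle is cut into two full-height columns and the pieces below, inside and above
    the inner one; Goursat kills all but the inner piece. *)
Lemma oint_annulus f X1 X2 Y1 Y2 x1 x2 y1 y2 :
  X1 <= x1 -> x1 <= x2 -> x2 <= X2 -> Y1 <= y1 -> y1 <= y2 -> y2 <= Y2 ->
  (forall x y, X1 <= x <= X2 -> Y1 <= y <= Y2 -> ~ (x1 < x < x2 /\ y1 < y < y2) ->
    holo f (x +i* y)) ->
  oint f X1 X2 Y1 Y2 = oint f x1 x2 y1 y2.
Proof.
move=> a1 a2 a3 b1 b2 b3 H.
rewrite (@oint_hsplit _ _ X1 x1 X2); [|lra|lra| |]; last 2 first.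
- by move=> t ht; apply: H; lra.
- by move=> t ht; apply: H; lra.
rewrite (@oint_hsplit _ _ x1 x2 X2); [|lra|lra| |]; last 2 first.
- by move=> t ht; apply: H; lra.
- by move=> t ht; apply: H; lra.
rewrite goursat; [|lra|lra|by move=> t s ht hs; apply: H; lra].
rewrite (@goursat f x2 X2); [|lra|lra|by move=> t s ht hs; apply: H; lra].
rewrite (@oint_vsplit _ _ x1 x2 Y1 y1 Y2); [|lra|lra| |]; last 2 first.
- by move=> t ht; apply: H; lra.
- by move=> t ht; apply: H; lra.
rewrite (@oint_vsplit _ _ x1 x2 y1 y2 Y2); [|lra|lra| |]; last 2 first.
- by move=> t ht; apply: H; lra.
- by move=> t ht; apply: H; lra.
rewrite (@goursat f x1 x2 Y1 y1); [|lra|lra|by move=> t s ht hs; apply: H; lra].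
rewrite (@goursat f x1 x2 y2 Y2); [|lra|lra|by move=> t s ht hs; apply: H; lra].
by rewrite !add0r !addr0.
Qed.

End Goursat.

(** * Cauchy's formula and Cauchy's estimate *)

Section CauchyFormula.
Context {R : realType}.
Implicit Types (f g : R[i] -> R[i]) (x y a b : R) (z w h p : R[i]).

Lemma holo_pole z w : w != z -> holo (fun v => (v - z)^-1) w.
Proof.
move=> wz; apply: holoV; first by rewrite subr_eq0.
by apply: holoB; [apply: holo_id|apply: holo_cst].
Qed.

Lemma complex_neq (x y a b : R) : x <> a \/ y <> b -> x +i* y != a +i* b.
Proof. by move=> H; apply/eqP => -[? ?]; case: H. Qed.

(* It is enough that the integral of 1/(w - z) is bounded away from 0: its value
   2 pi i is never needed in the Cauchy formula. *)
Lemma Im_oint_pole a b X1 X2 Y1 Y2 : X1 < a < X2 -> Y1 < b < Y2 ->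
  4 <= complex.Im (oint (fun w => (w - (a +i* b))^-1) X1 X2 Y1 Y2).
Proof.
move=> /andP[a1 a2] /andP[b1 b2].
pose s := Num.min (Num.min (a - X1) (X2 - a)) (Num.min (b - Y1) (Y2 - b)).
have s0 : 0 < s by rewrite /s !lt_min; lra.
have [s1 s2 s3 s4] : [/\ s <= a - X1, s <= X2 - a, s <= b - Y1 & s <= Y2 - b].
  by rewrite /s; split; rewrite !ge_min ?lexx ?orbT.
clearbody s; set f := fun w => _.
have hf x y : x <> a \/ y <> b -> holo f (x +i* y).
  by move=> H; apply: holo_pole; apply: complex_neq.
rewrite (@oint_annulus _ _ _ _ _ _ (a - s) (a + s) (b - s) (b + s)); try lra; last first.
  move=> x y hx hy H; apply: hf; have [xa|] := eqVneq x a; last by move/eqP; left.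
  have [yb|] := eqVneq y b; last by move/eqP; right.
  by exfalso; apply: H; rewrite xa yb; split; apply/andP; split; lra.
rewrite /oint.
have -> : hint f (a - s) (a + s) (b - s) + vint f (a + s) (b - s) (b + s) -
   hint f (a - s) (a + s) (b + s) - vint f (a - s) (b - s) (b + s) =
  (hint f (a - s) (a + s) (b - s) - hint f (a - s) (a + s) (b + s)) +
  (vint f (a + s) (b - s) (b + s) - vint f (a - s) (b - s) (b + s)) by ring.
have h1 t : holo f (t +i* (b - s)) by apply: hf; right; lra.
have h2 t : holo f (t +i* (b + s)) by apply: hf; right; lra.
have h3 t : holo f ((a - s) +i* t) by apply: hf; left; lra.
have h4 t : holo f ((a + s) +i* t) by apply: hf; left; lra.
(* t^2 + s^2 <= 2 s^2 on a side of the small square. Each pair of opposite sides, of length 2 s,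
   then contributes at least 2, whence the total 4. *)
have key t : - s <= t <= s -> 1 / s <= 2 * (s / (t ^+ 2 + s ^+ 2)).
  move=> hs; have q0 : 0 < t ^+ 2 + s ^+ 2 by nra.
  have -> : 2 * (s / (t ^+ 2 + s ^+ 2)) = (2 * s) / (t ^+ 2 + s ^+ 2) by ring.
  rewrite ler_pdivrMr // mulrAC ler_pdivlMr // mul1r; nra.
rewrite ImD /hint /vint -mulrBr /lint -!cintegralB //;
  try (by apply: hcont_int => t _); try (by apply: vcont_int => t _).
have Imi (v : R[i]) : complex.Im ('i * v) = complex.Re v.
  by case: v => u v /=; ring.
rewrite Imi.
have E : 4 = 1 / s * (a + s - (a - s)) + 1 / s * (b + s - (b - s)).
  by field; rewrite lt0r_neq0.
rewrite E; apply: lerD.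
  apply: Im_lint_ge; first lra.
    by apply: cintegrableB => //; apply: hcont_int => t _.
  move=> t ht; have -> : complex.Im (f (t +i* (b - s)) - f (t +i* (b + s))) =
      2 * (s / ((t - a) ^+ 2 + s ^+ 2)).
    rewrite ImB /f /=.
    have -> : b - s - b = - s by ring.
    have -> : b + s - b = s by ring.
    by rewrite sqrrN; ring.
  by apply: key; lra.
apply: Re_lint_ge; first lra.
  by apply: cintegrableB => //; apply: vcont_int => t _.
move=> t ht; have -> : complex.Re (f ((a + s) +i* t) - f ((a - s) +i* t)) =
    2 * (s / ((t - b) ^+ 2 + s ^+ 2)).
  rewrite ReB /f /=.
  have -> : a - s - a = - s by ring.
  have -> : a + s - a = s by ring.
  by rewrite sqrrN [s ^+ 2 + _]addrC; ring.
by apply: key; lra.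
Qed.

Lemma cauchy_formula f a b X1 X2 Y1 Y2 : X1 < a < X2 -> Y1 < b < Y2 ->
  holo_rect f X1 X2 Y1 Y2 ->
  f (a +i* b) * oint (fun w => (w - (a +i* b))^-1) X1 X2 Y1 Y2 =
  oint (fun w => f w * (w - (a +i* b))^-1) X1 X2 Y1 Y2.
Proof.
move=> /andP[a1 a2] /andP[b1 b2] hf; set z := a +i* b.
have X12 : X1 <= X2 by lra.
have Y12 : Y1 <= Y2 by lra.
pose k w := (w - z)^-1; pose g w := (f w - f z) * k w.
have hk x y : x <> a \/ y <> b -> holo k (x +i* y).
  by move=> H; apply: holo_pole; apply: complex_neq.
have hg x y : X1 <= x <= X2 -> Y1 <= y <= Y2 -> x <> a \/ y <> b -> holo g (x +i* y).
  move=> hx hy H; apply: holoM; last exact: hk.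
  by apply: holoB; [apply: hf|apply: holo_cst].
have bd (u : R[i] -> R[i]) : (forall x y, X1 <= x <= X2 -> Y1 <= y <= Y2 ->
     x <> a \/ y <> b -> holo u (x +i* y)) -> bcont u X1 X2 Y1 Y2.
  move=> H; apply: bcontP => // _ [x [y [-> hx hy hor]]]; apply: H => //.
  by case: hor => ->; [left|left|right|right]; lra.
have bk : bcont k X1 X2 Y1 Y2 by apply: bd => x y _ _; apply: hk.
have bfk : bcont (fun w => f w * k w) X1 X2 Y1 Y2.
  by apply: bd => x y hx hy H; apply: holoM; [apply: hf|apply: hk].
rewrite -ointZ //; apply/eqP; rewrite eq_sym -subr_eq0 -ointB //; last first.
  by apply: bd => x y hx hy H; apply: holoM; [apply: holo_cst|apply: hk].
rewrite (_ : (fun w => _) = g); last first.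
  by apply/funext => w; rewrite /g mulrBl.
have [A HA] : holo f z by apply: hf; lra.
have [d d0 Hd] := HA 1 ltr01.
apply/eqP; apply: cmod_lt_eps0 => e e0.
pose K := cmod A + 1; have K0 : 0 < K by rewrite ltr_wpDl ?cmod_ge0.
(* The small square must fit in the rectangle, satisfy |w - z| <= 2 s < d, and make 8 K s <= e,
   where 8 s is its perimeter and K bounds the quotient on it. *)
pose s := Num.min (Num.min (Num.min (a - X1) (X2 - a)) (Num.min (b - Y1) (Y2 - b)))
  (Num.min (d / 4) (e / (8 * K))).
have s0 : 0 < s.
  have q0 : 0 < e / (8 * K) by rewrite divr_gt0 // mulr_gt0.
  by rewrite /s !lt_min q0; lra.
have [s1 s2 s3 [s4 s5 s6]] : [/\ s <= a - X1, s <= X2 - a, s <= b - Y1 &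
   [/\ s <= Y2 - b, s <= d / 4 & s <= e / (8 * K)]].
  by rewrite /s; split; last split; rewrite !ge_min ?lexx ?orbT.
clearbody s.
rewrite (@oint_annulus _ _ _ _ _ _ (a - s) (a + s) (b - s) (b + s)); try lra; last first.
  move=> x y hx hy H; apply: hg => //; have [xa|] := eqVneq x a; last by move/eqP; left.
  have [yb|] := eqVneq y b; last by move/eqP; right.
  by exfalso; apply: H; rewrite xa yb; split; apply/andP; split; lra.
have : cmod (oint g (a - s) (a + s) (b - s) (b + s)) <=
    2 * K * ((a + s - (a - s)) + (b + s - (b - s))).
  apply: oint_le; try lra.
    apply: bcontP; try lra.
    by move=> _ [x [y [-> hx hy hor]]]; apply: hg; try lra; case: hor => ->;
      [left|left|right|right]; lra.
  move=> _ [x [y [-> /andP[hx1 hx2] /andP[hy1 hy2] hor]]]; set w := x +i* y.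
  have wz : w != z.
    by apply: complex_neq; case: hor => ->; [left|left|right|right]; lra.
  have wd : cmod (w - z) < d.
    have : cmod (w - z) <= s + s.
      by apply: le_trans (cmod_leD _) _; rewrite /=; apply: lerD; rewrite ler_norml; lra.
    lra.
  have := Hd _ wd; have -> : z + (w - z) = w by ring.
  move=> Hw; rewrite /g /k cmodM cmodV ler_pdivrMr ?cmod_gt0 ?subr_eq0 // mulrDl.
  have -> : f w - f z = A * (w - z) + (f w - f z - A * (w - z)) by ring.
  by apply: le_trans (cmodD _ _) _; rewrite cmodM lerD.
move/le_trans; apply.
have -> : 2 * K * ((a + s - (a - s)) + (b + s - (b - s))) = s * (8 * K) by ring.
by rewrite -ler_pdivlMr ?mulr_gt0.
Qed.

Lemma boundary_far a b r w : 0 < r -> boundary (a - r) (a + r) (b - r) (b + r) w ->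
  r <= cmod (w - (a +i* b)).
Proof.
move=> r0 [x [y [-> _ _ hor]]].
have rr : r = `|r| by rewrite gtr0_norm.
case: hor => ->; rewrite [in leLHS]rr.
- apply: le_trans (normRe_le _); rewrite /= -normrN.
  by have -> : a - r - a = - r by ring.
- apply: le_trans (normRe_le _); rewrite /=.
  by have -> : a + r - a = r by ring.
- apply: le_trans (normIm_le _); rewrite /= -normrN.
  by have -> : b - r - b = - r by ring.
- apply: le_trans (normIm_le _); rewrite /=.
  by have -> : b + r - b = r by ring.
Qed.

Lemma in_square_interior a b r h : 0 < r -> cmod h <= r / 2 ->
  a - r < complex.Re (a +i* b + h) < a + r /\ b - r < complex.Im (a +i* b + h) < b + r.
Proof.
move=> r0 hr; have := normRe_le h; have := normIm_le h; rewrite ReD ImD /= !ler_norml.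
by move=> *; split; apply/andP; split; lra.
Qed.

(** Makes the unknown constant in Cauchy's formula the same at p and at p + h. The difference of the
    kernels is O(|h| / t^2) on the square of half-side t, and the contour can be enlarged freely
    because both poles lie inside. *)
Lemma oint_pole_cst a b r h : 0 < r -> cmod h <= r / 2 ->
  oint (fun w => (w - (a +i* b + h))^-1) (a - r) (a + r) (b - r) (b + r) =
  oint (fun w => (w - (a +i* b))^-1) (a - r) (a + r) (b - r) (b + r).
Proof.
move=> r0 hr; set p := a +i* b.
have far t w : r <= t -> boundary (a - t) (a + t) (b - t) (b + t) w ->
    t <= cmod (w - p) /\ t / 2 <= cmod (w - (p + h)).
  move=> rt hw; have H := boundary_far (lt_le_trans r0 rt) hw; split=> //.
  have -> : w - (p + h) = (w - p) - h by ring.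
  have := cmodB (w - p - h) (- h); rewrite opprK subrK cmodN; lra.
have ne t w : r <= t -> boundary (a - t) (a + t) (b - t) (b + t) w -> w != p /\ w != p + h.
  move=> rt /(far _ _ rt)[h1 h2]; rewrite -subr_eq0 -cmod_gt0 -[w == p + h]subr_eq0 -cmod_gt0.
  split; lra.
pose k w := (w - (p + h))^-1 - (w - p)^-1.
have bk1 : bcont (fun w => (w - (p + h))^-1) (a - r) (a + r) (b - r) (b + r).
  by apply: bcontP; try lra; move=> w /(ne _ _ (lexx r))[_ ?]; apply: holo_pole.
have bk2 : bcont (fun w => (w - p)^-1) (a - r) (a + r) (b - r) (b + r).
  by apply: bcontP; try lra; move=> w /(ne _ _ (lexx r))[? _]; apply: holo_pole.
apply/eqP; rewrite -subr_eq0 -ointB //; apply/eqP; apply: cmod_lt_eps0 => e e0.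
pose t := Num.max r (16 * cmod h / e).
have rt : r <= t by rewrite le_max lexx.
have et : 16 * cmod h / e <= t by rewrite le_max lexx orbT.
have t0 : 0 < t := lt_le_trans r0 rt.
rewrite -(@oint_annulus _ k (a - t) (a + t) (b - t) (b + t)); try lra; last first.
  move=> x y hx hy H.
  have out (q1 q2 : R) : a - r < q1 < a + r /\ b - r < q2 < b + r -> x +i* y != q1 +i* q2.
    by move=> Hq; apply/eqP => -[xq yq]; apply: H; rewrite xq yq.
  apply: holoB; apply: holo_pole; last by apply: out; split; apply/andP; split; lra.
  by have := out _ _ (in_square_interior a b r0 hr); rewrite -/p; case: (p + h).
have : cmod (oint k (a - t) (a + t) (b - t) (b + t)) <=
    2 * (cmod h / (t * (t / 2))) * ((a + t - (a - t)) + (b + t - (b - t))).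
  apply: oint_le; try lra.
    by apply: bcontP; try lra; move=> w /(ne _ _ rt)[? ?]; apply: holoB; apply: holo_pole.
  move=> w hw; have [w1 w2] := ne _ _ rt hw; have [f1 f2] := far _ _ rt hw.
  have -> : k w = h / ((w - p) * (w - (p + h))).
    by rewrite /k; field; rewrite !subr_eq0 w1 w2.
  rewrite cmodM cmodV ler_wpM2l ?cmod_ge0 // cmodM lef_pV2 ?posrE; last 2 first.
  - by rewrite mulr_gt0; lra.
  - by rewrite mulr_gt0 // divr_gt0.
  by apply: ler_pM; lra.
move/le_trans; apply.
have -> : 2 * (cmod h / (t * (t / 2))) * ((a + t - (a - t)) + (b + t - (b - t))) =
  (16 * cmod h) / t by field; rewrite lt0r_neq0.
by rewrite ler_pdivrMr // [e * t]mulrC -ler_pdivrMr.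
Qed.

(** Combining Cauchy's formulas at p and p + h leaves the kernel h^2 / ((w - p)^2 (w - p - h)), of
    modulus at most 2 |h|^2 / r^3 on a contour of length 8 r. Division by a constant of modulus at
    least 4 gives the factor 4 / r^2. *)
Lemma cauchy_estimate f a b (r M : R) : 0 < r ->
  holo_rect f (a - r) (a + r) (b - r) (b + r) ->
  (forall x y, a - r <= x <= a + r -> b - r <= y <= b + r -> cmod (f (x +i* y)) <= M) ->
  exists A, forall h, cmod h <= r / 2 ->
    cmod (f (a +i* b + h) - f (a +i* b) - A * h) <= 4 / r ^+ 2 * M * cmod h ^+ 2.
Proof.
move=> r0 hf fM; set p := a +i* b.
pose I (g : R[i] -> R[i]) := oint g (a - r) (a + r) (b - r) (b + r).
pose c := I (fun w => (w - p)^-1).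
have c4 : 4 <= cmod c.
  have H : 4 <= complex.Im c by apply: Im_oint_pole; lra.
  by apply: le_trans H (le_trans (ler_norm _) (normIm_le _)).
have c0 : c != 0 by rewrite -cmod_gt0; lra.
have cz : cmod (0 : R[i]) <= r / 2 by rewrite cmod0; lra.
have formula h : cmod h <= r / 2 -> f (p + h) * c = I (fun w => f w * (w - (p + h))^-1).
  move=> hr; rewrite /c /I -(oint_pole_cst a b r0 hr) -/p.
  have [] := in_square_interior a b r0 hr; rewrite -/p.
  by case: (p + h) => u v /= hu hv; apply: cauchy_formula.
have formula0 : f p * c = I (fun w => f w * (w - p)^-1).
  by have := formula _ cz; rewrite addr0.
exists (I (fun w => f w * (w - p)^-2) / c) => h hr.
have far w : boundary (a - r) (a + r) (b - r) (b + r) w ->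
    r <= cmod (w - p) /\ r / 2 <= cmod (w - (p + h)).
  move=> hw; have H := boundary_far r0 hw; split=> //.
  have -> : w - (p + h) = (w - p) - h by ring.
  have := cmodB (w - p - h) (- h); rewrite opprK subrK cmodN -/p in H *; lra.
have ne w : boundary (a - r) (a + r) (b - r) (b + r) w -> w != p /\ w != p + h.
  move=> /far[h1 h2]; rewrite -subr_eq0 -cmod_gt0 -[w == p + h]subr_eq0 -cmod_gt0.
  split; lra.
have hfb w : boundary (a - r) (a + r) (b - r) (b + r) w -> holo f w.
  by move=> [x [y [-> hx hy _]]]; apply: hf.
have bk1 : bcont (fun w => f w * (w - (p + h))^-1) (a - r) (a + r) (b - r) (b + r).
  apply: bcontP; try lra; move=> w hw; have [_ ?] := ne _ hw.
  by apply: holoM; [apply: hfb|apply: holo_pole].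
have bk2 : bcont (fun w => f w * (w - p)^-1) (a - r) (a + r) (b - r) (b + r).
  apply: bcontP; try lra; move=> w hw; have [? _] := ne _ hw.
  by apply: holoM; [apply: hfb|apply: holo_pole].
have bk3 : bcont (fun w => f w * (w - p)^-2) (a - r) (a + r) (b - r) (b + r).
  apply: bcontP; try lra; move=> w hw; have [w1 _] := ne _ hw.
  apply: holoM; first exact: hfb.
  rewrite (_ : (fun w => _) = (fun w => (w - p)^-1 * (w - p)^-1)); last first.
    by apply/funext => v; rewrite -invfM.
  by apply: holoM; apply: holo_pole.
have -> : f (p + h) - f p - I (fun w => f w * (w - p)^-2) / c * h =
   (f (p + h) * c - f p * c - h * I (fun w => f w * (w - p)^-2)) / c.
  by field.
rewrite formula // formula0 /I -ointZ // -ointB // -ointB //; last first.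
- by case: bk3 => *; split => t ht; apply: holoM; auto; apply: holo_cst.
- by case: bk1 => *; case: bk2 => *; split => t ht; apply: holoB; auto.
set g := fun w => _.
have : cmod (oint g (a - r) (a + r) (b - r) (b + r)) <=
    2 * (M * (cmod h ^+ 2 / (r ^+ 2 * (r / 2)))) * ((a + r - (a - r)) + (b + r - (b - r))).
  apply: oint_le; try lra.
    case: bk1 => *; case: bk2 => *; case: bk3 => *; split => t ht; apply: holoB; auto.
    - by apply: holoB; auto.
    - by apply: holoM; auto; apply: holo_cst.
    - by apply: holoB; auto.
    - by apply: holoM; auto; apply: holo_cst.
    - by apply: holoB; auto.
    - by apply: holoM; auto; apply: holo_cst.
    - by apply: holoB; auto.
    - by apply: holoM; auto; apply: holo_cst.
  move=> w hw; have [w1 w2] := ne _ hw; have [f1 f2] := far _ hw.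
  have -> : g w = f w * (h ^+ 2 / ((w - p) ^+ 2 * (w - (p + h)))).
    by rewrite /g; field; rewrite !subr_eq0 w1 w2.
  have fw : cmod (f w) <= M by case: hw => [x [y [-> hx hy _]]]; apply: fM.
  rewrite !(cmodM, cmodV, expr2) -!expr2.
  have P1 : 0 < r ^+ 2 * (r / 2) by rewrite mulr_gt0 ?exprn_gt0 // divr_gt0.
  have P2 : r ^+ 2 * (r / 2) <= cmod (w - p) ^+ 2 * cmod (w - (p + h)).
    by apply: ler_pM; rewrite ?sqr_ge0 //; [lra|rewrite lerXn2r ?nnegrE //; lra].
  apply: ler_pM => //; first exact: cmod_ge0.
    by rewrite divr_ge0 ?sqr_ge0 //; lra.
  by rewrite ler_wpM2l ?sqr_ge0 // lef_pV2 ?posrE //; lra.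
have -> : 2 * (M * (cmod h ^+ 2 / (r ^+ 2 * (r / 2)))) * ((a + r - (a - r)) + (b + r - (b - r)))
  = 4 * (4 / r ^+ 2 * M * cmod h ^+ 2) by field; rewrite lt0r_neq0.
set B := 4 / r ^+ 2 * M * cmod h ^+ 2 => H.
rewrite cmodM cmodV ler_pdivrMr; last lra.
apply: le_trans H _; rewrite mulrC ler_wpM2l //.
have M0 : 0 <= M by apply: le_trans (cmod_ge0 _) (fM a b _ _); lra.
by rewrite /B mulr_ge0 ?sqr_ge0 // mulr_ge0 // mulr_ge0 // invr_ge0 sqr_ge0.
Qed.

End CauchyFormula.

(** * Limits of holomorphic functions and the identity theorem *)

Section ComplexLimits.
Context {R : realType}.
Implicit Types (u v : nat -> R[i]) (l : R[i]).

Definition ccvg u l := forall e : R, 0 < e ->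
  exists N, forall n, (N <= n)%N -> cmod (u n - l) <= e.

Lemma ccvgP u l : ccvg u l <-> (u : nat -> R[i]^o) @ \oo --> (l : R[i]^o).
Proof.
split=> [H|/cvgrPdist_le H].
  apply/cvgrPdist_le => e' /complex_gt0P[e e0 ->].
  have [N HN] := H _ e0; exists N => // n /= nN.
  by rewrite distrC normE lecR HN.
move=> e e0; have /H[N _ HN] : 0 < e%:C by rewrite ltcR.
by exists N => n /HN /=; rewrite distrC normE lecR.
Qed.

Lemma ccvg_unique u l l' : ccvg u l -> ccvg u l' -> l = l'.
Proof.
move=> /ccvgP H /ccvgP H'.
exact: (cvg_unique (@norm_hausdorff _ R[i]^o) H H').
Qed.

Lemma ccvg_limn u l : ccvg u l -> limn (u : nat -> R[i]^o) = l.
Proof. by move=> /ccvgP H; apply: (cvg_lim (@norm_hausdorff _ R[i]^o) H). Qed.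

Lemma ccvg_cvgn u l : ccvg u l -> cvgn (u : nat -> R[i]^o).
Proof. by move=> /ccvgP H; apply/cvg_ex; exists l. Qed.

Lemma ccvg_cst l : ccvg (fun=> l) l.
Proof. by move=> e e0; exists 0%N => n _; rewrite subrr cmod0 ltW. Qed.

(** Index 0 is left out because kappa may vanish at 0, so that the identities between the later
    sequences hold for n > 0. *)
Lemma eq_ccvg u v l : (forall n, (0 < n)%N -> u n = v n) -> ccvg u l -> ccvg v l.
Proof.
move=> uv H e /H[N HN]; exists (maxn N 1) => n.
by rewrite geq_max => /andP[nN n0]; rewrite -uv // HN.
Qed.

Lemma ccvg_shift u l : ccvg u l -> ccvg (fun n => u n.+1) l.
Proof. by move=> H e /H[N HN]; exists N => n nN; apply: HN; apply: leqW. Qed.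

Lemma ccvgD u v l m : ccvg u l -> ccvg v m -> ccvg (fun n => u n + v n) (l + m).
Proof. move=> /ccvgP Hu /ccvgP Hv; apply/ccvgP.
exact: (cvgD Hu Hv). Qed.

Lemma ccvgM u v l m : ccvg u l -> ccvg v m -> ccvg (fun n => u n * v n) (l * m).
Proof. move=> /ccvgP Hu /ccvgP Hv; apply/ccvgP.
exact: (cvgM Hu Hv). Qed.

Lemma ccvgZ (c : R[i]) u l : ccvg u l -> ccvg (fun n => c * u n) (c * l).
Proof. by apply: ccvgM; apply: ccvg_cst. Qed.

Lemma ccvgN u l : ccvg u l -> ccvg (fun n => - u n) (- l).
Proof. move=> /ccvgP Hu; apply/ccvgP.
exact: (cvgN Hu). Qed.

Lemma ccvgB u v l m : ccvg u l -> ccvg v m -> ccvg (fun n => u n - v n) (l - m).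
Proof. by move=> ? ?; apply: ccvgD => //; apply: ccvgN. Qed.

Lemma ccvg_holo (f : R[i] -> R[i]) u l : holo f l -> ccvg u l ->
  ccvg (fun n => f (u n)) (f l).
Proof.
move=> /holo_cont fl H e /fl[d d0 Hd].
have [N HN] := H _ (divr_gt0 d0 (ltr0Sn R 1)); exists N => n /HN un.
rewrite -[u n](subrKC l); apply: Hd.
by apply: le_lt_trans un _; rewrite ltr_pdivrMr // ltr_pMr // ltr1n.
Qed.

Lemma ccvg_Re u l : ccvg u l -> (fun n => complex.Re (u n)) @ \oo --> complex.Re l.
Proof.
move=> H; apply/cvgrPdist_le => e /H[N HN]; exists N => // n /= /HN.
by apply: le_trans; rewrite distrC -ReB normRe_le.
Qed.

Lemma ccvg_cmod_le u l (K : R) : ccvg u l -> (forall n, cmod (u n) <= K) -> cmod l <= K.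
Proof.
move=> H uK; apply/ler_addgt0Pr => e e0; have [N /(_ N (leqnn N))] := H _ e0.
have := uK N; have := cmodB (u N) (u N - l); rewrite opprB addrC subrK; lra.
Qed.

Lemma ccvg_cauchy u : (forall e : R, 0 < e -> exists N, forall n m, (N <= n)%N ->
   (N <= m)%N -> cmod (u n - u m) <= e) -> exists l, ccvg u l.
Proof.
move=> H.
have real (p : R[i] -> R) : (forall z w, `|p z - p w| <= cmod (z - w)) ->
    exists l : R, (fun n => p (u n)) @ \oo --> l.
  move=> Hp; apply/cvg_ex; apply/cauchy_cvgP; apply/cauchy_exP => e e0.
  have [N HN] := H _ (divr_gt0 e0 (ltr0Sn R 1)).
  exists (p (u N)); exists N => // n /= nN; rewrite /ball /=.
  apply: le_lt_trans (Hp _ _) _; apply: le_lt_trans (HN _ _ (leqnn N) nN) _.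
  by rewrite ltr_pdivrMr // ltr_pMr // ltr1n.
have [|a Ha] := real (@complex.Re R); first by move=> z w; rewrite -ReB normRe_le.
have [|b Hb] := real (@complex.Im R); first by move=> z w; rewrite -ImB normIm_le.
exists (a +i* b) => e e0; have e20 : 0 < e / 2 by rewrite divr_gt0.
move/cvgrPdist_le : Ha => /(_ _ e20)[N1 _ H1].
move/cvgrPdist_le : Hb => /(_ _ e20)[N2 _ H2].
exists (maxn N1 N2) => n; rewrite geq_max => /andP[n1 n2].
apply: le_trans (cmod_leD _) _; rewrite ReB ImB /= distrC [`|complex.Im _ - _|]distrC.
by have := H1 _ n1; have := H2 _ n2; rewrite /=; lra.
Qed.

(** Increments of order 1/k^2 are measured by 1/k - 1/(k+1), which sums exactly and leaves the error
    B / n. *)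
Lemma telescope_bound u (B : R) : 0 <= B ->
  (forall k, (0 < k)%N -> cmod (u k.+1 - u k) <= B * (k%:R^-1 - k.+1%:R^-1)) ->
  forall n m, (0 < n)%N -> (n <= m)%N -> cmod (u m - u n) <= B / n%:R.
Proof.
move=> B0 H n m n0 nm.
suff : cmod (u m - u n) <= B * (n%:R^-1 - m%:R^-1).
  by move/le_trans; apply; rewrite ler_wpM2l // lerBlDr lerDl invr_ge0.
rewrite -(subnK nm); elim: (m - n)%N => [|k IH]; first by rewrite add0n !subrr cmod0 mulr0.
rewrite addSn; have -> : u (k + n).+1 - u n = (u (k + n).+1 - u (k + n)%N) + (u (k + n)%N - u n) by ring.
apply: le_trans (cmodD _ _) _; apply: le_trans (lerD (H _ _) IH) _; first by rewrite addn_gt0 n0 orbT.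
by rewrite -mulrDr ler_wpM2l // addrC addrA subrK.
Qed.

Lemma inv_lt_eps (e : R) : 0 < e -> exists N, (0 < N)%N /\ forall n, (N <= n)%N -> n%:R^-1 <= e.
Proof.
move=> e0; exists (Num.truncn e^-1).+1; split => // n nN.
have N0 : (0 : R) < (Num.truncn e^-1).+1%:R by rewrite ltr0n.
have n0 : (0 : R) < n%:R by rewrite ltr0n (leq_trans _ nN).
rewrite -[e]invrK lef_pV2 ?posrE ?invr_gt0 //.
by apply: le_trans (ltW (truncnS_gt _)) _; rewrite ler_nat.
Qed.

Lemma telescope_ccvg u (B : R) : 0 <= B ->
  (forall k, (0 < k)%N -> cmod (u k.+1 - u k) <= B * (k%:R^-1 - k.+1%:R^-1)) ->
  exists l, ccvg u l /\ forall n, (0 < n)%N -> cmod (l - u n) <= B / n%:R.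
Proof.
move=> B0 H; have T := telescope_bound B0 H.
have [e e0|l Hl] := @ccvg_cauchy u.
  have B10 : 0 < 2 * (B + 1) by lra.
  have [N [N0 HN]] := inv_lt_eps (divr_gt0 e0 B10).
  exists N => n m nN mN.
  have -> : u n - u m = (u n - u N) - (u m - u N) by ring.
  apply: le_trans (cmodB _ _) _.
  have K : B / N%:R <= e / 2.
    have := HN _ (leqnn N); rewrite ler_pdivlMr // => K.
    have : 0 <= N%:R^-1 :> R by rewrite invr_ge0.
    nra.
  have := T _ _ N0 nN; have := T _ _ N0 mN; lra.
exists l; split => // n n0.
apply: (@ccvg_cmod_le (fun m => u (m + n)%N - u n)).
  apply: ccvgB; last exact: ccvg_cst.
  by move=> e /Hl[N HN]; exists N => m mN; apply: HN; apply: leq_trans mN (leq_addr _ _).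
by move=> m; apply: T => //; apply: leq_addl.
Qed.

End ComplexLimits.

(** * Bounded limits of holomorphic functions *)

Section HolomorphicLimits.
Context {R : realType}.
Implicit Types (f g : R[i] -> R[i]) (x y a b : R) (z w h k p : R[i]).

(** A ball for the sup norm of the two real coordinates, the shape on which the rectangle form of
    Cauchy's formula applies. *)
Definition square p (r : R) : set R[i] :=
  [set w | `|complex.Re w - complex.Re p| <= r /\ `|complex.Im w - complex.Im p| <= r].

Lemma square_center p r : 0 <= r -> square p r p.
Proof. by move=> r0; split; rewrite subrr normr0. Qed.

Lemma square_add p r h : cmod h <= r -> square p r (p + h).
Proof.
by move=> hr; split; rewrite ?ReD ?ImD addrC addrA subrr add0r || rewrite ?ReD ?ImD [_ + _ - _]addrAC subrr add0r;
  [apply: le_trans (normRe_le _) hr|apply: le_trans (normIm_le _) hr].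
Qed.

Lemma square_cmod p r w : square p r w -> cmod (w - p) <= 2 * r.
Proof.
by move=> [h1 h2]; apply: le_trans (cmod_leD _) _; rewrite ReB ImB; lra.
Qed.

Lemma cauchy_square f p (r M : R) : 0 < r ->
  (forall w, square p r w -> holo f w) ->
  (forall w, square p r w -> cmod (f w) <= M) ->
  exists A, forall h, cmod h <= r / 2 ->
    cmod (f (p + h) - f p - A * h) <= 4 / r ^+ 2 * M * cmod h ^+ 2.
Proof.
case: p => a b r0 hf fM.
have sq x y : a - r <= x <= a + r -> b - r <= y <= b + r -> square (a +i* b) r (x +i* y).
  by move=> hx hy; split; rewrite /= ler_norml; lra.
apply: cauchy_estimate => // x y hx hy; first by apply: hf; apply: sq.
by apply: fM; apply: sq.
Qed.

Lemma cauchy_lipschitz f p (r M : R) : 0 < r ->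
  (forall w, square p r w -> holo f w) ->
  (forall w, square p r w -> cmod (f w) <= M) ->
  forall h, cmod h <= r / 2 -> cmod (f (p + h) - f p) <= 8 / r * M * cmod h.
Proof.
move=> r0 hf fM h hr; have [A HA] := cauchy_square r0 hf fM.
have M0 : 0 <= M by apply: le_trans (cmod_ge0 _) (fM p _); apply: square_center; apply: ltW.
have r20 : 0 <= r / 2 by lra.
(* The Taylor bound at h = r / 2 gives |A| r / 2 <= 2 M + M. The remainder adds 2 / r M |h|, hence 8
   / r in total. *)
have A6 : cmod A <= 6 / r * M.
  have rr : cmod (r / 2)%:C = r / 2 by rewrite cmod_real ger0_norm.
  have := HA (r / 2)%:C; rewrite rr => /(_ (lexx _)) H.
  have : cmod (A * (r / 2)%:C) <= 3 * M.
    have -> : A * (r / 2)%:C = (f (p + (r / 2)%:C) - f p) -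
      (f (p + (r / 2)%:C) - f p - A * (r / 2)%:C) by ring.
    apply: le_trans (cmodB _ _) _.
    have -> : 3 * M = (M + M) + 4 / r ^+ 2 * M * (r / 2) ^+ 2 by field; rewrite lt0r_neq0.
    apply: lerD H; apply: le_trans (cmodB _ _) _; apply: lerD; apply: fM.
      by apply: square_add; rewrite rr; lra.
    by apply: square_center; apply: ltW.
  rewrite cmodM rr -ler_pdivlMr; last lra.
  by have -> : 3 * M / (r / 2) = 6 / r * M by field; rewrite lt0r_neq0.
have -> : f (p + h) - f p = (f (p + h) - f p - A * h) + A * h by ring.
apply: le_trans (cmodD _ _) _; rewrite cmodM.
have H1 : 4 / r ^+ 2 * M * cmod h ^+ 2 <= 2 / r * M * cmod h.
  have -> : 2 / r * M * cmod h = 4 / r ^+ 2 * M * (cmod h * (r / 2)).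
    by field; rewrite lt0r_neq0.
  rewrite ler_wpM2l //; first by rewrite mulr_ge0 // divr_ge0 // sqr_ge0.
  by rewrite expr2 ler_wpM2l // cmod_ge0.
have H2 : cmod A * cmod h <= 6 / r * M * cmod h by rewrite ler_wpM2r // cmod_ge0.
have H3 := HA _ hr.
have -> : 8 / r * M * cmod h = 2 / r * M * cmod h + 6 / r * M * cmod h by ring.
by apply: lerD H2; apply: le_trans H3 H1.
Qed.

Lemma holo_taylor f p A (K d : R) : 0 < d ->
  (forall h, cmod h <= d -> cmod (f (p + h) - f p - A * h) <= K * cmod h ^+ 2) ->
  is_cderiv f p A.
Proof.
move=> d0 H e e0; have K0 : 0 < `|K| + 1 by rewrite ltr_wpDl.
exists (Num.min d (e / (`|K| + 1))); first by rewrite lt_min d0 divr_gt0.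
move=> h; rewrite lt_min => /andP[/ltW hd]; rewrite ltr_pdivlMr // => he.
apply: le_trans (H _ hd) _; rewrite expr2 mulrA ler_wpM2r ?cmod_ge0 //.
by have := cmod_ge0 h; have := ler_norm K; nra.
Qed.

(* Cauchy's estimate bounds the second-order Taylor remainders uniformly along
   the sequence, so the derivatives converge. *)
Lemma holo_bounded_limit (F : nat -> R[i] -> R[i]) f p (r M : R) : 0 < r ->
  (forall n w, square p r w -> holo (F n) w) ->
  (forall n w, square p r w -> cmod (F n w) <= M) ->
  (forall w, square p r w -> ccvg (F ^~ w) (f w)) -> holo f p.
Proof.
move=> r0 hF FM Ff.
have M0 : 0 <= M.
  by apply: le_trans (cmod_ge0 _) (FM 0%N p _); apply: square_center; apply: ltW.
set K := 4 / r ^+ 2 * M.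
have K0 : 0 <= K by rewrite mulr_ge0 // divr_ge0 // sqr_ge0.
have HA n : exists A, forall h, cmod h <= r / 2 ->
    cmod (F n (p + h) - F n p - A * h) <= K * cmod h ^+ 2.
  exact: (cauchy_square r0 (hF n) (FM n)).
have [A {}HA] := choice HA.
have sq h : cmod h <= r / 2 -> square p r (p + h).
  by move=> hr; apply: square_add; lra.
have sp : square p r p by apply: square_center; apply: ltW.
have [e e0|B HB] := @ccvg_cauchy _ A.
  (* At the step t the two Taylor remainders cost at most e t / 4 each and the four values of F at
     most e t / 8 each; together this is e t, which is divided by t. *)
  pose t := Num.min (r / 2) (e / (4 * (K + 1))).
  have t0 : 0 < t.
    by rewrite lt_min !divr_gt0 // mulr_gt0 //; lra.
  have tr : t <= r / 2 by rewrite ge_min lexx.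
  have te : K * t <= e / 4.
    have : t <= e / (4 * (K + 1)) by rewrite ge_min lexx orbT.
    rewrite ler_pdivlMr; last lra.
    move=> H; nra.
  clearbody t.
  have ct : cmod t%:C = t by rewrite cmod_real gtr0_norm.
  have tsq : square p r (p + t%:C) by apply: sq; rewrite ct.
  have e1 : 0 < e * t / 8 by rewrite divr_gt0 // mulr_gt0.
  have [N1 H1] := Ff _ tsq _ e1; have [N2 H2] := Ff _ sp _ e1.
  exists (maxn N1 N2) => n m; rewrite !geq_max => /andP[n1 n2] /andP[m1 m2].
  have Hn := HA n t%:C; have Hm := HA m t%:C; rewrite ct in Hn Hm.
  have {}Hn := Hn tr; have {}Hm := Hm tr.
  have n1' := H1 _ n1; have n2' := H2 _ n2; have m1' := H1 _ m1; have m2' := H2 _ m2.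
  have : cmod ((A n - A m) * t%:C) <= e * t.
    set fn1 := F n (p + t%:C) in Hn n1'; set fn0 := F n p in Hn n2'.
    set fm1 := F m (p + t%:C) in Hm m1'; set fm0 := F m p in Hm m2'.
    have -> : (A n - A m) * t%:C = (fm1 - fm0 - A m * t%:C) - (fn1 - fn0 - A n * t%:C) +
      ((fn1 - f (p + t%:C)) - (fm1 - f (p + t%:C)) - ((fn0 - f p) - (fm0 - f p))) by ring.
    have Kt : K * t ^+ 2 <= e * t / 4.
      have -> : e * t / 4 = e / 4 * t by ring.
      by rewrite expr2 mulrA ler_wpM2r // ltW.
    have B1 := cmodB (fm1 - fm0 - A m * t%:C) (fn1 - fn0 - A n * t%:C).
    have B2 := cmodB (fn1 - f (p + t%:C)) (fm1 - f (p + t%:C)).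
    have B3 := cmodB (fn0 - f p) (fm0 - f p).
    have B4 := cmodB ((fn1 - f (p + t%:C)) - (fm1 - f (p + t%:C))) ((fn0 - f p) - (fm0 - f p)).
    apply: le_trans (cmodD _ _) _; lra.
  by rewrite cmodM ct ler_pM2r.
exists B; apply: (@holo_taylor _ _ _ K (r / 2)); first lra.
move=> h hr; apply: (@ccvg_cmod_le _ (fun n => F n (p + h) - F n p - A n * h)).
  apply: ccvgB; first by apply: ccvgB; apply: Ff => //; apply: sq.
  by apply: ccvgM => //; apply: ccvg_cst.
by move=> n; apply: HA.
Qed.

End HolomorphicLimits.

(** * Joint from separate holomorphy *)

Section TwoVariables.
Context {R : realType}.
Implicit Types (F : R[i] -> R[i] -> R[i]) (z w h k p : R[i]).

(** The mixed difference is controlled by using Cauchy's Lipschitz bound twice: G(w) = F(w, q + k) -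
    F(w, q) is O(|k|) by the bound in the second variable and holomorphic in w, so G(p + h) - G(p)
    is O(|h| |k|). *)
Lemma osgood F (p q : R[i]) (r M : R) : 0 < r ->
  (forall w z, square p r w -> square q r z ->
     [/\ holo (F ^~ z) w, holo (F w) z & cmod (F w z) <= M]) ->
  exists A B K, forall h k, cmod h <= r / 2 -> cmod k <= r / 2 ->
    cmod (F (p + h) (q + k) - F p q - (A * h + B * k)) <= K * (cmod h + cmod k) ^+ 2.
Proof.
move=> r0 H.
have sp : square p r p by apply: square_center; apply: ltW.
have sq : square q r q by apply: square_center; apply: ltW.
have M0 : 0 <= M by apply: le_trans (cmod_ge0 (F p q)) _; have [] := H _ _ sp sq.
have [A HA] : exists A, forall h, cmod h <= r / 2 ->
    cmod (F (p + h) q - F p q - A * h) <= 4 / r ^+ 2 * M * cmod h ^+ 2.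
  by apply: (@cauchy_square _ (F ^~ q) p r M r0) => w sw; have [] := H _ _ sw sq.
have [B HB] : exists B, forall k, cmod k <= r / 2 ->
    cmod (F p (q + k) - F p q - B * k) <= 4 / r ^+ 2 * M * cmod k ^+ 2.
  by apply: (@cauchy_square _ (F p) q r M r0) => w sw; have [] := H _ _ sp sw.
exists A, B, (4 / r ^+ 2 * M + (8 / r) ^+ 2 * M) => h k hr kr.
have sk : square q r (q + k) by apply: square_add; lra.
pose G w := F w (q + k) - F w q.
have G1 w : square p r w -> cmod (G w) <= 8 / r * M * cmod k.
  by move=> sw; apply: (@cauchy_lipschitz _ (F w) q r M) => // z sz; have [] := H _ _ sw sz.
have G2 : cmod (G (p + h) - G p) <= 8 / r * (8 / r * M * cmod k) * cmod h.
  apply: (@cauchy_lipschitz _ G p r) => // w sw.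
  by apply: holoB; [have [] := H _ _ sw sk|have [] := H _ _ sw sq].
have -> : F (p + h) (q + k) - F p q - (A * h + B * k) =
  (G (p + h) - G p) + (F (p + h) q - F p q - A * h) + (F p (q + k) - F p q - B * k).
  by rewrite /G; ring.
have H1 := HA _ hr; have H2 := HB _ kr.
set C1 := 4 / r ^+ 2 * M in H1 H2 *; set C2 := (8 / r) ^+ 2 * M.
have C10 : 0 <= C1 by rewrite mulr_ge0 // divr_ge0 // sqr_ge0.
have C20 : 0 <= C2 by rewrite mulr_ge0 // sqr_ge0.
have {}G2 : cmod (G (p + h) - G p) <= C2 * (cmod k * cmod h).
  by apply: le_trans G2 _; rewrite /C2 le_eqVlt; apply/orP; left; apply/eqP; ring.
have h0 := cmod_ge0 h; have k0 := cmod_ge0 k.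
apply: le_trans (cmodD _ _) _; apply: le_trans (lerD (cmodD _ _) H2) _.
apply: le_trans (lerD (lerD G2 H1) (lexx _)) _.
move: (cmod h) (cmod k) h0 k0 => x y x0 y0; rewrite -subr_ge0.
have -> : (C1 + C2) * (x + y) ^+ 2 - (C2 * (y * x) + C1 * x ^+ 2 + C1 * y ^+ 2) =
  C1 * (2 * (x * y)) + C2 * (x ^+ 2 + y ^+ 2 + x * y) by ring.
have xy0 : 0 <= x * y by rewrite mulr_ge0.
by apply: addr_ge0; apply: mulr_ge0 => //; rewrite ?mulr_ge0 ?addr_ge0 ?sqr_ge0.
Qed.

Lemma differentiable_osgood F (p q : R[i]) (r M : R) : 0 < r ->
  (forall w z, square p r w -> square q r z ->
     [/\ holo (F ^~ z) w, holo (F w) z & cmod (F w z) <= M]) ->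
  differentiable ((fun pq => F pq.1 pq.2) : R[i]^o * R[i]^o -> R[i]^o)
    ((p, q) : R[i]^o * R[i]^o).
Proof.
move=> r0 /(osgood r0)[A [B [K HK]]].
pose V : normedModType R[i] := (R[i]^o * R[i]^o)%type.
pose L : V -> R[i]^o := fun v => A *: (v.1 : R[i]^o) + B *: (v.2 : R[i]^o).
have dL (v : V) : differentiable L v.
  apply: differentiableD; apply: differentiableZ.
    apply: (@linear_differentiable _ _ _ fst) => u; exact: cvg_fst.
  apply: (@linear_differentiable _ _ _ snd) => u; exact: cvg_snd.
(* Without its linear part the function has the zero map as differential, and the required little-o
   expansion is the quadratic bound of [osgood]. *)
pose G : V -> R[i]^o := fun v => F v.1 v.2 - L v.
have EG : G \o shift ((p, q) : V) = cst (G (p, q)) + (\0 : V -> R[i]^o) +o_ 0 id.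
  apply/eqaddoP => e' /complex_gt0P[e e0 ->].
  have K0 : 0 < 4 * (`|K| + 1) by rewrite mulr_gt0 // ltr_wpDl.
  pose d := Num.min (r / 2) (e / (4 * (`|K| + 1))).
  have d0 : 0 < d by rewrite lt_min !divr_gt0.
  apply/nbhs_ballP; exists d%:C; first by rewrite /= ltcR.
  move=> [h k] [/=]; rewrite /ball /= !sub0r !normrN !normE !ltcR => hd kd.
  have [hr kr] : cmod h <= r / 2 /\ cmod k <= r / 2.
    by move: hd kd; rewrite !lt_min => /andP[/ltW ? _] /andP[/ltW ? _].
  rewrite [_ (h, k)](_ : _ = F (p + h) (q + k) - F p q - (A * h + B * k)); last first.
    rewrite /G /L /= !fctE /= addr0 [h + p]addrC [k + q]addrC /GRing.scale /=; ring.
  rewrite prod_normE /= !normE.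
  set m := Num.max (cmod h) (cmod k).
  have -> : Num.max (cmod h)%:C (cmod k)%:C = m%:C.
    by rewrite /m /Order.max ltcR; case: ifP.
  rewrite -rmorphM /= lecR; apply: le_trans (HK _ _ hr kr) _.
  have hm : cmod h <= m by rewrite le_max lexx.
  have km : cmod k <= m by rewrite le_max lexx orbT.
  have md : m < d by rewrite gt_max hd kd.
  have me : m * (4 * (`|K| + 1)) <= e.
    rewrite -ler_pdivlMr //; apply: ltW; apply: lt_le_trans md _.
    by rewrite ge_min lexx orbT.
  have h0 := cmod_ge0 h; have k0 := cmod_ge0 k; have Kn := ler_norm K.
  have q1 : (cmod h + cmod k) ^+ 2 <= 4 * m ^+ 2 by nra.
  have q2 : K * (cmod h + cmod k) ^+ 2 <= (`|K| + 1) * (4 * m ^+ 2).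
    apply: le_trans (_ : (`|K| + 1) * (cmod h + cmod k) ^+ 2 <= _).
      by rewrite ler_wpM2r ?sqr_ge0 //; lra.
    by rewrite ler_wpM2l // addr_ge0.
  apply: le_trans q2 _; have m0 : 0 <= m by apply: le_trans h0 hm.
  have -> : (`|K| + 1) * (4 * m ^+ 2) = m * (4 * (`|K| + 1)) * m by ring.
  by rewrite ler_wpM2r.
have dG : differentiable G ((p, q) : V).
  apply/diff_locallyP; rewrite (@diff_unique _ _ _ G \0 _ _ EG); last exact: cst_continuous.
  by split; first exact: cst_continuous.
have -> : ((fun pq => F pq.1 pq.2) : V -> R[i]^o) = G + L.
  by apply/funext => v; rewrite /G !fctE subrK.
exact: differentiableD.
Qed.

End TwoVariables.

(** * The identity theorem from the positive axis *)

Section IdentityTheorem.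
Context {R : realType}.
Implicit Types (f : R[i] -> R[i]) (x y a b : R) (z w h : R[i]).

Lemma ccont_bounded (g : R -> R[i]) a b : a <= b -> (forall t, a <= t <= b -> ccont_at g t) ->
  exists M, forall t, a <= t <= b -> cmod (g t) <= M.
Proof.
move=> ab H; have [|c cab Hc] := @EVT_max R (fun t => cmod (g t)) a b ab.
  apply: continuous_in_subspaceT => t /[!inE] /=; rewrite in_itv /= => /H Ht.
  apply/cvgrPdist_le => e /Ht[d d0 Hd]; apply/nbhs_ballP; exists d => //= s.
  rewrite /ball /= => ts; have -> : s = t + (s - t) by ring.
  have /Hd : `|s - t| < d by rewrite distrC.
  set u := g (t + (s - t)); apply: le_trans; rewrite ler_norml.
  have := cmodB u (u - g t); have := cmodD (g t) (u - g t).
  have -> : g t + (u - g t) = u by ring.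
  have -> : u - (u - g t) = g t by ring.
  lra.
by exists (cmod (g c)) => t ht; apply: Hc; rewrite in_itv.
Qed.

Lemma holo_bounded_boundary f x1 x2 y1 y2 : x1 <= x2 -> y1 <= y2 ->
  bcont f x1 x2 y1 y2 -> exists M, forall w, boundary x1 x2 y1 y2 w -> cmod (f w) <= M.
Proof.
move=> x12 y12 [h1 h2 h3 h4].
have hc y : hcont f x1 x2 y -> exists M, forall t, x1 <= t <= x2 -> cmod (f (t +i* y)) <= M.
  move=> H; apply: ccont_bounded => // t /H /holo_cont Ht e /Ht[d d0 Hd]; exists d => // h hd.
  have -> : (t + h) +i* y = (t +i* y) + h%:C by apply: complex_eqP; rewrite /= ?addr0.
  by apply: Hd; rewrite cmod_real.
have vc x : vcont f x y1 y2 -> exists M, forall t, y1 <= t <= y2 -> cmod (f (x +i* t)) <= M.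
  move=> H; apply: ccont_bounded => // t /H /holo_cont Ht e /Ht[d d0 Hd]; exists d => // h hd.
  have -> : x +i* (t + h) = (x +i* t) + 'i * h%:C.
    by apply: complex_eqP; rewrite /=; ring.
  by apply: Hd; rewrite cmodM cmod_i mul1r cmod_real.
have [M1 H1] := hc _ h1; have [M2 H2] := hc _ h2.
have [M3 H3] := vc _ h3; have [M4 H4] := vc _ h4.
exists (Num.max (Num.max M1 M2) (Num.max M3 M4)) => _ [x [y [-> hx hy hor]]].
rewrite !le_max; case: hor => E; rewrite E in hx hy *.
- by rewrite H3 // !orbT.
- by rewrite H4 // !orbT.
- by rewrite H1.
- by rewrite H2 // !orbT.
Qed.

(* The Cauchy formula is applied to f exp(N u) on a rectangle resting on the
   real axis, where Re u < 0 on the three upper sides and Re u > 0 at z. *)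
Lemma identity_upper f c Y : 0 < c -> 0 < Y ->
  (forall z, 0 < complex.Re z -> holo f z) -> (forall x, 0 < x -> f x%:C = 0) ->
  f (c +i* Y) = 0.
Proof.
move=> c0 Y0 hf f0; pose a := c / 2; pose b := Y + 1.
have a0 : 0 < a by rewrite divr_gt0.
have ac : a < c by rewrite /a; lra.
(* With this k, cos (k (x - c)) vanishes on the vertical sides. As eps lies midway between exp (- k
   b) and exp (- k Y), Re u is at most - del on the top side and equals del at z. *)
pose k := pi / (2 * a); have k0 : 0 < k by rewrite divr_gt0 ?pi_gt0 // mulr_gt0.
pose eps := (expR (- (k * b)) + expR (- (k * Y))) / 2.
pose del := (expR (- (k * Y)) - expR (- (k * b))) / 2.
have del0 : 0 < del.
  by rewrite divr_gt0 // subr_gt0 ltr_expR ltrN2 ltr_pM2l // /b; lra.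
have ed : del <= eps.
  by rewrite /del /eps; have := expR_ge0 (- (k * b)); lra.
pose u w := cexp ('i * (w - c%:C) * k%:C) - eps%:C.
have hu w : holo u w.
  apply: holoB; last exact: holo_cst.
  apply: holo_cexp; apply: holoM; last exact: holo_cst.
  apply: holoM; first exact: holo_cst.
  by apply: holoB; [apply: holo_id|apply: holo_cst].
have Reu x y : complex.Re (u (x +i* y)) = expR (- (k * y)) * cos (k * (x - c)) - eps.
  rewrite /u ReB Re_cexp /=.
  by congr (expR _ * cos _ - _); ring.
set z := c +i* Y.
pose F N w := f w * cexp (N%:R * u w).
have hF N x y : 0 < x -> holo (F N) (x +i* y).
  move=> x0; apply: holoM; first exact: hf.
  by apply: holo_cexp; apply: holoM; [apply: holo_cst|apply: hu].
have xa12 : c - a <= c + a by lra.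
have b0 : 0 <= b by rewrite /b; lra.
have [M HM] : exists M, forall w, boundary (c - a) (c + a) 0 b w -> cmod (f w) <= M.
  apply: holo_bounded_boundary => //; apply: bcontP => // _ [x [y [-> hx _ _]]].
  by apply: hf => /=; lra.
pose s := Num.min a (Num.min Y 1).
have s0 : 0 < s by rewrite !lt_min a0 Y0 ltr01.
have [sa sY s1] : [/\ s <= a, s <= Y & s <= 1].
  by rewrite /s; split; rewrite !ge_min ?lexx ?orbT.
have far w : boundary (c - a) (c + a) 0 b w -> s <= cmod (w - z).
  have rr t : s <= t -> s <= `|t| by move=> ?; apply: le_trans (ler_norm _).
  move=> [x [y [-> _ _ [] ->]]].
  - apply: le_trans (normRe_le _); rewrite /= -normrN; apply: rr; lra.
  - apply: le_trans (normRe_le _); rewrite /=; apply: rr; lra.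
  - apply: le_trans (normIm_le _); rewrite /= -normrN; apply: rr; lra.
  - apply: le_trans (normIm_le _); rewrite /=; apply: rr; rewrite /b; lra.
have bdF N w : boundary (c - a) (c + a) 0 b w -> cmod (F N w) <= `|M|.
  move=> hw; have fM := HM _ hw; case: hw => [x [y [Ew hx hy hor]]].
  have [E|y0] : w = x%:C \/ complex.Re (u w) <= 0.
  - case: hor => E.
    + right; rewrite Ew Reu E; have -> : k * (c - a - c) = - (pi / 2).
        by rewrite /k; field; rewrite lt0r_neq0.
      rewrite cosN cos_pihalf mulr0; lra.
    + right; rewrite Ew Reu E; have -> : k * (c + a - c) = pi / 2.
        by rewrite /k; field; rewrite lt0r_neq0.
      rewrite cos_pihalf mulr0; lra.
    + by left; rewrite Ew E.
    + right; rewrite Ew Reu E.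
      have : expR (- (k * b)) * cos (k * (x - c)) <= expR (- (k * b)).
        by rewrite ler_piMr ?expR_ge0 // cos_le1.
      by move: del0; rewrite /eps /del; lra.
  - by rewrite /F E f0 ?mul0r ?cmod0 //; lra.
  rewrite /F cmodM cmod_cexp; apply: le_trans (_ : cmod (f w) * 1 <= _).
    rewrite ler_wpM2l ?cmod_ge0 // -expR0 ler_expR ReM.
    have -> : complex.Im (N%:R : R[i]) = 0 by rewrite -(rmorph_nat (real_complex R)).
    have -> : complex.Re (N%:R : R[i]) = N%:R by rewrite -(rmorph_nat (real_complex R)).
    by rewrite mul0r subr0 mulr_ge0_le0.
  by rewrite mulr1; apply: le_trans fM (ler_norm _).
(* The right-hand side is free of N while the left-hand side grows with N unless f z = 0. *)
have key N : cmod (f z) * expR (N%:R * del) * 4 <= 2 * (`|M| / s) * ((c + a - (c - a)) + (b - 0)).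
  have hr : holo_rect (F N) (c - a) (c + a) 0 b.
    by move=> x y hx hy; apply: hF; lra.
  have Hac : c - a < c < c + a by lra.
  have HY : 0 < Y < b by rewrite /b; lra.
  have := cauchy_formula Hac HY hr; rewrite -/z => E.
  have : cmod (oint (fun w => F N w * (w - z)^-1) (c - a) (c + a) 0 b) <=
      2 * (`|M| / s) * ((c + a - (c - a)) + (b - 0)).
    apply: oint_le => //.
      apply: bcontP => // w hw; apply: holoM.
        by case: hw => [x [y [-> hx _ _]]]; apply: hF; lra.
      apply: holo_pole; rewrite -subr_eq0 -cmod_gt0; have := far _ hw; lra.
    move=> w hw; rewrite cmodM cmodV ler_pM ?invr_ge0 ?cmod_ge0 //; first exact: bdF.
    have := far _ hw => fw; rewrite lef_pV2 ?posrE //; lra.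
  apply: le_trans; rewrite -E cmodM {E}.
  have c4 : 4 <= cmod (oint (fun w => (w - z)^-1) (c - a) (c + a) 0 b).
    apply: le_trans (Im_oint_pole Hac HY) _.
    by apply: le_trans (ler_norm _) (normIm_le _).
  apply: ler_pM => //; first by rewrite mulr_ge0 ?cmod_ge0 ?expR_ge0.
  rewrite /F cmodM cmod_cexp ler_wpM2l ?cmod_ge0 // ler_expR ReM.
  have -> : complex.Im (N%:R : R[i]) = 0 by rewrite -(rmorph_nat (real_complex R)).
  have -> : complex.Re (N%:R : R[i]) = N%:R by rewrite -(rmorph_nat (real_complex R)).
  rewrite mul0r subr0 ler_wpM2l // Reu subrr mulr0 cos0 mulr1 /del /eps; lra.
set Q := 2 * _ * _ in key.
apply/eqP; rewrite -cmod_eq0; apply/negPn/negP => fz.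
have fz0 : 0 < cmod (f z) by rewrite lt_def fz cmod_ge0.
pose N := (Num.truncn (Q / (cmod (f z) * 4 * del))).+1.
have := key N; apply/negP; rewrite -ltNge.
have D0 : 0 < cmod (f z) * 4 * del by apply: mulr_gt0 => //; apply: mulr_gt0.
have : Q / (cmod (f z) * 4 * del) < N%:R by apply: truncnS_gt.
rewrite ltr_pdivrMr // => QN; apply: lt_le_trans QN _.
have -> : N%:R * (cmod (f z) * 4 * del) = cmod (f z) * (N%:R * del) * 4 by ring.
rewrite ler_wpM2r // ler_wpM2l ?cmod_ge0 //.
by apply: le_trans (expR_ge1Dx _); rewrite lerDr.
Qed.

(** Reflection in the real axis, which reduces the lower quadrant to the upper one. *)
Lemma conjc_cderiv f z A : is_cderiv f z^* A -> is_cderiv (fun w => (f w^*)^*) z A^*.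
Proof.
have cc w : cmod w^* = cmod w by case: w => a b; rewrite /cmod /= sqrrN.
move=> H e /H[d d0 Hd]; exists d => // h hd.
have -> : (f (z + h)^*)^* - (f z^*)^* - A^* * h = (f (z^* + h^*) - f z^* - A * h^*)^*.
  by rewrite !(rmorphB, rmorphM, rmorphD) /= conjcK.
by rewrite cc -[cmod h]cc Hd // cc.
Qed.

Lemma identity_theorem f : (forall z, 0 < complex.Re z -> holo f z) ->
  (forall x, 0 < x -> f x%:C = 0) -> forall z, 0 < complex.Re z -> f z = 0.
Proof.
move=> hf f0 [c Y] /= c0; have [Y0|Y0|->] := ltgtP Y 0; last exact: f0.
- pose g w := (f w^*)^*.
  have : g (c +i* - Y) = 0.
    apply: identity_upper => //; first by rewrite oppr_gt0.
      by move=> z z0; have [|A HA] := hf z^*; [case: z z0|exists A^*; apply: conjc_cderiv].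
    by move=> x x0; rewrite /g conjc_real f0 // conjc0.
  by rewrite /g /= opprK => /(congr1 conjc); rewrite conjcK conjc0.
- exact: identity_upper.
Qed.

End IdentityTheorem.

(** * Estimates on bivariate Bernstein functions *)

Section ExpBounds.
Context {R : realType}.
Implicit Types (t s : R).

(** The bounds of this section compare the factors produced by differentiating exp (- t) with 1 -
    exp (- t), whose integrability the Levy form provides. *)
Lemma texpN_le t : t * expR (- t) <= 1 - expR (- t).
Proof.
have E : expR t * expR (- t) = 1 by rewrite -expRD subrr expR0.
have := expR_ge1Dx t; have := expR_gt0 (- t); nra.
Qed.

Lemma t2expN_le t : 0 <= t -> t ^+ 2 * expR (- t) <= 4 * (1 - expR (- t)).
Proof.
move=> t0.
have E : expR t * expR (- t) = 1 by rewrite -expRD subrr expR0.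
have E2 : expR t = expR (t / 2) ^+ 2 by rewrite expr2 -expRD -splitr.
have H : 1 + t ^+ 2 / 4 <= expR t by rewrite E2; have := expR_ge1Dx (t / 2); nra.
have := expR_gt0 (- t); nra.
Qed.

Lemma min2_le t : 0 <= t -> Num.min 2 t <= 4 * (1 - expR (- t)).
Proof.
move=> t0; have E : expR t * expR (- t) = 1 by rewrite -expRD subrr expR0.
have q0 := expR_gt0 (- t).
have q1 : (1 + t) * expR (- t) <= 1 by have := expR_ge1Dx t; nra.
have t1 : 0 < 1 + t by lra.
rewrite ge_min; case: (leP t 2) => t2; apply/orP; [right|left]; last nra.
rewrite -(ler_pM2r t1); nra.
Qed.

Lemma bernoulli_expN (N : nat) t : 0 <= t -> 1 - expR (- (N%:R * t)) <= N%:R * (1 - expR (- t)).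
Proof.
move=> t0; elim: N => [|N IH]; first by rewrite !mul0r oppr0 expR0 subrr.
have E : expR (- (N.+1%:R * t)) = expR (- (N%:R * t)) * expR (- t).
  by rewrite -expRD; congr expR; rewrite -natr1; ring.
rewrite E -natr1.
have : expR (- t) <= 1 by rewrite -expR0 ler_expR; lra.
have : expR (- (N%:R * t)) <= 1 by rewrite -expR0 ler_expR oppr_le0 mulr_ge0.
have := expR_gt0 (- t); nra.
Qed.

End ExpBounds.

(** * Integrals of a family of exponentials in one moving variable *)

Section ExpFamily.
Context {d : measure_display} {T : measurableType d} {R : realType}.
Variables (mu : {measure set T -> \bar R}) (D : set T).
Variables (y : T -> R) (th : T -> R[i]).
Hypothesis mD : measurable D.
Hypothesis my : measurable_fun D y.
Hypothesis y_ge0 : forall p, D p -> 0 <= y p.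
Hypothesis th_le0 : forall p, D p -> complex.Re (th p) <= 0.
Implicit Types (w h : R[i]) (x : R) (p : T).

Definition expfam w p := cexp (th p - w * (y p)%:C).
Definition levy_int x := \int[mu]_(p in D) (1 - expR (- (x * y p))).

Hypothesis hI : forall w, 0 <= complex.Re w -> cintegrable mu D (fun p => 1 - expfam w p).
Hypothesis hJ : forall x, 0 < x -> mu.-integrable D (fun p => (1 - expR (- (x * y p)))%:E).

Let F w := cintegral mu D (fun p => 1 - expfam w p).

Let integrable_scale (f : T -> R) (c : R) : mu.-integrable D (fun p => (f p)%:E) ->
  mu.-integrable D (fun p => (c * f p)%:E).
Proof.
move=> hf; apply: (eq_integrable mD _ _ _ (integrableZl mD c hf)).
by move=> p _; rewrite EFinM.
Qed.

Let expfam_diff_int w h : 0 <= complex.Re w -> 0 <= complex.Re (w + h) ->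
  cintegrable mu D (fun p => expfam w p - expfam (w + h) p).
Proof.
move=> w0 wh0; apply: (eq_cintegrable mD _ (cintegrableB mD (hI wh0) (hI w0))).
by move=> p _; ring.
Qed.

Let F_diff w h : 0 <= complex.Re w -> 0 <= complex.Re (w + h) ->
  F (w + h) - F w = cintegral mu D (fun p => expfam w p - expfam (w + h) p).
Proof.
move=> w0 wh0; rewrite /F -cintegralB //; try exact: hI.
by apply: eq_cintegral => // p _; ring.
Qed.

Let Re_expo w x p : D p -> x <= complex.Re w ->
  complex.Re (th p - w * (y p)%:C) <= - (x * y p).
Proof.
move=> Dp xw; rewrite ReB ReM /= mulr0 subr0.
by have := th_le0 Dp; have := y_ge0 Dp; nra.
Qed.

Let expfam_add w h p : expfam (w + h) p = cexp ((th p - w * (y p)%:C) + (- (h * (y p)%:C))).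
Proof. by congr cexp; ring. Qed.

Let cmod_hy h p : D p -> cmod (- (h * (y p)%:C)) = cmod h * y p.
Proof. by move=> Dp; rewrite cmodN cmodM cmod_real ger0_norm // y_ge0. Qed.

Let y_exp_le x p : 0 < x -> D p -> y p * expR (- (x * y p)) <= x^-1 * (1 - expR (- (x * y p))).
Proof.
move=> x0 Dp; rewrite ler_pdivlMl // mulrA; exact: texpN_le.
Qed.

(** Pointwise, |h| y exp (- x y) <= (|h| / x) (1 - exp (- x y)). Only the real parts at both ends
    matter, so h need not be small. *)
Lemma expfam_lip w h x : 0 < x -> x <= complex.Re w -> x <= complex.Re (w + h) ->
  cmod (F (w + h) - F w) <= cmod h * (levy_int x / x).
Proof.
move=> x0 xw xwh; rewrite F_diff; try lra.
have -> : cmod h * (levy_int x / x) =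
    \int[mu]_(p in D) ((cmod h / x) * (1 - expR (- (x * y p)))).
  rewrite RintegralZl //; first by rewrite /levy_int; ring.
  exact: hJ.
apply: cmod_cintegral_le => //; first by apply: expfam_diff_int; lra.
  by apply: integrable_scale; apply: hJ.
move=> p Dp; rewrite cmodBC expfam_add.
apply: le_trans (cexp_lip (Re_expo Dp xw) _) _.
  by have := Re_expo Dp xwh; rewrite (_ : _ - _ * _ = th p - w * (y p)%:C - h * (y p)%:C) //; ring.
rewrite cmod_hy // -!mulrA ler_wpM2l ?cmod_ge0 //; exact: y_exp_le.
Qed.

Let yexp_meas w : 0 <= complex.Re w ->
  measurable_fun D (fun p => complex.Re ((y p)%:C * expfam w p)) /\
  measurable_fun D (fun p => complex.Im ((y p)%:C * expfam w p)).
Proof.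
move=> /hI[h1 h2].
have {}h1 := measurable_int _ h1; have {}h2 := measurable_int _ h2.
move/measurable_EFinP : h1 => h1; move/measurable_EFinP : h2 => h2.
split.
  have -> : (fun p => complex.Re ((y p)%:C * expfam w p)) =
      (fun p => y p * (1 - complex.Re (1 - expfam w p))).
    by apply/funext => p; rewrite ReM ReB /=; ring.
  by apply: measurable_funM => //; apply: measurable_funB.
have -> : (fun p => complex.Im ((y p)%:C * expfam w p)) =
    (fun p => y p * - complex.Im (1 - expfam w p)).
  by apply/funext => p; rewrite ImM ImB /=; ring.
apply: measurable_funM => //; exact: measurableT_comp.
Qed.

Let yexp_le w x p : 0 < x -> x <= complex.Re w -> D p ->
  cmod ((y p)%:C * expfam w p) <= x^-1 * (1 - expR (- (x * y p))).
Proof.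
move=> x0 xw Dp; rewrite cmodM cmod_real ger0_norm ?y_ge0 // cmod_cexp.
apply: le_trans (y_exp_le x0 Dp); rewrite ler_wpM2l ?y_ge0 // ler_expR.
exact: Re_expo.
Qed.

Let yexp_int w : 0 < complex.Re w -> cintegrable mu D (fun p => (y p)%:C * expfam w p).
Proof.
move=> w0; have [m1 m2] := yexp_meas (ltW w0).
apply: (cintegrable_le mD m1 m2 (integrable_scale (complex.Re w)^-1 (hJ w0))).
by move=> p Dp; apply: yexp_le.
Qed.

(** Differentiation under the integral: A is the integral of y times the exponential. The
    second-order remainder |h|^2 y^2 exp (- x y) is handled by [t2expN_le], the source of the 4. *)
Lemma expfam_taylor w : 0 < complex.Re w -> exists A,
  cmod A <= levy_int (complex.Re w) / complex.Re w /\
  forall x h, 0 < x -> x <= complex.Re w -> x <= complex.Re (w + h) ->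
  cmod (F (w + h) - F w - A * h) <= 4 * cmod h ^+ 2 * (levy_int x / x ^+ 2).
Proof.
move=> w0; exists (cintegral mu D (fun p => (y p)%:C * expfam w p)); split.
  rewrite mulrC -RintegralZl //; last exact: hJ.
  apply: cmod_cintegral_le => //; first exact: yexp_int.
    by apply: integrable_scale; apply: hJ.
  by move=> p Dp; apply: yexp_le.
move=> x h x0 xw xwh; rewrite F_diff; try lra.
rewrite mulrC -cintegralZ //; last exact: yexp_int.
rewrite -cintegralB //; last 2 first.
- by apply: expfam_diff_int; lra.
- by apply: cintegrableZ => //; apply: yexp_int.
have -> : 4 * cmod h ^+ 2 * (levy_int x / x ^+ 2) =
    \int[mu]_(p in D) ((4 * cmod h ^+ 2 / x ^+ 2) * (1 - expR (- (x * y p)))).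
  rewrite RintegralZl //; first by rewrite /levy_int; ring.
  exact: hJ.
apply: cmod_cintegral_le => //.
- apply: cintegrableB => //; first by apply: expfam_diff_int; lra.
  by apply: cintegrableZ => //; apply: yexp_int.
- by apply: integrable_scale; apply: hJ.
move=> p Dp; set u := th p - w * (y p)%:C; set v := - (h * (y p)%:C).
have -> : expfam w p - expfam (w + h) p - h * ((y p)%:C * expfam w p) =
    - (cexp (u + v) - cexp u - v * cexp u).
  rewrite expfam_add -/u (_ : expfam w p = cexp u) // /v; ring.
rewrite cmodN; apply: le_trans (cexp_taylor (Re_expo Dp xw) _) _.
  by have := Re_expo Dp xwh; rewrite (_ : _ - _ * _ = u + v) // /u /v; ring.
rewrite cmod_hy // exprMn.
have := t2expN_le (mulr_ge0 (ltW x0) (y_ge0 Dp)) => H.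
have -> : 4 * cmod h ^+ 2 / x ^+ 2 * (1 - expR (- (x * y p))) =
  cmod h ^+ 2 * ((4 * (1 - expR (- (x * y p)))) / x ^+ 2) by ring.
rewrite -[leLHS]mulrA ler_wpM2l ?sqr_ge0 // ler_pdivlMr ?exprn_gt0 //.
by apply: le_trans H; rewrite exprMn le_eqVlt; apply/orP; left; apply/eqP; ring.
Qed.

(** On the imaginary axis there is no exponential decay to use. The integrand is bounded by min (2,
    |h| y), comparable with 1 - exp (- |h| y), and [levy_int_small] makes the integral of the latter
    small. *)
Lemma expfam_cont w h : 0 <= complex.Re w -> 0 <= complex.Re (w + h) -> h != 0 ->
  cmod (F (w + h) - F w) <= 4 * levy_int (cmod h).
Proof.
move=> w0 wh0 h0; have hp : 0 < cmod h by rewrite cmod_gt0.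
rewrite F_diff // -RintegralZl //; last exact: hJ.
apply: cmod_cintegral_le => //; first exact: expfam_diff_int.
  by apply: integrable_scale; apply: hJ.
move=> p Dp; apply: le_trans (min2_le (mulr_ge0 (ltW hp) (y_ge0 Dp))).
have R1 : complex.Re (th p - w * (y p)%:C) <= 0.
  by have := Re_expo Dp w0; rewrite mul0r oppr0.
have R2 : complex.Re (th p - w * (y p)%:C + - (h * (y p)%:C)) <= 0.
  by have := Re_expo Dp wh0; rewrite mul0r oppr0 (_ : _ - _ * _ = th p - w * (y p)%:C - h * (y p)%:C) //; ring.
rewrite cmodBC expfam_add le_min; apply/andP; split; last first.
  by apply: le_trans (cexp_lip R1 R2) _; rewrite expR0 mulr1 cmod_hy.
apply: le_trans (cmodB _ _) _; rewrite !cmod_cexp.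
have E (t : R) : t <= 0 -> expR t <= 1 by rewrite -[in X in _ -> X]expR0 ler_expR.
have := E _ R1; have := E _ R2; lra.
Qed.

Lemma levy_int_ge0 x : 0 <= x -> 0 <= levy_int x.
Proof.
move=> x0; apply: Rintegral_ge0 => p Dp.
by rewrite subr_ge0 -expR0 ler_expR oppr_le0 mulr_ge0 // y_ge0.
Qed.

Lemma levy_int_mono x x' : 0 < x -> x <= x' -> levy_int x <= levy_int x'.
Proof.
move=> x0 xx'; apply: le_Rintegral => //; [exact: hJ|apply: hJ; lra|].
by move=> p Dp; rewrite lerD2l lerN2 ler_expR lerN2 ler_wpM2r // y_ge0.
Qed.

(** Propagates the vanishing of the Levy integral from one point to all of (0, oo), as [phi_pos]
    requires. *)
Lemma levy_int_mul x (N : nat) : 0 < x -> (0 < N)%N ->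
  levy_int (N%:R * x) <= N%:R * levy_int x.
Proof.
move=> x0 N0; rewrite -RintegralZl //; last exact: hJ.
apply: le_Rintegral => //.
- by apply: hJ; rewrite mulr_gt0 // ltr0n.
- by apply: integrable_scale; apply: hJ.
by move=> p Dp; rewrite -mulrA bernoulli_expN // mulr_ge0 ?y_ge0 // ltW.
Qed.

Lemma levy_int_small (e : R) : 0 < e -> exists2 x, 0 < x & levy_int x <= e.
Proof.
move=> e0.
pose f n p : \bar R := (1 - expR (- (n.+1%:R^-1 * y p)))%:E.
have cv : (\int[mu]_(p in D) f n p)%E @[n --> \oo] --> (\int[mu]_(p in D) (cst 0 p))%E.
  apply: (@dominated_cvg _ _ _ _ _ mD f (cst 0) (fun p => (1 - expR (- (1 * y p)))%:E)) => //.
  - by move=> n; apply: measurable_int (hJ _); rewrite invr_gt0.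
  - move=> p Dp; apply/fine_cvgP; split; first by near=> n.
    have -> : (0 : R) = 1 - expR (- (0 * y p)) by rewrite mul0r oppr0 expR0 subrr.
    apply: cvgB; first exact: cvg_cst.
    apply: (@continuous_cvg _ _ _ _ _ _ expR); first exact: continuous_expR.
    apply: cvgN.
    apply: cvgM; last exact: cvg_cst.
    exact: cvg_harmonic.
  - exact: hJ.
  move=> n p Dp; rewrite /f /= lee_fin ger0_norm.
    rewrite lerD2l lerN2 ler_expR lerN2 ler_wpM2r ?y_ge0 //.
    by rewrite invf_le1 ?ler1n.
  by rewrite subr_ge0 -expR0 ler_expR oppr_le0 mulr_ge0 ?y_ge0 // invr_ge0.
rewrite integral0 in cv.
have {}cv : (fun n => levy_int n.+1%:R^-1) @ \oo --> (0 : R).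
  by move/fine_cvg : cv.
move/cvgrPdist_le : cv => /(_ _ e0)[N _ /(_ N (leqnn N))] /=.
rewrite sub0r normrN => H; exists N.+1%:R^-1; first by rewrite invr_gt0.
by apply: le_trans (ler_norm _) H.
Unshelve. all: by end_near. Qed.

End ExpFamily.

(* All constants are relative to phi(x) = Re kappa(0, x), hence uniform in zeta. *)
Record kappa_facts {R : realType} (kappa : R[i] -> R[i] -> R[i]) (phi : R -> R) : Prop := {
  kf_pos : forall x, 0 < x -> 0 < phi x;
  kf_mono : forall x x', 0 < x -> x <= x' -> phi x <= phi x';
  kf_Re : forall zeta z, closed_half_plane zeta -> half_plane z ->
    phi (complex.Re z) <= complex.Re (kappa zeta z);
  kf_lip : forall zeta z h x, closed_half_plane zeta -> 0 < x ->
    x <= complex.Re z -> x <= complex.Re (z + h) ->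
    cmod (kappa zeta (z + h) - kappa zeta z) <= cmod h * (phi x / x);
  kf_taylor : forall zeta z, closed_half_plane zeta -> half_plane z -> exists A,
    cmod A <= phi (complex.Re z) / complex.Re z /\
    forall x h, 0 < x -> x <= complex.Re z -> x <= complex.Re (z + h) ->
    cmod (kappa zeta (z + h) - kappa zeta z - A * h) <= 4 * cmod h ^+ 2 * (phi x / x ^+ 2);
  kf_holo : forall zeta z, half_plane zeta -> half_plane z -> holo (kappa ^~ z) zeta;
  kf_cont : forall zeta z (e : R), closed_half_plane zeta -> half_plane z -> 0 < e ->
    exists2 d : R, 0 < d & forall h, closed_half_plane (zeta + h) -> cmod h < d ->
      cmod (kappa (zeta + h) z - kappa zeta z) <= e;
  kf_real : forall q x : R, 0 <= q -> 0 < x ->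
    kappa q%:C x%:C = (complex.Re (kappa q%:C x%:C))%:C;
  kf_real_mono : forall q x x' : R, 0 <= q -> 0 < x -> x <= x' ->
    complex.Re (kappa q%:C x%:C) <= complex.Re (kappa q%:C x'%:C) }.

(** * The estimates for kappa from its Levy form *)

Section KappaFacts.
Context {R : realType}.
Implicit Types (zeta z h w : R[i]) (x q : R).
Variables (kappa : R[i] -> R[i] -> R[i]) (d1 d2 : R).
Variable mu : {measure set (R * R) -> \bar R}.
Hypothesis k0 : 0 <= kappa 0 0.
Hypothesis d1_ge0 : 0 <= d1.
Hypothesis d2_ge0 : 0 <= d2.
Hypothesis Hk : forall zeta z : R[i], closed_half_plane zeta -> closed_half_plane z ->
      let f (x : R * R) := 1 - cexp (- zeta * x.1%:C - z * x.2%:C) in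
      cintegrable mu quadrant f /\
      kappa zeta z = kappa 0 0 + d1%:C * zeta + d2%:C * z
                     + cintegral mu quadrant f.

Lemma measurable_quadrant : measurable (@quadrant R).
Proof. by apply: measurableX; exact: measurable_itv. Qed.

Lemma quadrantP (p : R * R) : quadrant p -> 0 < p.1 /\ 0 < p.2.
Proof. by move=> [] /=; rewrite !in_itv /= !andbT. Qed.

Let mQ := measurable_quadrant.
Let thz zeta (p : R * R) : R[i] := - zeta * p.1%:C.
Let thzeta z (p : R * R) : R[i] := - z * p.2%:C.

Let thz_le0 zeta p : closed_half_plane zeta -> quadrant p -> complex.Re (thz zeta p) <= 0.
Proof.
move=> h /quadrantP[p1 _]; rewrite /thz ReM ReN /= mulr0 subr0 mulNr oppr_le0.
by rewrite mulr_ge0 // ltW.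
Qed.

Let thzeta_le0 z p : closed_half_plane z -> quadrant p -> complex.Re (thzeta z p) <= 0.
Proof.
move=> h /quadrantP[_ p2]; rewrite /thzeta ReM ReN /= mulr0 subr0 mulNr oppr_le0.
by rewrite mulr_ge0 // ltW.
Qed.

Let ch0 : closed_half_plane (0 : R[i]).
Proof. by rewrite /closed_half_plane /= lexx. Qed.

Let ch_real x : 0 <= x -> closed_half_plane x%:C.
Proof. by []. Qed.

Let hIz zeta w : closed_half_plane zeta -> 0 <= complex.Re w ->
  cintegrable mu quadrant (fun p => 1 - expfam snd (thz zeta) w p).
Proof. by move=> hz hw; have [] := Hk hz hw. Qed.

Let expfam_swap z zeta p : expfam fst (thzeta z) zeta p = expfam snd (thz zeta) z p.
Proof. by rewrite /expfam /thz /thzeta; congr cexp; ring. Qed.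

Let hIzeta z w : closed_half_plane z -> 0 <= complex.Re w ->
  cintegrable mu quadrant (fun p => 1 - expfam fst (thzeta z) w p).
Proof.
move=> hz hw; apply: (eq_cintegrable mQ _ (hIz hw hz)).
by move=> p _; rewrite expfam_swap.
Qed.

Let hJ2 x : 0 < x -> mu.-integrable quadrant (fun p => (1 - expR (- (x * p.2)))%:E).
Proof.
move=> x0; have [h _] := @hIz 0 x%:C ch0 (ltW x0).
apply: (eq_integrable mQ _ _ _ h) => p _; rewrite /expfam /thz ReB Re_cexp /=.
by rewrite !(mul0r, oppr0, mulr0, add0r, subr0, addr0) cos0 mulr1.
Qed.

Let hJ1 x : 0 < x -> mu.-integrable quadrant (fun p => (1 - expR (- (x * p.1)))%:E).
Proof.
move=> x0; have [h _] := @hIzeta 0 x%:C ch0 (ltW x0).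
apply: (eq_integrable mQ _ _ _ h) => p _; rewrite /expfam /thzeta ReB Re_cexp /=.
by rewrite !(mul0r, oppr0, mulr0, add0r, subr0, addr0) cos0 mulr1.
Qed.

Let msnd : measurable_fun quadrant (@snd R R).
Proof. exact: measurable_funTS. Qed.
Let mfst : measurable_fun quadrant (@fst R R).
Proof. exact: measurable_funTS. Qed.
Let snd_ge0 (p : R * R) : quadrant p -> 0 <= p.2.
Proof. by move=> /quadrantP[_ /ltW]. Qed.
Let fst_ge0 (p : R * R) : quadrant p -> 0 <= p.1.
Proof. by move=> /quadrantP[/ltW]. Qed.

Let J2 := levy_int mu quadrant snd.
Let J1 := levy_int mu quadrant fst.
Let phi x := complex.Re (kappa 0 x%:C).

Let kappaE zeta z : closed_half_plane zeta -> closed_half_plane z ->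
  kappa zeta z = kappa 0 0 + d1%:C * zeta + d2%:C * z +
    cintegral mu quadrant (fun p => 1 - expfam snd (thz zeta) z p).
Proof. by move=> h1 h2; have [_] := Hk h1 h2. Qed.

Let kappaE1 zeta z : closed_half_plane zeta -> closed_half_plane z ->
  kappa zeta z = kappa 0 0 + d1%:C * zeta + d2%:C * z +
    cintegral mu quadrant (fun p => 1 - expfam fst (thzeta z) zeta p).
Proof.
move=> h1 h2; rewrite kappaE //; congr (_ + _); apply: eq_cintegral => // p _.
by rewrite expfam_swap.
Qed.

Let Re_k0 : 0 <= complex.Re (kappa 0 0).
Proof. by move: k0; rewrite lecE => /andP[]. Qed.

Let Im_k0 : complex.Im (kappa 0 0) = 0.
Proof. exact: ger0_Im. Qed.

Let phiE x : 0 < x -> phi x = complex.Re (kappa 0 0) + d2 * x + J2 x.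
Proof.
move=> x0; rewrite /phi kappaE // ?mulr0 ?addr0 ?ReD; last exact: ltW.
rewrite !ReM /= !(mulr0, mul0r, subr0, addr0); congr (_ + _); apply: eq_Rintegral => p _.
by rewrite !(mul0r, oppr0, mulr0, add0r, subr0, addr0) cos0 mulr1.
Qed.

Let phi_J2 x : 0 < x -> J2 x <= phi x.
Proof. by move=> x0; rewrite phiE // lerDr addr_ge0 // mulr_ge0 // ltW. Qed.

(** Phases only decrease the real part of an exponential and |exp (- zeta x1)| <= 1, so the real
    part of the integrand dominates the integrand of phi (Re z). *)
Let Re_kappa zeta z : closed_half_plane zeta -> half_plane z ->
  phi (complex.Re z) <= complex.Re (kappa zeta z).
Proof.
move=> hz z0; have chz : closed_half_plane z by apply: ltW.
rewrite phiE // (kappaE hz chz); set I := cintegral _ _ _.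
have -> : complex.Re (kappa 0 0 + d1%:C * zeta + d2%:C * z + I) = complex.Re (kappa 0 0)
  + d1 * complex.Re zeta + d2 * complex.Re z + complex.Re I.
  by rewrite !ReD !ReM /= !mul0r !subr0.
apply: lerD.
  by rewrite lerD2r lerDl mulr_ge0.
apply: le_Rintegral => //; [exact: hJ2|by case: (hIz hz chz)|].
move=> p Qp; have [p1 p2] := quadrantP Qp; rewrite ReB Re_cexp lerD2l lerN2.
apply: le_trans (_ : expR (- (complex.Re z * p.2)) * 1 <= _); last by rewrite mulr1.
apply: le_trans (ler_wpM2l (expR_ge0 _) (cos_le1 _)) _.
rewrite !mulr1 ler_expR ReB (ReM z) /= mulr0 subr0 -[leRHS]add0r lerD2r.
exact: thz_le0.
Qed.

Let phi_mono x x' : 0 < x -> x <= x' -> phi x <= phi x'.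
Proof.
move=> x0 xx'; rewrite !phiE //; last exact: lt_le_trans xx'.
apply: lerD; first by rewrite lerD2l ler_wpM2l.
by apply: levy_int_mono => //; apply: hJ2.
Qed.

Let kappa_diff zeta z h : closed_half_plane zeta -> closed_half_plane z ->
  closed_half_plane (z + h) -> kappa zeta (z + h) - kappa zeta z = d2%:C * h +
  (cintegral mu quadrant (fun p => 1 - expfam snd (thz zeta) (z + h) p) -
   cintegral mu quadrant (fun p => 1 - expfam snd (thz zeta) z p)).
Proof. by move=> h1 h2 h3; rewrite (kappaE h1 h2) (kappaE h1 h3); ring. Qed.

Let kappa_diff1 zeta z h : closed_half_plane zeta -> closed_half_plane z ->
  closed_half_plane (zeta + h) -> kappa (zeta + h) z - kappa zeta z = d1%:C * h +
  (cintegral mu quadrant (fun p => 1 - expfam fst (thzeta z) (zeta + h) p) -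
   cintegral mu quadrant (fun p => 1 - expfam fst (thzeta z) zeta p)).
Proof. by move=> h1 h2 h3; rewrite (kappaE1 h1 h2) (kappaE1 h3 h2); ring. Qed.

Let d2J2 x : 0 < x -> d2 + J2 x / x <= phi x / x.
Proof.
move=> x0; rewrite phiE // ler_pdivlMr // mulrDl divfK ?lt0r_neq0 // lerD2r.
by rewrite lerDr.
Qed.

Let kappa_lip zeta z h x : closed_half_plane zeta -> 0 < x ->
  x <= complex.Re z -> x <= complex.Re (z + h) ->
  cmod (kappa zeta (z + h) - kappa zeta z) <= cmod h * (phi x / x).
Proof.
move=> hz x0 xz xzh.
rewrite kappa_diff //; [|rewrite /closed_half_plane /=; lra..].
apply: le_trans (cmodD _ _) _.
have := @expfam_lip _ _ _ mu quadrant snd (thz zeta) mQ snd_ge0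
  (fun p => @thz_le0 zeta p hz) (fun w => @hIz zeta w hz) hJ2 z h x x0 xz xzh.
move=> H; apply: le_trans (lerD (lexx _) H) _.
rewrite cmodM cmod_real ger0_norm // [d2 * _]mulrC -mulrDr ler_wpM2l ?cmod_ge0 //.
exact: d2J2.
Qed.

Let kappa_taylor zeta z : closed_half_plane zeta -> half_plane z -> exists A,
    cmod A <= phi (complex.Re z) / complex.Re z /\
    forall x h, 0 < x -> x <= complex.Re z -> x <= complex.Re (z + h) ->
    cmod (kappa zeta (z + h) - kappa zeta z - A * h) <= 4 * cmod h ^+ 2 * (phi x / x ^+ 2).
Proof.
move=> hz z0.
have [A [A1 A2]] := @expfam_taylor _ _ _ mu quadrant snd (thz zeta) mQ msnd snd_ge0
  (fun p => @thz_le0 zeta p hz) (fun w => @hIz zeta w hz) hJ2 z z0.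
exists (d2%:C + A); split.
  apply: le_trans (cmodD _ _) _; rewrite cmod_real ger0_norm //.
  by apply: le_trans (d2J2 z0); rewrite lerD2l.
move=> x h x0 xz xzh; rewrite kappa_diff //; [|rewrite /closed_half_plane /=; lra..].
set u := cintegral _ _ _; set v := cintegral _ _ _.
have -> : d2%:C * h + (u - v) - (d2%:C + A) * h = u - v - A * h by ring.
apply: le_trans (A2 x h x0 xz xzh) _.
apply: ler_wpM2l; first by apply: mulr_ge0 => //; exact: sqr_ge0.
by apply: ler_wpM2r; [rewrite invr_ge0 sqr_ge0|exact: phi_J2].
Qed.

Let kappa_holo zeta z : half_plane zeta -> half_plane z -> holo (kappa ^~ z) zeta.
Proof.
move=> hz z0; have cz : closed_half_plane z by apply: ltW.
have [A [_ A2]] := @expfam_taylor _ _ _ mu quadrant fst (thzeta z) mQ mfst fst_ge0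
  (fun p => @thzeta_le0 z p cz) (fun w => @hIzeta z w cz) hJ1 zeta hz.
have r0 : 0 < complex.Re zeta / 2 by rewrite divr_gt0.
exists (d1%:C + A).
apply: (@holo_taylor _ _ _ _ (4 * (J1 (complex.Re zeta / 2) / (complex.Re zeta / 2) ^+ 2))
  (complex.Re zeta / 2)) => // h hr.
have R2 : complex.Re zeta / 2 <= complex.Re (zeta + h).
  have := normRe_le h; rewrite ReD; have := ler_norm (- complex.Re h); rewrite normrN; lra.
rewrite kappa_diff1 //; [|exact: ltW|rewrite /closed_half_plane /=; lra].
set u := cintegral _ _ _; set v := cintegral _ _ _.
have -> : d1%:C * h + (u - v) - (d1%:C + A) * h = u - v - A * h by ring.
apply: le_trans (A2 (complex.Re zeta / 2) h r0 _ R2) _; first by lra.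
by rewrite le_eqVlt; apply/orP; left; apply/eqP; rewrite /J1; ring.
Qed.

Let kappa_cont zeta z (e : R) : closed_half_plane zeta -> half_plane z -> 0 < e ->
    exists2 d : R, 0 < d & forall h, closed_half_plane (zeta + h) -> cmod h < d ->
      cmod (kappa (zeta + h) z - kappa zeta z) <= e.
Proof.
move=> hz z0 e0; have cz : closed_half_plane z by apply: ltW.
have [x x0 xe] := @levy_int_small _ _ _ mu quadrant fst mQ fst_ge0 hJ1 (e / 8) (divr_gt0 e0 (ltr0Sn _ 7)).
have D0 : 0 < 2 * (d1 + 1) by rewrite mulr_gt0 // ltr_wpDl.
exists (Num.min x (e / (2 * (d1 + 1)))); first by rewrite lt_min x0 divr_gt0.
move=> h hzh; rewrite lt_min => /andP[hx]; rewrite ltr_pdivlMr // => hd.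
have [->|h0] := eqVneq h 0; first by rewrite addr0 subrr cmod0 ltW.
rewrite kappa_diff1 //; apply: le_trans (cmodD _ _) _.
have := @expfam_cont _ _ _ mu quadrant fst (thzeta z) mQ fst_ge0
  (fun p => @thzeta_le0 z p cz) (fun w => @hIzeta z w cz) hJ1 zeta h hz hzh h0.
have hp : 0 < cmod h by rewrite cmod_gt0.
have := @levy_int_mono _ _ _ mu quadrant fst mQ fst_ge0 hJ1 (cmod h) x hp (ltW hx).
rewrite cmodM cmod_real ger0_norm //; nra.
Qed.

Let kappa_real q x : 0 <= q -> 0 < x ->
  kappa q%:C x%:C = (complex.Re (kappa q%:C x%:C))%:C.
Proof.
move=> q0 x0; apply: complex_eqP => //=; rewrite kappaE //; last exact: ltW.
rewrite !ImD !ImM Im_k0 /= !(mulr0, mul0r, addr0, add0r).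
rewrite -[RHS](@Rintegral_set0 _ _ _ mu (fun=> 0)) /Rintegral; congr fine.
rewrite integral_set0; apply: integral0_eq => p _.
by rewrite !(mulr0, mul0r, oppr0, addr0, subr0, add0r) sin0 mulr0 oppr0.
Qed.

(** If phi vanishes at one x, then so do kappa(0, 0), d2 and J2 x, all being nonnegative. By
    [levy_int_mul] and monotonicity J2 vanishes everywhere, and |kappa(0, z)| <= 4 J2 |z| forces
    kappa(0, .) = 0. *)
Let phi_pos : (exists2 z, closed_half_plane z & kappa 0 z != 0) ->
  forall x, 0 < x -> 0 < phi x.
Proof.
move=> [z cz kz] x x0.
have phi0 : 0 <= phi x.
  by apply: le_trans (phi_J2 x0); apply: levy_int_ge0; [exact: snd_ge0|exact: ltW].
rewrite lt_def phi0 andbT; apply/eqP => E; move/eqP: kz; apply.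
have J0 : 0 <= J2 x by apply: levy_int_ge0; [exact: snd_ge0|exact: ltW].
have dx : 0 <= d2 * x by rewrite mulr_ge0 // ltW.
have k00 := Re_k0; rewrite phiE // in E.
have k0E : kappa 0 0 = 0 by apply: complex_eqP => //=; lra.
have d20 : d2 = 0.
  have : d2 * x = 0 by lra.
  by move/eqP; rewrite mulf_eq0 (gt_eqF x0) orbF => /eqP.
have J2x : J2 x = 0 by lra.
have [->//|z0] := eqVneq z 0.
have E2 : kappa 0 z = cintegral mu quadrant (fun p => 1 - expfam snd (thz 0) (0 + z) p) -
    cintegral mu quadrant (fun p => 1 - expfam snd (thz 0) 0 p).
  have := @kappa_diff 0 0 z ch0 ch0; rewrite add0r => /(_ cz).
  by rewrite k0E d20 mul0r add0r subr0.
apply/eqP; rewrite -cmod_eq0 eq_le cmod_ge0 andbT.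
have Rz : 0 <= complex.Re (0 + z) by rewrite add0r.
have := @expfam_cont _ _ _ mu quadrant snd (thz 0) mQ snd_ge0
  (fun p => @thz_le0 0 p ch0) (fun w => @hIz 0 w ch0) hJ2 0 z (lexx _) Rz z0.
rewrite -E2 => /le_trans; apply.
pose N := (Num.truncn (cmod z / x)).+1.
have zN : cmod z <= N%:R * x.
  by rewrite -ler_pdivrMr //; apply: ltW; apply: truncnS_gt.
have zp : 0 < cmod z by rewrite cmod_gt0.
have := @levy_int_mono _ _ _ mu quadrant snd mQ snd_ge0 hJ2 (cmod z) _ zp zN.
have := @levy_int_mul _ _ _ mu quadrant snd mQ snd_ge0 hJ2 x N x0 isT.
rewrite -/J2 J2x mulr0 => a b.
by rewrite pmulr_rle0 //; apply: le_trans b a.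
Qed.

Lemma levy_integrable q x : 0 <= q -> 0 < x ->
  mu.-integrable quadrant (fun p => (expR (- (q * p.1)) * (1 - expR (- (x * p.2))))%:E).
Proof.
move=> q0 x0; apply: (le_integrable mQ _ _ (hJ2 x0)).
  apply/measurable_EFinP; apply: measurable_funM; last first.
    by apply/measurable_EFinP; exact: measurable_int (hJ2 x0).
  apply: measurableT_comp => //; apply: measurableT_comp => //.
  exact: measurable_funM.
move=> p Qp; have [p1 p2] := quadrantP Qp; rewrite !abse_EFin lee_fin.
rewrite normrM ler_piMl // ger0_norm ?expR_ge0 // -expR0 ler_expR oppr_le0.
by rewrite mulr_ge0 // ltW.
Qed.

(** For fixed q the function kappa(q, .) is a Bernstein function of x alone, with killing rate
    kappa(q, 0), drift d2 and Levy measure tilted by exp (- q x1). *)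
Lemma levy_form q : 0 <= q -> exists2 c, 0 <= c & forall x, 0 < x ->
  complex.Re (kappa q%:C x%:C) = c + d2 * x +
    \int[mu]_(p in quadrant) (expR (- (q * p.1)) * (1 - expR (- (x * p.2)))).
Proof.
move=> q0; exists (complex.Re (kappa q%:C 0)).
  rewrite (kappaE1 (ch_real q0) ch0) !ReD !ReM /= !(mulr0, mul0r, subr0, addr0).
  rewrite addr_ge0 ?addr_ge0 ?mulr_ge0 //; apply: Rintegral_ge0 => p Qp.
  have [p1 p2] := quadrantP Qp.
  rewrite !(mul0r, oppr0, mulr0, add0r, subr0, addr0) cos0 mulr1 subr_ge0.
  by rewrite -expR0 ler_expR oppr_le0 mulr_ge0 // ltW.
move=> x x0; have cx : closed_half_plane x%:C by apply: ltW.
have c0x : closed_half_plane (0 + x%:C) by rewrite add0r.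
have E := kappa_diff (ch_real q0) ch0 c0x.
have := congr1 (@complex.Re R) E.
rewrite add0r ReB => /eqP; rewrite subr_eq => /eqP ->; rewrite addrC -addrA; congr (_ + _).
set I1 := cintegral _ _ _; set I0 := cintegral _ _ _.
rewrite ReD ReB [complex.Re (_ * _)](_ : _ = d2 * x); last by rewrite ReM /= mulr0 subr0.
congr (_ + _); transitivity (\int[mu]_(p in quadrant) (complex.Re (1 - expfam snd (thz q%:C) x%:C p) -
    complex.Re (1 - expfam snd (thz q%:C) 0 p))).
  rewrite RintegralB //; first by have [] := hIz (ch_real q0) cx.
  by have [] := hIz (ch_real q0) ch0.
apply: eq_Rintegral => p _ /=.
rewrite !(mul0r, oppr0, mulr0, add0r, subr0, addr0) cos0 !mulr1 expRD !mulNr; ring.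
Qed.

Let real_mono q x x' : 0 <= q -> 0 < x -> x <= x' ->
    complex.Re (kappa q%:C x%:C) <= complex.Re (kappa q%:C x'%:C).
Proof.
move=> q0 x0 xx'; have x'0 := lt_le_trans x0 xx'.
have [c _ H] := levy_form q0; rewrite !H //; apply: lerD; first by rewrite lerD2l ler_wpM2l.
apply: le_Rintegral => //; try exact: levy_integrable.
move=> p Qp; have [p1 p2] := quadrantP Qp.
by rewrite ler_wpM2l ?expR_ge0 // lerD2l lerN2 ler_expR lerN2 ler_wpM2r // ltW.
Qed.

Lemma kappa_facts_of_levy : (exists2 z, closed_half_plane z & kappa 0 z != 0) ->
  kappa_facts kappa (fun x => complex.Re (kappa 0 x%:C)).
Proof.
move=> h; split.
- exact: phi_pos.
- exact: phi_mono.
- exact: Re_kappa.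
- exact: kappa_lip.
- exact: kappa_taylor.
- exact: kappa_holo.
- exact: kappa_cont.
- exact: kappa_real.
- exact: real_mono.
Qed.

End KappaFacts.

Lemma bernstein_kappa_facts {R : realType} (kappa : R[i] -> R[i] -> R[i]) :
  bivariate_bernstein kappa -> (exists2 z, closed_half_plane z & kappa 0 z != 0) ->
  kappa_facts kappa (fun x => complex.Re (kappa 0 x%:C)).
Proof.
by move=> [d1 [d2 [mu [k0 d10 d20 _ Hk]]]]; apply: (kappa_facts_of_levy k0 d10 d20 Hk).
Qed.

(** * The Weierstrass product *)

Section ClosedHalfPlaneContinuity.
Context {R : realType}.
Implicit Types (f g : R[i] -> R[i]) (zeta h : R[i]).

Definition hcts f := forall zeta, closed_half_plane zeta -> forall e : R, 0 < e ->
  exists2 d : R, 0 < d & forall h, closed_half_plane (zeta + h) -> cmod h < d ->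
    cmod (f (zeta + h) - f zeta) <= e.

Lemma hcts_cvg f : hcts f <-> forall zeta, closed_half_plane zeta ->
  (f : R[i]^o -> R[i]^o) @ within closed_half_plane (nbhs (zeta : R[i]^o)) --> (f zeta : R[i]^o).
Proof.
split=> [H zeta hz|H zeta hz e e0].
  apply/cvgrPdist_le => e' /complex_gt0P[e e0 ->].
  have [d d0 Hd] := H _ hz _ e0.
  rewrite near_withinE; apply/nbhs_ballP; exists (d%:C); first by rewrite /= ltcR.
  move=> w; rewrite /ball /= normE ltcR => hw cw.
  rewrite distrC normE lecR -[w](subrKC zeta); apply: Hd; first by rewrite subrKC.
  by rewrite cmodBC.
have /cvgrPdist_le : _ := H _ hz => /(_ e%:C); rewrite ltcR => /(_ e0).
rewrite near_withinE => /nbhs_ballP[d' /= /complex_gt0P[d d0 ->] Hd].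
exists d => // h hzh hd; have := Hd (zeta + h); rewrite /ball /= distrC normE ltcR.
by rewrite addrC addKr => /(_ hd hzh); rewrite distrC normE lecR addrC.
Qed.

Lemma hcts_within f : hcts f ->
  {within (closed_half_plane : set R[i]^o), continuous (f : R[i]^o -> R[i]^o)}.
Proof. by move=> /hcts_cvg H; apply/subspace_continuousP => zeta hz; apply: H. Qed.

Lemma within_hcts f :
  {within (closed_half_plane : set R[i]^o), continuous (f : R[i]^o -> R[i]^o)} -> hcts f.
Proof. by move=> /subspace_continuousP H; apply/hcts_cvg => zeta hz; apply: H. Qed.

Lemma hctsD f g : hcts f -> hcts g -> hcts (fun w => f w + g w).
Proof.
move=> /hcts_cvg hf /hcts_cvg hg; apply/hcts_cvg => zeta hz.
exact: (cvgD (hf _ hz) (hg _ hz)).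
Qed.

Lemma hctsM f g : hcts f -> hcts g -> hcts (fun w => f w * g w).
Proof.
move=> /hcts_cvg hf /hcts_cvg hg; apply/hcts_cvg => zeta hz.
exact: (cvgM (hf _ hz) (hg _ hz)).
Qed.

Lemma hcts_cst c : hcts (fun=> c).
Proof. by move=> zeta _ e e0; exists 1 => // h _ _; rewrite subrr cmod0 ltW. Qed.

Lemma hctsN f : hcts f -> hcts (fun w => - f w).
Proof.
by move=> hf zeta hz e e0; have [d d0 Hd] := hf _ hz _ e0; exists d => // h ch hd;
  rewrite -opprD cmodN Hd.
Qed.

Lemma hctsB f g : hcts f -> hcts g -> hcts (fun w => f w - g w).
Proof. by move=> hf hg; apply: hctsD => //; apply: hctsN. Qed.

Lemma hcts_holo (u : R[i] -> R[i]) f :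
  (forall zeta, closed_half_plane zeta -> holo u (f zeta)) -> hcts f ->
  hcts (fun w => u (f w)).
Proof.
move=> hu hf zeta hz e e0; have [d1 d10 H1] := holo_cont (hu _ hz) e0.
have [d d0 Hd] := hf _ hz _ (divr_gt0 d10 (ltr0Sn R 1)); exists d => // h ch hd.
rewrite -[f (zeta + h)](subrKC (f zeta)); apply: H1.
by apply: le_lt_trans (Hd _ ch hd) _; rewrite ltr_pdivrMr // ltr_pMr // ltr1n.
Qed.

Lemma hcts_sum (I : Type) (r : seq I) (F : I -> R[i] -> R[i]) :
  (forall i, hcts (F i)) -> hcts (fun w => \sum_(i <- r) F i w).
Proof.
move=> H; elim: r => [|i r IH].
  have -> : (fun w => \sum_(i <- [::]) F i w) = fun=> 0.
    by apply/funext => w; rewrite big_nil.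
  exact: hcts_cst.
have -> : (fun w => \sum_(i <- i :: r) F i w) = fun w => F i w + \sum_(i <- r) F i w.
  by apply/funext => w; rewrite big_cons.
exact: hctsD.
Qed.

Lemma hcts_unif_limit (F : nat -> R[i] -> R[i]) f :
  (forall n, hcts (F n)) ->
  (forall e : R, 0 < e -> exists n, forall zeta, closed_half_plane zeta ->
     cmod (F n zeta - f zeta) <= e) -> hcts f.
Proof.
move=> hF H zeta hz e e0; have e30 : 0 < e / 3 by rewrite divr_gt0.
have [n Hn] := H _ e30; have [d d0 Hd] := hF n _ hz _ e30.
exists d => // h ch hd.
have -> : f (zeta + h) - f zeta = (F n (zeta + h) - F n zeta) -
  (F n (zeta + h) - f (zeta + h)) + (F n zeta - f zeta) by ring.
have := Hd _ ch hd; have := Hn _ hz; have := Hn _ ch.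
have := cmodB (F n (zeta + h) - F n zeta) (F n (zeta + h) - f (zeta + h)).
have := cmodD (F n (zeta + h) - F n zeta - (F n (zeta + h) - f (zeta + h)))
  (F n zeta - f zeta).
lra.
Qed.

End ClosedHalfPlaneContinuity.

(** * Convergence of gamma and of the two products *)

Section GammaProduct.
Context {R : realType}.
Variables (kappa : R[i] -> R[i] -> R[i]) (phi : R -> R).
Hypothesis K : kappa_facts kappa phi.
Implicit Types (zeta z h w : R[i]) (x q : R) (n k : nat).

Let L zeta z := log0 (kappa zeta z).
Let a zeta k := dkappa kappa zeta k%:R / kappa zeta k%:R.

Lemma Re_natr n : complex.Re (n%:R : R[i]) = n%:R.
Proof. by rewrite -(rmorph_nat (real_complex R)). Qed.

Lemma half_natr n : (0 < n)%N -> half_plane (n%:R : R[i]).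
Proof. by move=> n0; rewrite /half_plane /= Re_natr ltr0n. Qed.

Lemma half_natrD n z : half_plane z -> half_plane (n%:R + z).
Proof. by move=> z0; rewrite /half_plane /= ReD Re_natr ltr_wpDl. Qed.

Lemma half_closed z : half_plane z -> closed_half_plane z.
Proof. exact: ltW. Qed.

Lemma Re_kappa_gt0 zeta z : closed_half_plane zeta -> half_plane z ->
  0 < complex.Re (kappa zeta z).
Proof. by move=> hz z0; apply: lt_le_trans (kf_pos K z0) (kf_Re K hz z0). Qed.

Lemma kappa_neq0 zeta z : closed_half_plane zeta -> half_plane z -> kappa zeta z != 0.
Proof. by move=> hz z0; apply: half_plane_neq0; apply: Re_kappa_gt0. Qed.

Lemma cexp_log_kappa zeta z : closed_half_plane zeta -> half_plane z ->
  cexp (L zeta z) = kappa zeta z.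
Proof. by move=> hz z0; apply: log0K; apply: Re_kappa_gt0. Qed.

Lemma kappa_cderiv zeta z : closed_half_plane zeta -> half_plane z ->
  is_cderiv (kappa zeta) z (dkappa kappa zeta z) /\
  cmod (dkappa kappa zeta z) <= phi (complex.Re z) / complex.Re z /\
  forall x h, 0 < x -> x <= complex.Re z -> x <= complex.Re (z + h) ->
    cmod (kappa zeta (z + h) - kappa zeta z - dkappa kappa zeta z * h) <=
      4 * cmod h ^+ 2 * (phi x / x ^+ 2).
Proof.
move=> hz z0; have [A [A1 A2]] := kf_taylor K hz z0.
have r0 : 0 < complex.Re z / 2 by rewrite divr_gt0.
have HA : is_cderiv (kappa zeta) z A.
  apply: (@holo_taylor _ _ _ _ (4 * (phi (complex.Re z / 2) / (complex.Re z / 2) ^+ 2))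
    (complex.Re z / 2)) => // h hr.
  have R2 : complex.Re z / 2 <= complex.Re (z + h).
    have := normRe_le h; rewrite ReD; have := ler_norm (- complex.Re h); rewrite normrN; lra.
  apply: le_trans (A2 _ h r0 _ R2) _; first by lra.
  by rewrite le_eqVlt; apply/orP; left; apply/eqP; ring.
have -> : dkappa kappa zeta z = A.
  by rewrite /dkappa derive1E; have /is_cderivP[_ ] := HA.
by [].
Qed.

Lemma kappa_holo_z zeta z : closed_half_plane zeta -> half_plane z -> holo (kappa zeta) z.
Proof. by move=> hz z0; have [H _] := kappa_cderiv hz z0; eexists; exact: H. Qed.

(** With m = phi x, the remainder of the logarithm costs (|h| / x)^2, because the increment of kappa
    is at most m |h| / x, and the remainder of kappa costs 4 (|h| / x)^2. The value phi x cancels,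
    so the bound depends neither on zeta nor on kappa. *)
Lemma log_kappa_taylor zeta z x h : closed_half_plane zeta -> 0 < x ->
  x <= complex.Re z -> x <= complex.Re (z + h) ->
  cmod (L zeta (z + h) - L zeta z - dkappa kappa zeta z / kappa zeta z * h) <=
    5 * (cmod h / x) ^+ 2.
Proof.
move=> hz x0 xz xzh.
have z0 : half_plane z by apply: lt_le_trans xz.
have zh0 : half_plane (z + h) by apply: lt_le_trans xzh.
have m0 := kf_pos K x0; set m := phi x in m0.
have mz : m <= complex.Re (kappa zeta z).
  by apply: le_trans (kf_Re K hz z0); apply: (kf_mono K).
have mzh : m <= complex.Re (kappa zeta (z + h)).
  by apply: le_trans (kf_Re K hz zh0); apply: (kf_mono K).
have H1 := log0_taylor m0 mz mzh.
have H2 := kf_lip K hz x0 xz xzh.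
have [_ [_ H3]] := kappa_cderiv hz z0; have {}H3 := H3 x h x0 xz xzh.
have k0 := kappa_neq0 hz z0.
set A := dkappa kappa zeta z in H3 *; rewrite /L.
set k1 := kappa zeta z in mz H1 H2 H3 k0 *; set k2 := kappa zeta (z + h) in mzh H1 H2 H3 *.
have -> : log0 k2 - log0 k1 - A / k1 * h =
  (log0 k2 - log0 k1 - (k2 - k1) / k1) + (k2 - k1 - A * h) / k1 by field.
apply: le_trans (cmodD _ _) _.
have -> : 5 * (cmod h / x) ^+ 2 = (cmod h / x) ^+ 2 + 4 * (cmod h / x) ^+ 2 by ring.
apply: lerD.
  apply: le_trans H1 _; rewrite lerXn2r ?nnegrE ?divr_ge0 ?cmod_ge0 ?(ltW m0) ?(ltW x0) //.
  rewrite ler_pdivrMr //; apply: le_trans H2 _.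
  by rewrite le_eqVlt; apply/orP; left; apply/eqP; rewrite -/m; ring.
rewrite cmodM cmodV ler_pdivrMr; last by rewrite cmod_gt0.
apply: le_trans H3 _; rewrite -/m.
have -> : 4 * cmod h ^+ 2 * (m / x ^+ 2) = 4 * (cmod h / x) ^+ 2 * m.
  by field; rewrite lt0r_neq0.
apply: ler_wpM2l; last exact: le_trans mz (Re_le _).
by apply: mulr_ge0 => //; exact: sqr_ge0.
Qed.

Let inv_diff n : (0 < n)%N -> (n.+1%:R ^+ 2)^-1 <= n%:R^-1 - n.+1%:R^-1 :> R.
Proof.
move=> n0; have p0 : (0 : R) < n%:R by rewrite ltr0n.
have -> : n%:R^-1 - n.+1%:R^-1 = (n%:R * n.+1%:R)^-1 :> R.
  by rewrite -natr1; field; rewrite !lt0r_neq0 // addr_gt0.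
by rewrite lef_pV2 ?posrE ?exprn_gt0 ?mulr_gt0 // expr2 ler_wpM2r // ler_nat.
Qed.

(** Written as the Taylor remainder of log kappa at n + 1 for the step h = - 1. *)
Lemma gamma_seqS zeta n : (0 < n)%N -> gamma_seq kappa zeta n.+1 - gamma_seq kappa zeta n =
  L zeta n%:R - L zeta n.+1%:R - a zeta n.+1 * (- 1).
Proof.
move=> n0; pose g m : R[i] := \sum_(1 <= k < m.+1) a zeta k - L zeta m%:R.
rewrite -[LHS]/(g n.+1 - g n) /g [in LHS]big_nat_recr //=.
move: (\sum_(1 <= k < n.+1) a zeta k) (a zeta n.+1) (L zeta n.+1%:R) (L zeta n%:R).
by move=> s u v w; ring.
Qed.

(** The Taylor bound 5 / n^2 is at most 10 / (n (n + 1)) because n + 1 <= 2 n. *)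
Lemma gamma_increment zeta n : closed_half_plane zeta -> (0 < n)%N ->
  cmod (gamma_seq kappa zeta n.+1 - gamma_seq kappa zeta n) <=
  10 * (n%:R^-1 - n.+1%:R^-1).
Proof.
move=> hz n0; rewrite gamma_seqS //.
have p0 : (0 : R) < n%:R by rewrite ltr0n.
have x1 : n%:R <= complex.Re (n.+1%:R : R[i]) by rewrite Re_natr ler_nat.
have E : (n.+1%:R : R[i]) + -1 = n%:R by rewrite -natr1 addrK.
have x2 : n%:R <= complex.Re (n.+1%:R + -1 : R[i]) by rewrite E Re_natr.
have := log_kappa_taylor hz p0 x1 x2; rewrite E cmodN cmod1 => /le_trans; apply.
have -> : n%:R^-1 - n.+1%:R^-1 = (n%:R * n.+1%:R)^-1 :> R.
  by rewrite -natr1; field; rewrite !lt0r_neq0 // addr_gt0.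
rewrite div1r exprVn -ler_pdivlMl // mulrA.
have -> : (5^-1 * 10 : R) = 2 by field.
rewrite -[leRHS]invrK lef_pV2 ?posrE ?exprn_gt0 ?invr_gt0 ?mulr_gt0 ?invr_gt0 ?mulr_gt0 //.
rewrite invfM invrK expr2 mulrC ler_pdivrMr // -[leRHS]mulrA ler_wpM2l ?(ltW p0) //.
have n1 : (1 : R) <= n%:R by rewrite ler1n.
by rewrite -natr1; lra.
Qed.

Lemma gamma_cvg zeta : closed_half_plane zeta ->
  ccvg (gamma_seq kappa zeta) (gamma_kappa kappa zeta) /\
  forall n, (0 < n)%N -> cmod (gamma_kappa kappa zeta - gamma_seq kappa zeta n) <= 10 / n%:R.
Proof.
move=> hz; have [|l [Hl1 Hl2]] := @telescope_ccvg _ (gamma_seq kappa zeta) 10 (ler0n _ _).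
  by move=> n; apply: gamma_increment.
have -> : gamma_kappa kappa zeta = l by apply: ccvg_limn.
by [].
Qed.

(** A sum of principal logarithms of the separate values of kappa, all of positive real part: [cexp]
    recovers the partial product and no branch has to be followed along it. *)
Definition weier_log_seq zeta z n :=
  \sum_(1 <= k < n.+1) (L zeta k%:R - L zeta (k%:R + z) + a zeta k * z).

Lemma weier_term_le zeta z k : closed_half_plane zeta -> half_plane z -> (0 < k)%N ->
  cmod (L zeta k%:R - L zeta (k%:R + z) + a zeta k * z) <= 5 * cmod z ^+ 2 / k%:R ^+ 2.
Proof.
move=> hz z0 k0; have p0 : (0 : R) < k%:R by rewrite ltr0n.
have x1 : k%:R <= complex.Re (k%:R : R[i]) by rewrite Re_natr.
have x2 : k%:R <= complex.Re (k%:R + z) by rewrite ReD Re_natr lerDl ltW.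
have := log_kappa_taylor hz p0 x1 x2; rewrite -/(a zeta k) expr_div_n mulrA.
rewrite -[cmod (L zeta k%:R - _ + _)]cmodN; congr (cmod _ <= _); rewrite /L; ring.
Qed.

(** The term k = 1 and the sum of all later terms are each at most 5 |z|^2, which gives the uniform
    bound 10 |z|^2. *)
Lemma weier_log_cvg zeta z : closed_half_plane zeta -> half_plane z ->
  exists l, [/\ ccvg (weier_log_seq zeta z) l,
    forall n, (0 < n)%N -> cmod (l - weier_log_seq zeta z n) <= 5 * cmod z ^+ 2 / n%:R,
    forall n, cmod (weier_log_seq zeta z n) <= 10 * cmod z ^+ 2 &
    cmod l <= 10 * cmod z ^+ 2].
Proof.
move=> hz z0; have B0 : 0 <= 5 * cmod z ^+ 2 by apply: mulr_ge0 => //; exact: sqr_ge0.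
have inc k : (0 < k)%N -> cmod (weier_log_seq zeta z k.+1 - weier_log_seq zeta z k) <=
    5 * cmod z ^+ 2 * (k%:R^-1 - k.+1%:R^-1).
  move=> k0; rewrite {1}/weier_log_seq big_nat_recr //= -/(weier_log_seq zeta z k).
  rewrite addrAC subrr add0r.
  apply: le_trans (weier_term_le hz z0 (ltn0Sn k)) _.
  by rewrite ler_wpM2l // inv_diff.
have [l [H1 H2]] := telescope_ccvg B0 inc.
have one : cmod (weier_log_seq zeta z 1) <= 5 * cmod z ^+ 2.
  rewrite /weier_log_seq big_nat1; apply: le_trans (weier_term_le hz z0 (ltn0Sn 0)) _.
  by rewrite expr1n divr1.
have bd n : cmod (weier_log_seq zeta z n) <= 10 * cmod z ^+ 2.
  case: n => [|n].
    by rewrite /weier_log_seq big_nil cmod0; apply: mulr_ge0 => //; exact: sqr_ge0.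
  have := telescope_bound B0 inc (ltn0Sn 0) (ltn0Sn n); rewrite divr1.
  have := cmodD (weier_log_seq zeta z 1) (weier_log_seq zeta z n.+1 - weier_log_seq zeta z 1).
  rewrite addrC subrK; lra.
exists l; split => //; exact: ccvg_cmod_le H1 bd.
Qed.

Definition weier_log zeta z := limn (weier_log_seq zeta z : nat -> R[i]^o).

Lemma weier_logP zeta z : closed_half_plane zeta -> half_plane z ->
  [/\ ccvg (weier_log_seq zeta z) (weier_log zeta z),
    forall n, (0 < n)%N -> cmod (weier_log zeta z - weier_log_seq zeta z n) <=
      5 * cmod z ^+ 2 / n%:R &
    cmod (weier_log zeta z) <= 10 * cmod z ^+ 2].
Proof.
move=> hz z0; have [l [H1 H2 _ H3]] := weier_log_cvg hz z0.
by rewrite /weier_log (ccvg_limn H1).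
Qed.

Lemma weierstrass_seqE zeta z n : closed_half_plane zeta -> half_plane z ->
  weierstrass_seq kappa zeta z n = cexp (weier_log_seq zeta z n).
Proof.
move=> hz z0; rewrite /weierstrass_seq /weier_log_seq cexp_sum.
apply: eq_big_nat => k /andP[k1 _].
by rewrite cexpD cexpB !cexp_log_kappa //; [apply: half_natrD|apply: half_natr].
Qed.

Lemma weierstrass_cvg zeta z : closed_half_plane zeta -> half_plane z ->
  ccvg (weierstrass_seq kappa zeta z) (cexp (weier_log zeta z)).
Proof.
move=> hz z0; have [H _ _] := weier_logP hz z0.
have E : weierstrass_seq kappa zeta z = fun n => cexp (weier_log_seq zeta z n).
  by apply/funext => n; apply: weierstrass_seqE.
rewrite E; apply: ccvg_holo H.
by exists (cexp (weier_log zeta z)); apply: is_cderiv_cexp.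
Qed.

Lemma weierstrassE zeta z : closed_half_plane zeta -> half_plane z ->
  weierstrass kappa zeta z =
  cexp (- gamma_kappa kappa zeta * z) / kappa zeta z * cexp (weier_log zeta z).
Proof. by move=> hz z0; rewrite /weierstrass (ccvg_limn (weierstrass_cvg hz z0)). Qed.

(** The convergence factors of the Weierstrass product multiply to exp (z times the sum in
    [gamma_seq]); removing them leaves exp (z log0 kappa(zeta, n)). *)
Lemma gauss_seqE zeta z n : closed_half_plane zeta -> half_plane z ->
  gauss_seq kappa zeta z n =
  cexp (- gamma_seq kappa zeta n * z) * weierstrass_seq kappa zeta z n.
Proof.
move=> hz z0; rewrite weierstrass_seqE // -cexpD /gauss_seq.
have -> : \prod_(1 <= k < n.+1) (kappa zeta k%:R / kappa zeta (k%:R + z)) =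
    cexp (\sum_(1 <= k < n.+1) (L zeta k%:R - L zeta (k%:R + z))).
  rewrite cexp_sum; apply: eq_big_nat => k /andP[k1 _].
  by rewrite cexpB !cexp_log_kappa //; [apply: half_natrD|apply: half_natr].
rewrite -cexpD; congr cexp; rewrite /weier_log_seq [in RHS]big_split /= -mulr_suml.
pose s : R[i] := \sum_(1 <= k < n.+1) a zeta k.
rewrite -[gamma_seq kappa zeta n]/(s - L zeta n%:R) -/s.
by rewrite /L; move: s; set t := \sum_(_ <= _ < _) _ => s; ring.
Qed.

Lemma gauss_cvg zeta z : closed_half_plane zeta -> half_plane z ->
  ccvg (gauss_seq kappa zeta z)
    (cexp (- gamma_kappa kappa zeta * z) * cexp (weier_log zeta z)).
Proof.
move=> hz z0.
have E : gauss_seq kappa zeta z =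
    fun n => cexp (- gamma_seq kappa zeta n * z) * weierstrass_seq kappa zeta z n.
  by apply/funext => n; apply: gauss_seqE.
rewrite E; apply: ccvgM; last exact: weierstrass_cvg.
apply: (@ccvg_holo _ cexp); first by eexists; apply: is_cderiv_cexp.
apply: ccvgM; last exact: ccvg_cst.
by apply: ccvgN; have [] := gamma_cvg hz.
Qed.

Lemma weierstrass_gauss zeta z : closed_half_plane zeta -> half_plane z ->
  ccvg (fun n => gauss_seq kappa zeta z n / kappa zeta z) (weierstrass kappa zeta z).
Proof.
move=> hz z0; rewrite weierstrassE // mulrAC.
by apply: ccvgM; [apply: gauss_cvg|apply: ccvg_cst].
Qed.

(** By the Lipschitz bound, kappa(zeta, n + h) - kappa(zeta, n) is at most |h| phi(n) / n, and
    phi(n) <= |kappa(zeta, n)|. *)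
Lemma kappa_ratio_cvg zeta h : closed_half_plane zeta -> 0 <= complex.Re h ->
  ccvg (fun n => kappa zeta n%:R / kappa zeta (n%:R + h)) 1.
Proof.
move=> hz h0.
have H : ccvg (fun n => kappa zeta (n%:R + h) / kappa zeta n%:R) 1.
  move=> e e0; have D0 : 0 < cmod h + 1 by rewrite ltr_wpDl ?cmod_ge0.
  have [N [N0 HN]] := inv_lt_eps (divr_gt0 e0 D0).
  exists N => n nN; have n0 : (0 < n)%N by apply: leq_trans nN.
  have p0 : (0 : R) < n%:R by rewrite ltr0n.
  have kn := kappa_neq0 hz (half_natr n0).
  have -> : kappa zeta (n%:R + h) / kappa zeta n%:R - 1 =
     (kappa zeta (n%:R + h) - kappa zeta n%:R) / kappa zeta n%:R by field.
  have x1 : n%:R <= complex.Re (n%:R : R[i]) by rewrite Re_natr.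
  have x2 : n%:R <= complex.Re (n%:R + h) by rewrite ReD Re_natr lerDl.
  rewrite cmodM cmodV ler_pdivrMr ?cmod_gt0 //.
  apply: le_trans (kf_lip K hz p0 x1 x2) _; rewrite mulrCA mulrC.
  have phin : phi n%:R <= cmod (kappa zeta n%:R).
    apply: le_trans (Re_le _); have := kf_Re K hz (half_natr n0).
    by rewrite Re_natr.
  apply: ler_pM => //; first by rewrite mulr_ge0 ?cmod_ge0 // invr_ge0 ltW.
    exact: ltW (kf_pos K p0).
  have := HN _ nN; rewrite ler_pdivlMr // => H.
  have : 0 <= n%:R^-1 :> R by rewrite invr_ge0.
  have := cmod_ge0 h; nra.
have := @ccvg_holo _ (fun w => w^-1) _ _ _ H; rewrite invr1.
have hV : holo (fun w : R[i] => w^-1) 1.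
  by eexists; apply: is_cderivV; apply: oner_neq0.
move=> /(_ hV) {}H; apply: eq_ccvg H => n n0; rewrite invf_div //.
Qed.

Lemma prod_kappa_shift zeta z n : closed_half_plane zeta -> half_plane z ->
  \prod_(1 <= k < n.+1) (kappa zeta k%:R / kappa zeta (k%:R + (z + 1))) / kappa zeta (z + 1) =
  \prod_(1 <= k < n.+1) (kappa zeta k%:R / kappa zeta (k%:R + z)) / kappa zeta (n.+1%:R + z).
Proof.
move=> hz z0; elim: n => [|n IH]; first by rewrite !big_nil addrC.
rewrite !(big_nat_recr n.+1) //= mulrAC IH.
have -> : n.+1%:R + (z + 1) = n.+2%:R + z by rewrite -[n.+2%:R]natr1; ring.
ring.
Qed.

(** The product telescopes under z -> z + 1. What remains besides kappa(zeta, z) is a ratio of two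
    values of kappa that tends to 1 by [kappa_ratio_cvg]. *)
Lemma gauss_shift zeta z n : closed_half_plane zeta -> half_plane z -> (0 < n)%N ->
  gauss_seq kappa zeta (z + 1) n / kappa zeta (z + 1) =
  kappa zeta z * (gauss_seq kappa zeta z n / kappa zeta z) *
    (kappa zeta n%:R / kappa zeta (n%:R + (z + 1))).
Proof.
move=> hz z0 n0; rewrite /gauss_seq -[LHS]mulrA prod_kappa_shift //.
rewrite mulrDl mul1r cexpD -/(L _ _) cexp_log_kappa //; last exact: half_natr.
have -> : n%:R + (z + 1) = n.+1%:R + z by rewrite -natr1; ring.
by field; rewrite !kappa_neq0 //; apply: half_natrD.
Qed.

Lemma half_plane1 z : half_plane z -> half_plane (z + 1).
Proof. by move=> z0; rewrite /half_plane /= ReD /= addr_gt0. Qed.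

Lemma weierstrass_rec zeta z : closed_half_plane zeta -> half_plane z ->
  weierstrass kappa zeta (z + 1) = kappa zeta z * weierstrass kappa zeta z.
Proof.
move=> hz z0; apply: (ccvg_unique (weierstrass_gauss hz (half_plane1 z0))).
have z10 : 0 <= complex.Re (z + 1) by apply/ltW/half_plane1.
apply: (@eq_ccvg _ (fun n => kappa zeta z * (gauss_seq kappa zeta z n / kappa zeta z) *
    (kappa zeta n%:R / kappa zeta (n%:R + (z + 1))))).
  by move=> n n0; rewrite gauss_shift.
rewrite -[X in ccvg _ X]mulr1; apply: ccvgM; last exact: kappa_ratio_cvg.
by apply: ccvgZ; apply: weierstrass_gauss.
Qed.

Lemma weierstrass1 zeta : closed_half_plane zeta -> weierstrass kappa zeta 1 = 1.
Proof.
move=> hz; have h1 : half_plane (1 : R[i]) by rewrite /half_plane /= ltr01.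
apply: (ccvg_unique (weierstrass_gauss hz h1)).
apply: (@eq_ccvg _ (fun n => kappa zeta n%:R / kappa zeta (n%:R + 1))); last first.
  by apply: kappa_ratio_cvg => //=; exact: ler01.
move=> n n0; rewrite /gauss_seq mul1r -/(L _ _) cexp_log_kappa //; last exact: half_natr.
have H m : \prod_(1 <= k < m.+1) (kappa zeta k%:R / kappa zeta (k%:R + 1)) =
    kappa zeta 1 / kappa zeta (m%:R + 1).
  elim: m => [|m IH]; first by rewrite big_nil add0r divff // kappa_neq0.
  rewrite big_nat_recr //= IH; have -> : m%:R + 1 = m.+1%:R :> R[i] by rewrite natr1.
  by field; rewrite !kappa_neq0 //; [apply: half_natr|apply: half_plane1; apply: half_natr].
by rewrite H; field; rewrite !kappa_neq0 //; apply: half_plane1; apply: half_natr.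
Qed.

End GammaProduct.

(** * Regularity of gamma and of the product in each variable and jointly *)

Section GammaRegularity.
Context {R : realType}.
Variables (kappa : R[i] -> R[i] -> R[i]) (phi : R -> R).
Hypothesis K : kappa_facts kappa phi.
Implicit Types (zeta z h w : R[i]) (x q : R) (n k : nat).

Lemma cmod_natr n : cmod (n%:R : R[i]) = n%:R.
Proof. by rewrite -(rmorph_nat (real_complex R)) cmod_real ger0_norm. Qed.

Let half_square zeta (r : R) w : r <= complex.Re zeta / 2 -> half_plane zeta ->
  square zeta r w -> half_plane w /\ complex.Re zeta / 2 <= complex.Re w.
Proof.
move=> rz hz [h1 _]; rewrite /half_plane /=; move: hz; rewrite /half_plane /= => hz.
by move: h1; rewrite ler_norml => /andP[]; split; lra.
Qed.

Let pos_half zeta : half_plane zeta -> 0 < complex.Re zeta / 2.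
Proof. by move=> hz; rewrite divr_gt0. Qed.

Lemma log_kappa_holo zeta z : half_plane zeta -> half_plane z ->
  holo (fun w => log0 (kappa w z)) zeta.
Proof.
move=> hz z0; apply: holo_log0; last exact: kf_holo K _ _ hz z0.
exact: Re_kappa_gt0 K _ _ (half_closed hz) z0.
Qed.

Lemma log_kappa_holo_z zeta z : closed_half_plane zeta -> half_plane z ->
  holo (fun w => log0 (kappa zeta w)) z.
Proof.
move=> hz z0; apply: holo_log0; last exact: kappa_holo_z K _ _ hz z0.
exact: Re_kappa_gt0 K _ _ hz z0.
Qed.

Lemma log_kappa_hcts z : half_plane z -> hcts (fun w => log0 (kappa w z)).
Proof.
move=> z0; apply: hcts_holo.
  move=> zeta hz; exists (kappa zeta z)^-1; apply: is_cderiv_log0.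
  exact: Re_kappa_gt0 K _ _ hz z0.
by move=> zeta hz e e0; apply: kf_cont K _ _ _ hz z0 e0.
Qed.

(** Difference quotients in z with step 1 / (m + 1). They inherit the regularity of kappa in zeta
    and converge to [dkappa] uniformly in zeta, which transfers this regularity to the
    derivative. *)
Let dq k m zeta := m.+1%:R * (kappa zeta (k%:R + m.+1%:R^-1) - kappa zeta k%:R).

Let half_dq k m : (0 < k)%N -> half_plane (k%:R + m.+1%:R^-1 : R[i]) /\
  k%:R <= complex.Re (k%:R + m.+1%:R^-1 : R[i]).
Proof.
move=> k0; have E : (m.+1%:R^-1 : R[i]) = (m.+1%:R^-1)%:C.
  by rewrite (fmorphV (real_complex R)) rmorph_nat.
have : k%:R <= complex.Re (k%:R + m.+1%:R^-1 : R[i]).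
  by rewrite ReD Re_natr lerDl E /= invr_ge0.
move=> H; split => //; apply: lt_le_trans H; by rewrite ltr0n.
Qed.

Let cmod_inv m : cmod (m.+1%:R^-1 : R[i]) = m.+1%:R^-1.
Proof. by rewrite cmodV cmod_natr. Qed.

Let dq_err k m zeta : closed_half_plane zeta -> (0 < k)%N ->
  cmod (dq k m zeta - dkappa kappa zeta k%:R) <= 4 * phi k%:R / m.+1%:R.
Proof.
move=> hz k0; have p0 : (0 : R) < k%:R by rewrite ltr0n.
have [hdq hk] := half_dq m k0.
have [_ [_ H]] := kappa_cderiv K hz (half_natr k0).
have x1 : k%:R <= complex.Re (k%:R : R[i]) by rewrite Re_natr.
have {}H := H _ _ p0 x1 hk.
have m0 : m.+1%:R != 0 :> R[i] by rewrite pnatr_eq0.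
have -> : dq k m zeta - dkappa kappa zeta k%:R = m.+1%:R *
  (kappa zeta (k%:R + m.+1%:R^-1) - kappa zeta k%:R - dkappa kappa zeta k%:R * m.+1%:R^-1).
  by rewrite /dq; field.
rewrite cmodM cmod_natr.
apply: le_trans (ler_wpM2l _ H) _ => //; rewrite cmod_inv.
have k1 : 1 <= k%:R ^+ 2 :> R by rewrite -natrX ler1n expn_gt0 k0.
have pk : phi k%:R / k%:R ^+ 2 <= phi k%:R.
  by rewrite ler_piMr ?(ltW (kf_pos K p0)) // invf_le1 // exprn_gt0.
have -> : 4 * phi k%:R / m.+1%:R = m.+1%:R * (4 * m.+1%:R^-1 ^+ 2 * phi k%:R) :> R.
  by field.
do 2 (rewrite ler_wpM2l //); by rewrite mulr_ge0 // sqr_ge0.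
Qed.

Let dq_bound k m zeta : closed_half_plane zeta -> (0 < k)%N ->
  cmod (dq k m zeta) <= phi k%:R / k%:R.
Proof.
move=> hz k0; have p0 : (0 : R) < k%:R by rewrite ltr0n.
have [hdq hk] := half_dq m k0.
have x1 : k%:R <= complex.Re (k%:R : R[i]) by rewrite Re_natr.
have := kf_lip K hz p0 x1 hk; rewrite cmod_inv => H.
rewrite /dq cmodM cmod_natr.
by rewrite -ler_pdivlMl ?ltr0n.
Qed.

Let dq_small k (e : R) : (0 < k)%N -> 0 < e ->
  exists N, forall m, (N <= m)%N -> 4 * phi k%:R / m.+1%:R <= e.
Proof.
move=> k0 e0; have p0 : (0 : R) < 4 * phi k%:R.
  by rewrite mulr_gt0 // (kf_pos K) // ltr0n.
have [N [N0 HN]] := inv_lt_eps (divr_gt0 e0 p0).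
by exists N => m Nm; rewrite mulrC -ler_pdivlMr // HN // leqW.
Qed.

Lemma dkappa_holo k zeta : (0 < k)%N -> half_plane zeta ->
  holo (fun w => dkappa kappa w k%:R) zeta.
Proof.
move=> k0 hz; apply: (@holo_bounded_limit _ (dq k) _ _ (complex.Re zeta / 2)
  (phi k%:R / k%:R) (pos_half hz)).
- move=> m w /(half_square (lexx _) hz)[hw _]; have [hdq _] := half_dq m k0.
  apply: holoM; first exact: holo_cst.
  by apply: holoB; apply: (kf_holo K) => //; apply: half_natr.
- by move=> m w /(half_square (lexx _) hz)[/half_closed hw _]; apply: dq_bound.
move=> w /(half_square (lexx _) hz)[/half_closed hw _] e e0.
have [N HN] := dq_small k0 e0; exists N => m /HN; apply: le_trans; exact: dq_err.
Qed.

Lemma dkappa_hcts k : (0 < k)%N -> hcts (fun w => dkappa kappa w k%:R).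
Proof.
move=> k0; apply: (@hcts_unif_limit _ (dq k)).
  move=> m; have [hdq _] := half_dq m k0.
  apply: hctsM; first exact: hcts_cst.
  apply: hctsB => zeta hz e e0; first exact: kf_cont K _ _ _ hz hdq e0.
  exact: kf_cont K _ _ _ hz (half_natr k0) e0.
move=> e e0; have [N HN] := dq_small k0 e0; exists N => zeta hz.
by apply: le_trans (HN _ (leqnn N)); apply: dq_err.
Qed.

(** The index is shifted by one so that every k refers to a positive integer, as [holo_sum] and
    [hcts_sum] quantify over all indices. *)
Let a zeta k := dkappa kappa zeta k.+1%:R / kappa zeta k.+1%:R.

Let a_holo k zeta : half_plane zeta -> holo (a ^~ k) zeta.
Proof.
move=> hz; apply: holoM; first exact: dkappa_holo.
apply: holoV; first exact: kappa_neq0 K _ _ (half_closed hz) (half_natr (ltn0Sn k)).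
by apply: (kf_holo K) => //; apply: half_natr.
Qed.

Let a_hcts k : hcts (a ^~ k).
Proof.
apply: hctsM; first exact: dkappa_hcts.
apply: (@hcts_holo _ (fun w => w^-1)).
  move=> zeta hz; eexists; apply: is_cderivV.
  exact: kappa_neq0 K _ _ hz (half_natr (ltn0Sn k)).
by move=> zeta hz e e0; apply: kf_cont K _ _ _ hz (half_natr (ltn0Sn k)) e0.
Qed.

Let sum_shift (F : nat -> R[i]) n :
  \sum_(1 <= k < n.+1) F k = \sum_(k <- index_iota 0 n) F k.+1.
Proof. by rewrite big_add1. Qed.

Let gamma_seqE n : gamma_seq kappa ^~ n =
  fun zeta => \sum_(k <- index_iota 0 n) a zeta k - log0 (kappa zeta n%:R).
Proof. by apply/funext => zeta; rewrite /gamma_seq sum_shift. Qed.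

Lemma gamma_seq_holo n zeta : (0 < n)%N -> half_plane zeta ->
  holo (gamma_seq kappa ^~ n : R[i] -> R[i]) zeta.
Proof.
move=> n0 hz; rewrite gamma_seqE; apply: holoB.
  by apply: holo_sum => k; apply: a_holo.
by apply: log_kappa_holo => //; apply: half_natr.
Qed.

Lemma gamma_seq_hcts n : (0 < n)%N -> hcts (gamma_seq kappa ^~ n : R[i] -> R[i]).
Proof.
move=> n0; rewrite gamma_seqE; apply: hctsB.
  by apply: hcts_sum => k; apply: a_hcts.
by apply: log_kappa_hcts; apply: half_natr.
Qed.

Lemma gamma_hcts : hcts (gamma_kappa kappa).
Proof.
apply: (@hcts_unif_limit _ (fun n => gamma_seq kappa ^~ n.+1)).
  by move=> n; apply: gamma_seq_hcts.
move=> e e0; have e10 : 0 < e / 10 by rewrite divr_gt0.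
have [N [N0 HN]] := inv_lt_eps e10; exists N => zeta hz.
have [_ /(_ N.+1 isT)] := gamma_cvg K hz; rewrite cmodBC => /le_trans; apply.
by rewrite -ler_pdivlMl // mulrC HN.
Qed.

Lemma gamma_holo zeta : half_plane zeta -> holo (gamma_kappa kappa) zeta.
Proof.
move=> hz; have r0 := pos_half hz.
(* The differences with the first term are bounded by 10 on the whole half-plane, which supplies the
   uniform bound for [holo_bounded_limit]; the first term is holomorphic by itself. *)
have H : holo (fun w => gamma_kappa kappa w - gamma_seq kappa w 1) zeta.
  apply: (@holo_bounded_limit _ (fun n w => gamma_seq kappa w n.+1 - gamma_seq kappa w 1)
    _ _ (complex.Re zeta / 2) 10 r0).
  - move=> n w /(half_square (lexx _) hz)[hw _]; apply: holoB; exact: gamma_seq_holo.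
  - move=> n w /(half_square (lexx _) hz)[/half_closed hw _].
    have := @telescope_bound _ (gamma_seq kappa w) 10 (ler0n _ _)
      (fun k => gamma_increment K (n := k) hw) 1 n.+1 isT isT.
    by rewrite divr1.
  move=> w /(half_square (lexx _) hz)[/half_closed hw _].
  by apply: ccvgB; [apply: ccvg_shift; have [] := gamma_cvg K hw|apply: ccvg_cst].
have -> : gamma_kappa kappa = fun w =>
    (gamma_kappa kappa w - gamma_seq kappa w 1) + gamma_seq kappa w 1.
  by apply/funext => w; rewrite subrK.
by apply: holoD => //; apply: gamma_seq_holo.
Qed.

Lemma gamma_classA : classA (gamma_kappa kappa).
Proof.
split; last exact: hcts_within gamma_hcts.
by move=> zeta hz; apply/holoP; apply: gamma_holo.
Qed.

Let weier_log_seqE z n : weier_log_seq kappa ^~ z ^~ n = fun zeta =>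
  \sum_(k <- index_iota 0 n) (log0 (kappa zeta k.+1%:R) -
     log0 (kappa zeta (k.+1%:R + z)) + a zeta k * z).
Proof. by apply/funext => zeta; rewrite /weier_log_seq sum_shift. Qed.

Let weier_log_seq_holo z n zeta : half_plane z -> half_plane zeta ->
  holo (weier_log_seq kappa ^~ z ^~ n) zeta.
Proof.
move=> z0 hz; rewrite weier_log_seqE; apply: holo_sum => k.
apply: holoD; last by apply: holoM; [apply: a_holo|apply: holo_cst].
by apply: holoB; apply: log_kappa_holo => //; [apply: half_natr|apply: half_natrD].
Qed.

Let weier_log_seq_hcts z n : half_plane z -> hcts (weier_log_seq kappa ^~ z ^~ n).
Proof.
move=> z0; rewrite weier_log_seqE; apply: hcts_sum => k.
apply: hctsD; last by apply: hctsM; [apply: a_hcts|apply: hcts_cst].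
by apply: hctsB; apply: log_kappa_hcts => //; [apply: half_natr|apply: half_natrD].
Qed.

Let weier_log_seq_holo_z zeta n z : closed_half_plane zeta -> half_plane z ->
  holo (fun z => weier_log_seq kappa zeta z n) z.
Proof.
move=> hz z0.
have -> : (fun z => weier_log_seq kappa zeta z n) = fun z =>
  \sum_(k <- index_iota 0 n) (log0 (kappa zeta k.+1%:R) -
     log0 (kappa zeta (k.+1%:R + z)) + a zeta k * z).
  by apply/funext => w; rewrite /weier_log_seq sum_shift.
apply: holo_sum => k.
apply: holoD; last by apply: holoM; [apply: holo_cst|apply: holo_id].
apply: holoB; first exact: holo_cst.
apply: (@holo_comp _ (fun w => log0 (kappa zeta w)) (fun w => k.+1%:R + w)).
  by apply: log_kappa_holo_z => //; apply: half_natrD.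
by apply: holoD; [apply: holo_cst|apply: holo_id].
Qed.

Lemma weier_log_hcts z : half_plane z -> hcts (weier_log kappa ^~ z).
Proof.
move=> z0; apply: (@hcts_unif_limit _ (fun n zeta => weier_log_seq kappa zeta z n)).
  by move=> n; apply: weier_log_seq_hcts.
move=> e e0; have D0 : 0 < 5 * cmod z ^+ 2.
  by rewrite mulr_gt0 // exprn_gt0 // cmod_gt0 half_plane_neq0.
have [N [N0 HN]] := inv_lt_eps (divr_gt0 e0 D0); exists N => zeta hz.
have [_ /(_ N N0) H _] := weier_logP K hz z0.
rewrite cmodBC; apply: le_trans H _.
by rewrite mulrC -ler_pdivlMr // HN.
Qed.

Lemma weier_log_holo z zeta : half_plane z -> half_plane zeta ->
  holo (weier_log kappa ^~ z) zeta.
Proof.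
move=> z0 hz.
apply: (@holo_bounded_limit _ (fun n w => weier_log_seq kappa w z n)
    _ _ (complex.Re zeta / 2) (10 * cmod z ^+ 2) (pos_half hz)).
- by move=> n w /(half_square (lexx _) hz)[hw _]; apply: weier_log_seq_holo.
- move=> n w /(half_square (lexx _) hz)[/half_closed hw _].
  by have [l [_ _ H _]] := weier_log_cvg K hw z0; apply: H.
move=> w /(half_square (lexx _) hz)[/half_closed hw _].
by have [] := weier_logP K hw z0.
Qed.

Lemma weier_log_holo_z zeta z : closed_half_plane zeta -> half_plane z ->
  holo (weier_log kappa zeta) z.
Proof.
move=> hz z0; have r0 := pos_half z0.
have wz w : square z (complex.Re z / 2) w -> cmod w <= 2 * cmod z.
  move=> /square_cmod; have := cmodD z (w - z); rewrite addrC subrK.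
  have := Re_le z; lra.
apply: (@holo_bounded_limit _ (fun n w => weier_log_seq kappa zeta w n)
    _ _ (complex.Re z / 2) (10 * (2 * cmod z) ^+ 2) r0).
- by move=> n w /(half_square (lexx _) z0)[hw _]; apply: weier_log_seq_holo_z.
- move=> n w sw; have [hw _] := half_square (lexx _) z0 sw.
  have [l [_ _ H _]] := weier_log_cvg K hz hw; apply: le_trans (H n) _.
  by rewrite ler_wpM2l // lerXn2r ?nnegrE ?cmod_ge0 ?mulr_ge0 ?cmod_ge0 //; apply: wz.
move=> w /(half_square (lexx _) z0)[hw _].
by have [] := weier_logP K hz hw.
Qed.

Lemma weierstrass_hcts z : half_plane z -> hcts (weierstrass kappa ^~ z).
Proof.
move=> z0.
have H : hcts (fun zeta => cexp (- gamma_kappa kappa zeta * z) / kappa zeta z *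
    cexp (weier_log kappa zeta z)).
  have he (u : R[i] -> R[i]) : hcts u -> hcts (fun w => cexp (u w)).
    by apply: hcts_holo => w _; eexists; apply: is_cderiv_cexp.
  apply: hctsM; last by apply: he; apply: weier_log_hcts.
  apply: hctsM.
    apply: he; apply: hctsM; last exact: hcts_cst.
    by apply: hctsN; apply: gamma_hcts.
  apply: (@hcts_holo _ (fun w => w^-1)).
    by move=> zeta hz; eexists; apply: is_cderivV; apply: kappa_neq0 K _ _ hz z0.
  by move=> zeta hz e e0; apply: kf_cont K _ _ _ hz z0 e0.
move=> zeta hz e e0; have [d d0 Hd] := H _ hz _ e0; exists d => // h ch hd.
by rewrite (weierstrassE K hz z0) (weierstrassE K ch z0) Hd.
Qed.

Let holo_half f g zeta : half_plane zeta -> (forall w, half_plane w -> f w = g w) ->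
  holo f zeta -> holo g zeta.
Proof.
move=> hz fg; apply: (near_holo (pos_half hz)) => h hh; apply: fg.
have := normRe_le h; rewrite /half_plane /= ReD.
have := ler_norm (- complex.Re h); rewrite normrN; have := pos_half hz; lra.
Qed.

Lemma weierstrass_holo zeta z : half_plane zeta -> half_plane z ->
  holo (weierstrass kappa ^~ z) zeta.
Proof.
move=> hz z0; apply: (@holo_half (fun w => cexp (- gamma_kappa kappa w * z) / kappa w z *
    cexp (weier_log kappa w z))) => //.
  by move=> w /half_closed hw; rewrite (weierstrassE K hw z0).
apply: holoM; last by apply: holo_cexp; apply: weier_log_holo.
apply: holoM.
  apply: holo_cexp; apply: holoM; last exact: holo_cst.
  by apply: holoN; apply: gamma_holo.
apply: holoV; first exact: kappa_neq0 K _ _ (half_closed hz) z0.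
exact: kf_holo K _ _ hz z0.
Qed.

Lemma weierstrass_holo_z zeta z : closed_half_plane zeta -> half_plane z ->
  holo (weierstrass kappa zeta) z.
Proof.
move=> hz z0; apply: (@holo_half (fun w => cexp (- gamma_kappa kappa zeta * w) / kappa zeta w *
    cexp (weier_log kappa zeta w))) => //.
  by move=> w hw; rewrite (weierstrassE K hz hw).
apply: holoM; last by apply: holo_cexp; apply: weier_log_holo_z.
apply: holoM.
  by apply: holo_cexp; apply: holoM; [apply: holo_cst|apply: holo_id].
apply: holoV; first exact: kappa_neq0 K _ _ hz z0.
exact: kappa_holo_z K _ _ hz z0.
Qed.

(** Since phi is nondecreasing and gamma is locally bounded, this is the local bound needed to pass
    from separate to joint holomorphy. *)
Lemma weierstrass_bound zeta z : closed_half_plane zeta -> half_plane z ->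
  cmod (weierstrass kappa zeta z) <=
  expR (cmod (gamma_kappa kappa zeta) * cmod z + 10 * cmod z ^+ 2) / phi (complex.Re z).
Proof.
move=> hz z0; rewrite (weierstrassE K hz z0) mulrAC cmodM -cexpD cmod_cexp cmodV.
have p0 := kf_pos K z0.
have pk : phi (complex.Re z) <= cmod (kappa zeta z).
  by apply: le_trans (kf_Re K hz z0) (Re_le _).
apply: ler_pM; rewrite ?expR_ge0 ?invr_ge0 ?cmod_ge0 //.
  rewrite ler_expR; apply: le_trans (Re_le _) _; apply: le_trans (cmodD _ _) _.
  by rewrite mulNr cmodN cmodM lerD2l; have [] := weier_logP K hz z0.
by rewrite lef_pV2 ?posrE //; apply: lt_le_trans pk.
Qed.

Lemma weierstrass_differentiable zeta z : half_plane zeta -> half_plane z ->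
  differentiable ((fun p => weierstrass kappa p.1 p.2) : R[i]^o * R[i]^o -> R[i]^o)
    ((zeta, z) : R[i]^o * R[i]^o).
Proof.
move=> hz z0; have [d d0 Hd] := holo_cont (gamma_holo hz) (@ltr01 R).
(* On the square |w - zeta| <= 2 r < d, so gamma stays within 1 of its value at zeta; the other two
   constraints keep both squares in the half-plane. *)
pose r := Num.min (d / 4) (Num.min (complex.Re zeta / 2) (complex.Re z / 2)).
have r0 : 0 < r by rewrite !lt_min (pos_half hz) (pos_half z0) divr_gt0.
have [rd rzeta rz] : [/\ r <= d / 4, r <= complex.Re zeta / 2 & r <= complex.Re z / 2].
  by rewrite /r; split; rewrite !ge_min ?lexx ?orbT.
clearbody r.
pose G := cmod (gamma_kappa kappa zeta) + 1.
apply: (@differentiable_osgood _ (weierstrass kappa) zeta z r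
  (expR (G * (2 * cmod z) + 10 * (2 * cmod z) ^+ 2) / phi (complex.Re z / 2))) => //.
move=> w v sw sv; have [hw _] := half_square rzeta hz sw.
have [hv hv2] := half_square rz z0 sv.
split; first exact: weierstrass_holo.
  exact: weierstrass_holo_z (half_closed hw) hv.
apply: le_trans (weierstrass_bound (half_closed hw) hv) _.
have vz : cmod v <= 2 * cmod z.
  have := square_cmod sv; have := cmodD z (v - z); rewrite addrC subrK.
  by have := Re_le z; lra.
have gw : cmod (gamma_kappa kappa w) <= G.
  have := Hd (w - zeta); rewrite [zeta + _]addrC subrK => H.
  have : cmod (w - zeta) < d by have := square_cmod sw; lra.
  move=> /H; have := cmodD (gamma_kappa kappa w - gamma_kappa kappa zeta) (gamma_kappa kappa zeta).
  by rewrite subrK /G; lra.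
have p1 : 0 < phi (complex.Re z / 2) by apply: (kf_pos K); apply: pos_half.
have p2 : phi (complex.Re z / 2) <= phi (complex.Re v).
  by apply: (kf_mono K) => //; apply: pos_half.
apply: ler_pM; rewrite ?expR_ge0 ?invr_ge0 //; first exact: le_trans (ltW p1) p2.
  rewrite ler_expR; apply: lerD; first by apply: ler_pM; rewrite ?cmod_ge0.
  by rewrite ler_wpM2l // lerXn2r ?nnegrE ?cmod_ge0 ?mulr_ge0 ?cmod_ge0.
by rewrite lef_pV2 ?posrE //; apply: lt_le_trans p2.
Qed.

End GammaRegularity.

(** * Uniqueness *)

Section MellinTransform.
Context {d : measure_display} {T : measurableType d} {R : realType}.
Variables (P : probability T R) (Y : {RV P >-> R}).

Implicit Types (z h w : R[i]) (x s b : R).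

Let l t := ln (Y t).
Let M z := cintegral P setT (fun t => rcpow (Y t) (z - 1)).
Hypothesis hM : forall z, half_plane z -> cintegrable P setT (fun t => rcpow (Y t) (z - 1)).

Let rcpowE z t : rcpow (Y t) z = cexp (z * (l t)%:C).
Proof. by []. Qed.

Let cmod_rcpow z t : cmod (rcpow (Y t) (z - 1)) = expR ((complex.Re z - 1) * l t).
Proof. by rewrite rcpowE cmod_cexp ReM ReB /= mulr0 subr0. Qed.

Lemma rcpow_real x t : rcpow (Y t) (x%:C - 1) = (expR ((x - 1) * l t))%:C.
Proof.
rewrite rcpowE -cexp_real; congr cexp; apply: complex_eqP => /=; ring.
Qed.

Lemma mellin_integrable x : 0 < x ->
  P.-integrable setT (fun t => (expR ((x - 1) * l t))%:E).
Proof.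
move=> x0; have [h _] := @hM x%:C x0.
by apply: (eq_integrable measurableT _ _ _ h) => t _; rewrite rcpow_real.
Qed.

Let integrable_lin (f g : T -> R) (a b : R) : P.-integrable setT (fun t => (f t)%:E) ->
  P.-integrable setT (fun t => (g t)%:E) ->
  P.-integrable setT (fun t => (a * f t + b * g t)%:E).
Proof.
move=> hf hg; apply: (eq_integrable measurableT _ _ _
  (integrableD measurableT (integrableZl measurableT a hf) (integrableZl measurableT b hg))).
by move=> t _; rewrite EFinD !EFinM.
Qed.

Let measurable_l : measurable_fun setT l.
Proof. by apply: measurableT_comp => //; exact: measurable_ln. Qed.

Let exp_abs_le (e u k : R) : 0 < e -> expR (u + e * `|k|) <= expR (u + e * k) + expR (u - e * k).
Proof.
move=> e0; have [k0|k0] := leP 0 k.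
  by rewrite ger0_norm // lerDl expR_ge0.
by rewrite ltr0_norm // mulrN lerDr expR_ge0.
Qed.

Let dom (z : R[i]) (e : R) t := expR ((complex.Re z + 2 * e - 1) * l t) +
  expR ((complex.Re z - 2 * e - 1) * l t).

Let dom_le z (e : R) t : 0 < e ->
  expR ((complex.Re z - 1) * l t + (2 * e) * `|l t|) <= dom z e t.
Proof.
move=> e0; apply: le_trans (exp_abs_le _ _ _) _; first by rewrite mulr_gt0.
by rewrite le_eqVlt; apply/orP; left; apply/eqP; rewrite /dom; congr (expR _ + expR _); ring.
Qed.

Let dom_integrable z (e c : R) : 0 < e -> 2 * e < complex.Re z ->
  P.-integrable setT (fun t => (c * dom z e t)%:E).
Proof.
move=> e0 ez.
have h1 : 0 < complex.Re z + 2 * e by lra.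
have h2 : 0 < complex.Re z - 2 * e by lra.
apply: (eq_integrable measurableT _ _ _ (integrable_lin c c (mellin_integrable h1)
  (mellin_integrable h2))).
by move=> t _; rewrite -mulrDr.
Qed.

Lemma mellin_holo z : half_plane z -> holo M z.
Proof.
(* Powers of |ln Y| are absorbed by exp (e |ln Y|), and exp (2 e |ln Y|) is dominated by the moments
   at Re z + 2 e and Re z - 2 e, both positive for this e. *)
move=> z0; pose e := complex.Re z / 4.
have e0 : 0 < e by rewrite divr_gt0.
have e2 : 2 * e < complex.Re z by move: z0; rewrite /e /half_plane /= => z0; lra.
pose g t := (l t)%:C * rcpow (Y t) (z - 1).
have l1 t : `|l t| <= e^-1 * expR (2 * e * `|l t|).
  rewrite -ler_pdivrMl ?invr_gt0 // invrK.
  apply: le_trans (_ : expR (e * `|l t|) <= _).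
    by apply: le_trans (expR_ge1Dx _); rewrite lerDr.
  by rewrite ler_expR ler_wpM2r // ler_peMl ?(ltW e0) // ler1n.
have l2 t : `|l t| ^+ 2 <= 4 / e ^+ 2 * expR (e * `|l t|).
  have k0 : 0 <= e * `|l t| by rewrite mulr_ge0 // ltW.
  have E2 : expR (e * `|l t|) = expR (e * `|l t| / 2) ^+ 2.
    by rewrite expr2 -expRD -splitr.
  have H : (e * `|l t|) ^+ 2 <= 4 * expR (e * `|l t|).
    by rewrite E2; have := expR_ge1Dx (e * `|l t| / 2); nra.
  have -> : 4 / e ^+ 2 * expR (e * `|l t|) = 4 * expR (e * `|l t|) / e ^+ 2 by ring.
  by rewrite ler_pdivlMr ?exprn_gt0 // mulrC -exprMn.
have [mr mi] : measurable_fun setT (fun t => complex.Re (rcpow (Y t) (z - 1))) /\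
    measurable_fun setT (fun t => complex.Im (rcpow (Y t) (z - 1))).
  have [h1 h2] := hM z0.
  by split; apply/measurable_EFinP; [exact: measurable_int h1|exact: measurable_int h2].
have ig : cintegrable P setT g.
  apply: (@cintegrable_le _ _ _ P setT measurableT g (fun t => e^-1 * dom z e t)).
  - have -> : (fun t => complex.Re (g t)) = (fun t => l t * complex.Re (rcpow (Y t) (z - 1))).
      by apply/funext => t; rewrite /g ReM (_ : complex.Im _%:C = 0) // mul0r subr0.
    exact: measurable_funM.
  - have -> : (fun t => complex.Im (g t)) = (fun t => l t * complex.Im (rcpow (Y t) (z - 1))).
      by apply/funext => t; rewrite /g ImM (_ : complex.Im _%:C = 0) // mul0r addr0.
    exact: measurable_funM.
  - exact: dom_integrable.
  move=> t _; rewrite cmodM cmod_real cmod_rcpow.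
  apply: le_trans (ler_wpM2r (expR_ge0 _) (l1 t)) _.
  rewrite -[leLHS]mulrA -expRD ler_pM2l ?invr_gt0 // addrC; exact: dom_le.
exists (cintegral P setT g).
pose C := \int[P]_t (4 / e ^+ 2 * dom z e t).
apply: (@holo_taylor _ _ _ _ C e e0) => h he.
have zh : half_plane (z + h).
  have := normRe_le h; rewrite /half_plane /= ReD.
  have := ler_norm (- complex.Re h); rewrite normrN; lra.
rewrite mulrC -cintegralZ // /M -cintegralB //; try exact: hM.
rewrite -cintegralB //; last 2 first.
- by apply: cintegrableB => //; apply: hM.
- exact: cintegrableZ.
have -> : C * cmod h ^+ 2 = \int[P]_t ((cmod h ^+ 2 * (4 / e ^+ 2)) * dom z e t).
  rewrite mulrC /C -RintegralZl //; last exact: dom_integrable.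
  by apply: eq_Rintegral => t _; rewrite mulrA.
apply: cmod_cintegral_le => //.
- apply: cintegrableB => //; last exact: cintegrableZ.
  by apply: cintegrableB => //; apply: hM.
- exact: dom_integrable.
move=> t _; set u := (z - 1) * (l t)%:C; set v := h * (l t)%:C.
have -> : rcpow (Y t) (z + h - 1) - rcpow (Y t) (z - 1) - h * g t =
    cexp (u + v) - cexp u - v * cexp u.
  have -> : rcpow (Y t) (z + h - 1) = cexp (u + v).
    by rewrite rcpowE; congr cexp; rewrite /u /v; ring.
  by rewrite /g rcpowE -/u /v; ring.
pose m := (complex.Re z - 1) * l t + e * `|l t|.
have Ru : complex.Re u = (complex.Re z - 1) * l t.
  by rewrite /u ReM ReB /= mulr0 subr0.
have um : complex.Re u <= m by rewrite Ru /m lerDl mulr_ge0 // ltW.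
have uvm : complex.Re (u + v) <= m.
  rewrite ReD Ru /m lerD2l /v ReM /= mulr0 subr0.
  apply: le_trans (ler_norm _) _; rewrite normrM ler_wpM2r //.
  exact: le_trans (normRe_le _) he.
apply: le_trans (cexp_taylor um uvm) _.
rewrite /v cmodM cmod_real exprMn -[leLHS]mulrA -[leRHS]mulrA.
apply: ler_wpM2l; first exact: sqr_ge0.
apply: le_trans (ler_wpM2r (expR_ge0 _) (l2 t)) _.
rewrite -[leLHS]mulrA; apply: ler_wpM2l; first by apply: divr_ge0 => //; exact: sqr_ge0.
rewrite -expRD; apply: le_trans (dom_le _ _ e0).
by rewrite ler_expR /m le_eqVlt; apply/orP; left; apply/eqP; ring.
Qed.

Lemma mellin_realE x : 0 < x ->
  M x%:C = (\int[P]_t (expR ((x - 1) * l t)))%:C.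
Proof.
move=> x0; apply: complex_eqP.
  change (\int[P]_t complex.Re (rcpow (Y t) (x%:C - 1)) = \int[P]_t expR ((x - 1) * l t)).
  by apply: eq_Rintegral => t _; rewrite rcpow_real.
change (\int[P]_t complex.Im (rcpow (Y t) (x%:C - 1)) = 0).
rewrite /Rintegral; transitivity (fine (\int[P]_t (0 : \bar R))%E); last by rewrite integral0.
by congr fine; apply: eq_integral => t _; rewrite rcpow_real.
Qed.

(** Both tangent inequalities at the point s u, evaluated at 0 and at u, are averaged with weights 1
    - s and s. *)
Lemma exp_convex_tangent s (u : R) : 0 <= s <= 1 -> expR (s * u) <= (1 - s) + s * expR u.
Proof.
move=> /andP[s0 s1].
have h1 : expR (s * u) * (1 - s * u) <= 1.
  have := expR_ge1Dx (- (s * u)).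
  have : expR (s * u) * expR (- (s * u)) = 1 by rewrite -expRD subrr expR0.
  have := expR_gt0 (s * u); nra.
have h2 : expR (s * u) * (1 + (u - s * u)) <= expR u.
  have := expR_ge1Dx (u - s * u).
  have : expR (s * u) * expR (u - s * u) = expR u by rewrite -expRD; congr expR; ring.
  have := expR_gt0 (s * u); nra.
have -> : expR (s * u) = (1 - s) * (expR (s * u) * (1 - s * u)) +
  s * (expR (s * u) * (1 + (u - s * u))) by ring.
apply: lerD; last by rewrite ler_wpM2l.
by rewrite -[leRHS]mulr1 ler_wpM2l // subr_ge0.
Qed.

Let v x := \int[P]_t (expR ((x - 1) * l t)).

(** Stands in for Holder's inequality: the convexity of exp at u = ln Y - b is integrated, and b is
    left free for a later choice. *)
Lemma mellin_convex x s b : 0 < x -> 0 <= s <= 1 ->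
  v (x + s) <= (1 - s) * expR (s * b) * v x + s * expR ((s - 1) * b) * v (x + 1).
Proof.
move=> x0 s01; have [s0 s1] := andP s01.
have xs0 : 0 < x + s by rewrite ltr_pwDl.
have x10 : 0 < x + 1 by rewrite ltr_pwDl.
rewrite /v -!RintegralZl //; try exact: mellin_integrable.
rewrite -RintegralD //; last 2 first.
- apply: (eq_integrable measurableT _ _ _ (integrableZl measurableT _ (mellin_integrable x0))).
  by move=> t _ /=; rewrite EFinM.
- apply: (eq_integrable measurableT _ _ _ (integrableZl measurableT _ (mellin_integrable x10))).
  by move=> t _ /=; rewrite EFinM.
apply: le_Rintegral => //; first exact: mellin_integrable.
  exact: integrable_lin (mellin_integrable x0) (mellin_integrable x10).
move=> t _; have := exp_convex_tangent (l t - b) s01 => H.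
have -> : expR ((x + s - 1) * l t) = expR ((x - 1) * l t + s * b) * expR (s * (l t - b)).
  by rewrite -expRD; congr expR; ring.
apply: le_trans (ler_wpM2l (expR_ge0 _) H) _.
have -> : expR ((x + 1 - 1) * l t) = expR ((x - 1) * l t) * expR (l t).
  by rewrite -expRD; congr expR; ring.
have -> : expR ((s - 1) * b) = expR (s * b) * expR (- b) by rewrite -expRD; congr expR; ring.
have -> : expR (l t - b) = expR (l t) * expR (- b) by rewrite -expRD.
by rewrite expRD le_eqVlt; apply/orP; left; apply/eqP; ring.
Qed.

End MellinTransform.

(** * The Bohr-Mollerup argument and uniqueness *)

Section Uniqueness.
Context {R : realType}.
Variables (kappa : R[i] -> R[i] -> R[i]) (phi : R -> R).
Hypothesis K : kappa_facts kappa phi.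
Implicit Types (zeta z : R[i]) (x q s : R) (n k : nat).

(* The last hypothesis is the weighted AM-GM form of log-convexity; its free
   parameter b is optimal at b = ln (f x). *)
Lemma bohr_mollerup (f v : R -> R) (s : R) : 0 < s <= 1 ->
  (forall x, 0 < x -> 0 < f x) ->
  (forall x x', 0 < x -> x <= x' -> f x <= f x') ->
  (forall x, 0 < x -> v (x + 1) = f x * v x) ->
  (forall x, 0 < x -> 0 < v x) ->
  (forall x s b, 0 < x -> 0 <= s <= 1 ->
     v (x + s) <= (1 - s) * expR (s * b) * v x + s * expR ((s - 1) * b) * v (x + 1)) ->
  forall n, (0 < n)%N ->
  expR (s * ln (f n%:R)) * v n.+1%:R <= v (n.+1%:R + s) <=
  expR (s * ln (f n.+1%:R)) * v n.+1%:R.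
Proof.
move=> /andP[s0 s1] f0 fmono vrec v0 vconv n n0.
have BM x r : 0 < x -> 0 <= r <= 1 -> v (x + r) <= expR (r * ln (f x)) * v x.
  move=> x0 r01; apply: le_trans (vconv x r (ln (f x)) x0 r01) _.
  rewrite vrec // (_ : (r - 1) * ln (f x) = r * ln (f x) + - ln (f x)); last by ring.
  rewrite expRD expRN lnK ?posrE ?f0 //.
  by rewrite le_eqVlt; apply/orP; left; apply/eqP; field; rewrite lt0r_neq0 ?f0.
have p0 : (0 : R) < n%:R by rewrite ltr0n.
apply/andP; split; last by apply: BM; rewrite ?ltr0n // ltW.
have ns0 : 0 < n%:R + s by rewrite addr_gt0.
(* For the lower bound the inequality runs from n + s up to n + 1 by the step 1 - s, and the
   recurrence at n + s turns it around. *)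
have := @BM (n%:R + s) (1 - s) ns0; rewrite subr_ge0 s1 lerBlDr lerDl (ltW s0) => /(_ isT).
have -> : n%:R + s + (1 - s) = n.+1%:R by rewrite -natr1; ring.
have -> : n.+1%:R + s = n%:R + s + 1 by rewrite -natr1; ring.
rewrite vrec // (_ : (1 - s) * ln (f (n%:R + s)) = ln (f (n%:R + s)) + - (s * ln (f (n%:R + s)))); last by ring.
rewrite expRD expRN lnK ?posrE ?f0 // => H.
set A := expR (s * ln (f (n%:R + s))) in H.
have A0 : 0 < A := expR_gt0 _.
have : A * v n.+1%:R <= f (n%:R + s) * v (n%:R + s).
  apply: le_trans (ler_wpM2l (ltW A0) H) _.
  by rewrite le_eqVlt; apply/orP; left; apply/eqP; field; rewrite lt0r_neq0.
apply: le_trans; rewrite ler_wpM2r ?(ltW (v0 _ _)) ?ltr0n // ler_expR ler_wpM2l ?(ltW s0) //.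
rewrite ler_ln ?posrE ?f0 //; apply: fmono => //; rewrite lerDl; exact: ltW.
Qed.

Section Fixed_q.
Variables (q : R) (V : R[i] -> R[i]).
Hypothesis q0 : 0 <= q.
Hypothesis Vrec : forall z, half_plane z -> V (z + 1) = kappa q%:C z * V z.
Hypothesis V1 : V 1 = 1.
Hypothesis VM : mellin_of_positive_rv V.

Let f x := complex.Re (kappa q%:C x%:C).
Let v x := complex.Re (V x%:C).

Let chq : closed_half_plane q%:C.
Proof. by []. Qed.

Let f_real x : 0 < x -> kappa q%:C x%:C = (f x)%:C.
Proof. by move=> x0; apply: (kf_real K). Qed.

Let f_gt0 x : 0 < x -> 0 < f x.
Proof. by move=> x0; apply: (Re_kappa_gt0 K) => //; exact: x0. Qed.

Let real_nat n : (n%:R : R[i]) = (n%:R : R)%:C.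
Proof. by rewrite rmorph_nat. Qed.

Lemma mellin_V_holo z : half_plane z -> holo V z.
Proof.
move=> z0; have [d [T [P [Y [Y0 HY]]]]] := VM.
have hM w : half_plane w -> cintegrable P setT (fun t => rcpow (Y t) (w - 1)).
  by move=> /HY[].
have r0 : 0 < complex.Re z / 2 by rewrite divr_gt0.
apply: (near_holo r0 _ (mellin_holo hM z0)) => h hh; symmetry.
have hz : half_plane (z + h).
  have := normRe_le h; rewrite /half_plane /= ReD; move: z0; rewrite /half_plane /=.
  have := ler_norm (- complex.Re h); rewrite normrN; lra.
by have [_ ->] := HY _ hz.
Qed.

Lemma mellin_V_real x : 0 < x <= 1 -> V x%:C = weierstrass kappa q%:C x%:C.
Proof.
move=> x01; have [x0 x1] := andP x01.
have [d [T [P [Y [Y0 HY]]]]] := VM.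
have hM w : half_plane w -> cintegrable P setT (fun t => rcpow (Y t) (w - 1)).
  by move=> /HY[].
have VE y : 0 < y -> V y%:C = (\int[P]_t (expR ((y - 1) * ln (Y t))))%:C.
  by move=> y0; have [_ ->] := HY y%:C y0; apply: mellin_realE.
have vE y : 0 < y -> v y = \int[P]_t (expR ((y - 1) * ln (Y t))).
  by move=> y0; rewrite /v VE.
have VvE y : 0 < y -> V y%:C = (v y)%:C by move=> y0; rewrite vE // VE.
have vrec y : 0 < y -> v (y + 1) = f y * v y.
  move=> y0; rewrite /v rmorphD /= Vrec // f_real // ReM /= mul0r subr0 //.
have v_ge0 y : 0 < y -> 0 <= v y by move=> y0; rewrite vE //; apply: Rintegral_ge0.
have vconv y s b : 0 < y -> 0 <= s <= 1 ->
     v (y + s) <= (1 - s) * expR (s * b) * v y + s * expR ((s - 1) * b) * v (y + 1).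
  move=> y0 s01; have [s0 _] := andP s01.
  have ys0 : 0 < y + s by rewrite ltr_wpDr.
  have y10 : 0 < y + 1 by rewrite addr_gt0.
  rewrite !vE //.
  exact: (mellin_convex hM).
have v1 : v 1 = 1 by rewrite /v V1.
have v_gt0 y : 0 < y -> 0 < v y.
  have vn n : 0 < v n.+1%:R.
    elim: n => [|n IH]; first by rewrite v1.
    by rewrite -natr1 vrec ?ltr0n // mulr_gt0 // f_gt0 // ltr0n.
  move=> y0; rewrite lt_def v_ge0 // andbT; apply/eqP => vy.
  have vyn n : v (y + n%:R) = 0.
    elim: n => [|n IH]; first by rewrite addr0.
    by rewrite -natr1 addrA vrec ?ltr_wpDr // IH mulr0.
  (* N + 1 lies between y and y + 1; if v vanished at y, hence at y + 1, convexity would force v (N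
     + 1) <= 0. *)
  pose N := Num.truncn y.
  have yN : y < N.+1%:R by apply: truncnS_gt.
  have Ny : N%:R <= y by rewrite truncn_le // ltW.
  have s01 : 0 <= N.+1%:R - y <= 1 by rewrite -natr1 in yN *; apply/andP; split; lra.
  have := vconv y (N.+1%:R - y) 0 y0 s01.
  rewrite vy vrec // vy !mulr0 addr0 addrC subrK => H.
  by have := vn N; rewrite ltNge H.
have fmono y y' : 0 < y -> y <= y' -> f y <= f y'.
  move=> y0 yy'; exact: (kf_real_mono K).
have BM := bohr_mollerup x01 f_gt0 fmono vrec v_gt0 vconv.
suff main : ccvg (fun n => gauss_seq kappa q%:C x%:C n / kappa q%:C x%:C) (V x%:C).
  by apply: (ccvg_unique main); apply: (weierstrass_gauss K chq).
have prodv n : \prod_(1 <= k < n.+1) kappa q%:C k%:R = (v n.+1%:R)%:C.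
  elim: n => [|n IH]; first by rewrite big_nil v1.
  rewrite big_nat_recr //= IH -[n.+2%:R]natr1 vrec ?ltr0n // real_nat f_real ?ltr0n //.
  by rewrite -rmorphM mulrC.
have prodvx n : (\prod_(1 <= k < n.+1) kappa q%:C (k%:R + x%:C)) * (f x * v x)%:C =
    (v (n.+1%:R + x))%:C.
  elim: n => [|n IH].
    by rewrite big_nil mul1r [1 + x]addrC vrec.
  have nx0 : 0 < n.+1%:R + x by rewrite addr_gt0.
  rewrite big_nat_recr //= mulrAC IH.
  have -> : n.+2%:R + x = n.+1%:R + x + 1 by rewrite -[n.+2%:R]natr1; ring.
  rewrite vrec // real_nat -rmorphD f_real // -rmorphM mulrC //.
(* The Gauss sequence is V x times [ratio n]. The two Bohr-Mollerup bounds give 1 - 1/n <= ratio n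
   <= 1, because ln f(n + 1) - ln f(n) <= 1/n. *)
pose ratio n := expR (x * ln (f n%:R)) * v n.+1%:R / v (n.+1%:R + x).
apply: (@eq_ccvg _ (fun n => V x%:C * (ratio n)%:C)).
  move=> n n0; have p0 : (0 : R) < n%:R by rewrite ltr0n.
  have nx0 : 0 < n.+1%:R + x by rewrite addr_gt0.
  rewrite /gauss_seq real_nat f_real // log0_real ?f_gt0 // -rmorphM cexp_real.
  rewrite prodf_div prodv f_real // VvE //.
  have := prodvx n; set Q := \prod_(_ <= _ < _) _ => HQ.
  have Q0 : Q != 0.
    apply/eqP => E; move: HQ; rewrite E mul0r => /(congr1 (@complex.Re R)) /= H.
    by have := v_gt0 _ nx0; rewrite -H ltxx.
  have rE : (ratio n)%:C =
      (expR (x * ln (f n%:R)))%:C * (v n.+1%:R)%:C / (Q * ((f x)%:C * (v x)%:C)).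
    rewrite -[(f x)%:C * _](rmorphM (real_complex R)) HQ -[_^-1](fmorphV (real_complex R)).
    by rewrite -!(rmorphM (real_complex R)).
  have fx0 : (f x)%:C != 0 :> R[i] by rewrite (fmorph_eq0 (real_complex R)) lt0r_neq0 ?f_gt0.
  have vx0 : (v x)%:C != 0 :> R[i] by rewrite (fmorph_eq0 (real_complex R)) lt0r_neq0 ?v_gt0.
  by rewrite rE; field; rewrite Q0 fx0 vx0.
rewrite -[X in ccvg _ X]mulr1; apply: ccvgZ => e e0.
have [N [N0 HN]] := inv_lt_eps e0; exists N => n nN.
have n0 : (0 < n)%N by apply: leq_trans nN.
have p0 : (0 : R) < n%:R by rewrite ltr0n.
have nx0 : 0 < n.+1%:R + x by rewrite addr_gt0.
rewrite -(rmorph1 (real_complex R)) -rmorphB cmod_real.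
have [/andP[B1 B2]] : _ := BM n n0.
have D0 := v_gt0 _ nx0.
have r1 : ratio n <= 1 by rewrite /ratio ler_pdivrMr // mul1r.
have r2 : 1 - n%:R^-1 <= ratio n.
  rewrite /ratio ler_pdivlMr //.
  apply: le_trans (_ : (1 - n%:R^-1) * (expR (x * ln (f n.+1%:R)) * v n.+1%:R) <= _).
    rewrite ler_wpM2l // subr_ge0 invf_le1 ?ler1n //.
  rewrite mulrA ler_wpM2r ?v_ge0 ?ltr0n //.
  have fn := f_gt0 p0; have fn1 : 0 < f n.+1%:R by apply: f_gt0; rewrite ltr0n.
  have lip : f n.+1%:R - f n%:R <= f n%:R / n%:R.
    have h1 : n%:R <= complex.Re (n%:R%:C : R[i]) by [].
    have h2 : n%:R <= complex.Re (n%:R%:C + 1 : R[i]) by rewrite ReD /= lerDl.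
    have := kf_lip K chq p0 h1 h2; rewrite cmod1 mul1r => H.
    have E : (n%:R%:C + 1 : R[i]) = (n.+1%:R)%:C by rewrite -natr1 rmorphD.
    rewrite E in H; apply: le_trans (_ : phi n%:R / n%:R <= _); last first.
      rewrite ler_wpM2r ?invr_ge0 ?(ltW p0) //.
      exact: (kf_Re K (z := n%:R%:C) chq p0).
    by apply: le_trans H; rewrite /f -ReB; apply: Re_le.
  have lnle : ln (f n.+1%:R) - ln (f n%:R) <= n%:R^-1.
    rewrite -ln_div ?posrE //; apply: le_trans (_ : f n.+1%:R / f n%:R - 1 <= _).
      have := @le_ln1Dx _ (f n.+1%:R / f n%:R - 1).
      rewrite [1 + _]addrC subrK; apply; have := divr_gt0 fn1 fn; lra.
    have -> : f n.+1%:R / f n%:R - 1 = (f n.+1%:R - f n%:R) / f n%:R.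
      by field; rewrite lt0r_neq0.
    by rewrite ler_pdivrMr // mulrC.
  have -> : expR (x * ln (f n%:R)) = expR (- (x * (ln (f n.+1%:R) - ln (f n%:R)))) *
      expR (x * ln (f n.+1%:R)) by rewrite -expRD; congr expR; ring.
  rewrite ler_wpM2r ?expR_ge0 //; apply: le_trans (expR_ge1Dx _).
  rewrite lerD2l lerN2; apply: le_trans (_ : x * n%:R^-1 <= _).
    by rewrite ler_wpM2l // ltW.
  by rewrite ler_piMl // invr_ge0 ltW.
have := HN _ nN; rewrite ler_norml; lra.
Qed.

Lemma mellin_unique z : half_plane z -> V z = weierstrass kappa q%:C z.
Proof.
move=> z0; apply/eqP; rewrite -subr_eq0; apply/eqP.
apply: (@identity_theorem _ (fun z => V z - weierstrass kappa q%:C z)) => //.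
  move=> w w0; apply: holoB; first exact: mellin_V_holo.
  exact: weierstrass_holo_z K _ _ chq w0.
move=> x x0; apply/eqP; rewrite subr_eq0; apply/eqP.
have H n y : 0 < y -> y <= n.+1%:R -> V y%:C = weierstrass kappa q%:C y%:C.
  elim: n y => [|n IH] y y0 yn; first by apply: mellin_V_real; rewrite y0.
  have [y1|y1] := leP y 1; first by apply: mellin_V_real; rewrite y0.
  have y10 : 0 < y - 1 by rewrite subr_gt0.
  have E : y%:C = (y - 1)%:C + 1 :> R[i] by rewrite rmorphB /= subrK.
  rewrite E Vrec // (weierstrass_rec K chq) // IH //.
  by rewrite lerBlDr natr1.
by apply: (H (Num.truncn x)) => //; apply: ltW; apply: truncnS_gt.
Qed.

End Fixed_q.

Theorem bernstein_gamma_unique (V : R[i] -> R[i] -> R[i]) zeta z :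
  bernstein_gamma kappa V -> closed_half_plane zeta -> half_plane z ->
  0 < complex.Re zeta \/ complex.Im zeta = 0 \/ boundary_continuous V ->
  V zeta z = weierstrass kappa zeta z.
Proof.
move=> [Vrec V1 Vdiff VM] hz z0 hor.
have real q : 0 <= q -> V q%:C z = weierstrass kappa q%:C z.
  move=> q0; apply: (@mellin_unique q (V q%:C)) => //.
  - by move=> w w0; apply: Vrec.
  - exact: V1.
  - exact: VM.
have V_holo w : half_plane w -> holo (V ^~ z) w.
  move=> hw; have := Vdiff w z hw z0 => dV.
  apply/holoP; apply/derivable1_diffP.
  apply: (@differentiable_comp _ _ _ _ (fun w : R[i]^o => (w, z) : R[i]^o * R[i]^o)
    (fun p : R[i]^o * R[i]^o => V p.1 p.2 : R[i]^o)) => //.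
have inner w : half_plane w -> V w z = weierstrass kappa w z.
  move=> hw; apply/eqP; rewrite -subr_eq0; apply/eqP.
  apply: (@identity_theorem _ (fun w => V w z - weierstrass kappa w z)) => //.
    by move=> u hu; apply: holoB; [apply: V_holo|apply: weierstrass_holo K _ _ hu z0].
  by move=> x x0; rewrite real ?subrr // ltW.
case: hor => [hr|[him|hb]]; first exact: inner.
  have -> : zeta = (complex.Re zeta)%:C by apply: complex_eqP.
  exact: real.
have Vc := within_hcts (hb z z0).
have D : hcts (fun w => V w z - weierstrass kappa w z).
  by apply: hctsB => //; apply: weierstrass_hcts K _ z0.
apply/eqP; rewrite -subr_eq0 -cmod_eq0 eq_le cmod_ge0 andbT.
apply/ler_addgt0Pr => e e0; rewrite add0r.
have [d d0 Hd] := D zeta hz e e0.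
have d20 : 0 < d / 2 by rewrite divr_gt0.
have hin : half_plane (zeta + (d / 2)%:C).
  by rewrite /half_plane /= ReD /= ltr_wpDl.
have := Hd (d / 2)%:C (half_closed hin); rewrite cmod_real gtr0_norm // inner // subrr sub0r cmodN.
by apply; rewrite ltr_pdivrMr // ltr_pMr // ltr1n.
Qed.

End Uniqueness.

(** * Approximation by finite exponential sums *)

Section ExpSums.
Context {R : realType}.
Implicit Types (M s f : R -> R) (x c e b : R) (xs : seq R) (l : seq (R * R)) (A : pred R).

Lemma near_seq (xs : seq R) (Q : R -> nat -> Prop) :
  (forall x, x \in xs -> \forall n \near \oo, Q x n) ->
  \forall n \near \oo, forall x, x \in xs -> Q x n.
Proof.
elim: xs => [|y xs IH] H; first by near=> n.
have H1 := H y (mem_head _ _).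
have H2 : \forall n \near \oo, forall x, x \in xs -> Q x n.
  by apply: IH => x xxs; apply: H; rewrite inE xxs orbT.
near=> n => x; rewrite inE => /orP[/eqP ->|]; first by near: n.
by move: x; near: n.
Unshelve. all: by end_near. Qed.

Lemma near_inv_mul c e : 0 < e -> \forall n \near \oo, n.+1%:R^-1 * c <= e.
Proof.
move=> e0; have c1 : 0 < `|c| + 1 by rewrite ltr_wpDl.
have [N [N0 HN]] := inv_lt_eps (divr_gt0 e0 c1).
exists N => // n /= nN; have := HN n.+1 (leqW nN); rewrite ler_pdivlMr // => H.
apply: le_trans H; apply: ler_wpM2l; first by rewrite invr_ge0.
by apply: le_trans (ler_norm _) _; rewrite lerDl.
Qed.

Lemma near_exists (Q : nat -> Prop) : (\forall n \near \oo, Q n) -> exists n, Q n.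
Proof. by move=> [N _ H]; exists N; apply: H => /=. Qed.

Definition expsum l x := \sum_(p <- l) p.1 * expR (p.2 * x).

Definition nneg_weights l := all (fun p => 0 <= p.1) l.

Lemma expsum_ge0 l x : nneg_weights l -> 0 <= expsum l x.
Proof.
move=> /allP h; rewrite /expsum big_seq; apply: sumr_ge0 => p pl.
by rewrite mulr_ge0 ?expR_ge0 // h.
Qed.

Lemma expsum_cat l l' x : expsum (l ++ l') x = expsum l x + expsum l' x.
Proof. exact: big_cat. Qed.

Lemma nneg_weights_cat l l' : nneg_weights l -> nneg_weights l' -> nneg_weights (l ++ l').
Proof. by rewrite /nneg_weights all_cat => -> ->. Qed.

Definition expsum_mul l l' := [seq (p.1 * p'.1, p.2 + p'.2) | p <- l, p' <- l'].

Lemma expsum_mulE l l' x : expsum (expsum_mul l l') x = expsum l x * expsum l' x.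
Proof.
rewrite /expsum /expsum_mul big_allpairs_dep mulr_suml; apply: eq_bigr => p _.
by rewrite mulr_sumr; apply: eq_bigr => p' _ /=; rewrite mulrDl expRD; ring.
Qed.

Lemma nneg_weights_mul l l' : nneg_weights l -> nneg_weights l' ->
  nneg_weights (expsum_mul l l').
Proof.
move=> /allP h /allP h'; apply/allP => _ /allpairsP[[p p'] /= [hp hp' ->]] /=.
by apply: mulr_ge0; [apply: h hp|apply: h' hp'].
Qed.

(* Stands for: M is the Laplace transform of a positive measure on the line. *)
Definition exp_approx A M := forall xs e, all A xs -> 0 < e ->
  exists2 l, nneg_weights l & forall x, x \in xs -> `|expsum l x - M x| <= e.

Lemma exp_approx_exact A M l : nneg_weights l -> (forall x, A x -> M x = expsum l x) ->
  exp_approx A M.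
Proof.
move=> hl h xs e /allP Axs e0; exists l => // x xxs.
by rewrite h ?Axs // subrr normr0 ltW.
Qed.

Lemma exp_approx_cst A c : 0 <= c -> exp_approx A (fun=> c).
Proof.
move=> c0; apply: (exp_approx_exact (l := [:: (c, 0)])); first by rewrite /nneg_weights /= c0.
by move=> x _; rewrite /expsum big_seq1 mul0r expR0 mulr1.
Qed.

Lemma exp_approx_exp A b : exp_approx A (fun x => expR (b * x)).
Proof.
apply: (exp_approx_exact (l := [:: (1, b)])); first by rewrite /nneg_weights /= ler01.
by move=> x _; rewrite /expsum big_seq1 mul1r.
Qed.

Lemma eq_exp_approx A M M' : (forall x, A x -> M x = M' x) -> exp_approx A M -> exp_approx A M'.
Proof.
move=> h H xs e Axs e0; have [l hl Hl] := H xs e Axs e0; exists l => // x xxs.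
by rewrite -h ?Hl //; apply: (allP Axs).
Qed.

Lemma exp_approxD A M M' : exp_approx A M -> exp_approx A M' ->
  exp_approx A (fun x => M x + M' x).
Proof.
move=> H H' xs e Axs e0; have e20 : 0 < e / 2 by rewrite divr_gt0.
have [l hl Hl] := H xs _ Axs e20; have [l' hl' Hl'] := H' xs _ Axs e20.
exists (l ++ l'); first exact: nneg_weights_cat.
move=> x xxs; rewrite expsum_cat opprD addrACA; apply: le_trans (ler_normD _ _) _.
by have := Hl x xxs; have := Hl' x xxs; lra.
Qed.

Lemma exp_approxM A M M' : exp_approx A M -> exp_approx A M' ->
  exp_approx A (fun x => M x * M' x).
Proof.
move=> H H' xs e Axs e0.
have [n Hn] : exists n, forall x, x \in xs -> n.+1%:R^-1 * (1 + `|M x| + `|M' x|) <= e.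
  by apply: near_exists; apply: near_seq => x _; apply: near_inv_mul.
have d0 : (0 : R) < n.+1%:R^-1 by rewrite invr_gt0.
have d1 : n.+1%:R^-1 <= 1 :> R by rewrite invf_le1 ?ler1n.
have [l hl Hl] := H xs _ Axs d0; have [l' hl' Hl'] := H' xs _ Axs d0.
exists (expsum_mul l l'); first exact: nneg_weights_mul.
move=> x xxs; rewrite expsum_mulE; apply: le_trans (Hn x xxs).
move: (Hl x xxs) (Hl' x xxs); set a := expsum l x; set b := expsum l' x => h h'.
have -> : a * b - M x * M' x =
  (a - M x) * (b - M' x) + (M x * (b - M' x) + M' x * (a - M x)) by ring.
set d := _^-1 in h h' d1 *.
have -> : d * (1 + `|M x| + `|M' x|) = d * 1 + (`|M x| * d + `|M' x| * d) by ring.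
apply: le_trans (ler_normD _ _) _; apply: lerD.
  by rewrite normrM; apply: ler_pM => //; apply: le_trans h' d1.
apply: le_trans (ler_normD _ _) _; rewrite !normrM; apply: lerD; exact: ler_wpM2l.
Qed.

Lemma exp_approx_sum A (I : Type) (r : seq I) (F : I -> R -> R) :
  (forall i, exp_approx A (F i)) -> exp_approx A (fun x => \sum_(i <- r) F i x).
Proof.
move=> h; elim: r => [|i r IH].
  by apply: (eq_exp_approx _ (exp_approx_cst (lexx 0))) => x _; rewrite big_nil.
by apply: (eq_exp_approx _ (exp_approxD (h i) IH)) => x _; rewrite big_cons.
Qed.

Lemma exp_approx_prod A (I : Type) (r : seq I) (F : I -> R -> R) :
  (forall i, exp_approx A (F i)) -> exp_approx A (fun x => \prod_(i <- r) F i x).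
Proof.
move=> h; elim: r => [|i r IH].
  by apply: (eq_exp_approx _ (exp_approx_cst ler01)) => x _; rewrite big_nil.
by apply: (eq_exp_approx _ (exp_approxM (h i) IH)) => x _; rewrite big_cons.
Qed.

(** The approximant may depend on the points and on the accuracy. In [exp_approx_inv] it is 1 / g,
    with g known to be positive at the given points only. *)
Lemma exp_approx_near A M : (forall xs e, all A xs -> 0 < e ->
    exists2 M', exp_approx (mem xs) M' & forall x, x \in xs -> `|M' x - M x| <= e) ->
  exp_approx A M.
Proof.
move=> h xs e Axs e0; have e20 : 0 < e / 2 by rewrite divr_gt0.
have [M' H' HM] := h xs _ Axs e20.
have [l hl Hl] := H' xs _ (introT allP (fun x => id)) e20; exists l => // x xxs.
have -> : expsum l x - M x = (expsum l x - M' x) + (M' x - M x) by ring.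
by apply: le_trans (ler_normD _ _) _; have := HM x xxs; have := Hl x xxs; lra.
Qed.

Lemma exp_approx_sub A (B : pred R) M : (forall x, B x -> A x) -> exp_approx A M -> exp_approx B M.
Proof. by move=> h H xs e Bxs; apply: H; apply: sub_all Bxs. Qed.

Lemma exp_approx_lim A (u : nat -> R -> R) M : (\forall n \near \oo, exp_approx A (u n)) ->
  (forall x, A x -> u ^~ x @ \oo --> M x) -> exp_approx A M.
Proof.
move=> hu h; apply: exp_approx_near => xs e /allP Axs e0.
have [n [Hn Un]] : exists n, (forall x, x \in xs -> `|u n x - M x| <= e) /\ exp_approx A (u n).
  apply: near_exists; apply: filterI => //; apply: near_seq => x xxs.
  have /cvgrPdist_le/(_ e e0) := h x (Axs x xxs).
  by apply: filterS => n; rewrite distrC.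
by exists (u n) => //; apply: exp_approx_sub Un.
Qed.

(** Models the Bernstein functions: a constant minus a positive exponential sum is the exponent of a
    compound Poisson process, up to an additive constant. B depends on the points and the accuracy
    and may be arbitrarily large. *)
Definition bern_approx f := forall xs e, all (fun x => 0 < x) xs -> 0 < e ->
  exists B l, nneg_weights l /\ forall x, x \in xs -> `|B - expsum l x - f x| <= e.

Lemma bern_approx_cst c : bern_approx (fun=> c).
Proof.
move=> xs e _ e0; exists c, [::]; split => // x _.
by rewrite /expsum big_nil subr0 subrr normr0 ltW.
Qed.

Lemma bern_approxD f f' : bern_approx f -> bern_approx f' -> bern_approx (fun x => f x + f' x).
Proof.
move=> H H' xs e Axs e0; have e20 : 0 < e / 2 by rewrite divr_gt0.
have [B [l [hl Hl]]] := H xs _ Axs e20; have [B' [l' [hl' Hl']]] := H' xs _ Axs e20.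
exists (B + B'), (l ++ l'); split; first exact: nneg_weights_cat.
move=> x xxs; have -> : B + B' - expsum (l ++ l') x - (f x + f' x) =
  (B - expsum l x - f x) + (B' - expsum l' x - f' x) by rewrite expsum_cat; ring.
by apply: le_trans (ler_normD _ _) _; have := Hl x xxs; have := Hl' x xxs; lra.
Qed.

Lemma bern_approx_lim f (B : nat -> R) (l : nat -> seq (R * R)) :
  (forall n, nneg_weights (l n)) ->
  (forall x, 0 < x -> (fun n => B n - expsum (l n) x) @ \oo --> f x) -> bern_approx f.
Proof.
move=> hl h xs e /allP xs0 e0.
have [n Hn] : exists n, forall x, x \in xs -> `|B n - expsum (l n) x - f x| <= e.
  apply: near_exists; apply: near_seq => x xxs.
  have /cvgrPdist_le/(_ e e0) := h x (xs0 x xxs).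
  by apply: filterS => n; rewrite distrC.
by exists (B n), (l n).
Qed.

(** A drift is the limit of Poisson processes with small frequent jumps: c x is the limit of c m (1
    - exp (- x / m)). *)
Lemma bern_approx_lin c : 0 <= c -> bern_approx (fun x => c * x).
Proof.
move=> c0; apply: (@bern_approx_lim _ (fun n => c * n.+1%:R)
  (fun n => [:: (c * n.+1%:R, - n.+1%:R^-1)])).
  by move=> n; rewrite /nneg_weights /= mulr_ge0.
move=> x x0; apply/cvgrPdist_le => e e0.
have := near_inv_mul (c * x ^+ 2) e0; apply: filterS => n; apply: le_trans.
rewrite /expsum big_seq1 /=; set m : R := n.+1%:R; have m0 : 0 < m by rewrite ltr0n.
pose t := m^-1 * x; have t0 : 0 <= t by apply: mulr_ge0; [rewrite invr_ge0|]; apply: ltW.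
have -> : c * x - (c * m - c * m * expR (- m^-1 * x)) = c * m * (t - (1 - expR (- t))).
  by rewrite mulNr -/t /t; field; rewrite lt0r_neq0.
have h1 := texpN_le t; have h2 := expR_ge1Dx (- t); have h3 := expR_gt0 (- t).
have -> : m^-1 * (c * x ^+ 2) = c * m * t ^+ 2 by rewrite /t; field; rewrite lt0r_neq0.
have cm : 0 <= c * m by rewrite mulr_ge0 // ltW.
rewrite normrM (ger0_norm cm); apply: ler_wpM2l => //.
rewrite ger0_norm; last by lra.
nra.
Qed.

Lemma lower_bound_seq f xs : (forall x, x \in xs -> 0 < f x) ->
  exists2 m, 0 < m & forall x, x \in xs -> m <= f x.
Proof.
move=> h; have [n Hn] : exists n, forall x, x \in xs -> n.+1%:R^-1 * 1 <= f x.
  by apply: near_exists; apply: near_seq => x /h; apply: near_inv_mul.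
by exists n.+1%:R^-1; [rewrite invr_gt0|move=> x /Hn; rewrite mulr1].
Qed.

(** If f is close to B - s with s a positive exponential sum, then f > 0 yields 0 <= s / B < 1. The
    partial sums of the geometric series for 1 / (B - s) are again positive exponential sums, with
    the shift by j absorbed into the weights. *)
Lemma exp_approx_inv f (j : R) : (forall x, 0 < x -> 0 < f x) -> bern_approx f ->
  1 <= j -> exp_approx (fun x => -1 < x) (fun x => (f (j + x))^-1).
Proof.
move=> f0 H j1; apply: exp_approx_near => xs e /allP Axs e0.
have jx x : x \in xs -> 0 < j + x by move=> /Axs /=; lra.
have [m m0 Hm] := @lower_bound_seq (fun x => f (j + x)) xs (fun x hx => f0 _ (jx x hx)).
(* At the given points f >= m and g >= m / 2, so |1/g - 1/f| <= 2 d / m^2 <= e. *)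
pose d := Num.min (m / 2) (e * m ^+ 2 / 2).
have d0 : 0 < d by rewrite lt_min !divr_gt0 // mulr_gt0 // exprn_gt0.
have [B [l [hl Hl]]] : exists B l, nneg_weights l /\
    forall x, x \in xs -> `|B - expsum l (j + x) - f (j + x)| <= d.
  have [|B [l [hl Hl]]] := H [seq j + x | x <- xs] d _ d0.
    by apply/allP => _ /mapP[x hx ->]; apply: jx.
  by exists B, l; split=> // x hx; apply: Hl; apply: map_f.
pose g x := B - expsum l (j + x).
have g0 x : x \in xs -> m / 2 <= g x.
  move=> hx; have := Hl x hx; have := Hm x hx; rewrite -/(g x) ler_norml le_min.
  have : d <= m / 2 by rewrite ge_min lexx.
  move=> a b /andP[c _]; lra.
exists (fun x => (g x)^-1); last first.
  move=> x hx; have fx := Hm x hx; have gx := g0 x hx; have := Hl x hx; rewrite -/(g x) => K.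
  have f1 : 0 < f (j + x) by lra.
  have g1 : 0 < g x by lra.
  have -> : (g x)^-1 - (f (j + x))^-1 = (f (j + x) - g x) / (g x * f (j + x)).
    by field; rewrite !lt0r_neq0.
  have gf : 0 < g x * f (j + x) by rewrite mulr_gt0.
  rewrite normrM normfV (gtr0_norm gf) ler_pdivrMr // distrC; apply: le_trans K _.
  apply: le_trans (_ : e * m ^+ 2 / 2 <= _); first by rewrite ge_min lexx orbT.
  rewrite -mulrA ler_wpM2l ?(ltW e0) //; nra.
pose l' := [seq (p.1 * expR (p.2 * j), p.2) | p <- l].
have hl' : nneg_weights l'.
  by apply/allP => _ /mapP[p pl ->] /=; rewrite mulr_ge0 ?expR_ge0 //; apply: (allP hl).
have l'E x : expsum l' x = expsum l (j + x).
  rewrite /expsum big_map; apply: eq_bigr => p _ /=.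
  by rewrite mulrDr expRD mulrA.
apply: (@exp_approx_lim _ (fun N x => \sum_(k < N) B^-1 * (B^-1 * expsum l' x) ^+ k)).
  have [B0|B0] := ltP 0 B; last first.
    (* B > expsum >= 0 at any point of xs, so xs is empty here. *)
    near=> n => zs z zz z0; exists [::] => // x hx; have := allP zz x hx => /= /g0.
    by have := expsum_ge0 (j + x) hl; rewrite /g; lra.
  near=> n; apply: exp_approx_sum => i; apply: exp_approxM.
    by apply: exp_approx_cst; rewrite invr_ge0 ltW.
  elim: (nat_of_ord i) => [|k IH]; first by apply: exp_approx_cst.
  have B1 : 0 <= B^-1 by rewrite invr_ge0 ltW.
  have h1 := @exp_approxM (mem xs) _ _ (exp_approx_cst B1) (exp_approx_exact hl' (fun x _ => erefl)).
  by apply: (eq_exp_approx _ (exp_approxM h1 IH)) => x _; rewrite exprS.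
move=> x /= hx; have gx := g0 x hx; have s0 := expsum_ge0 (j + x) hl.
have B0 : 0 < B by move: gx; rewrite /g; lra.
pose t := B^-1 * expsum l' x.
have t0 : 0 <= t by rewrite /t l'E mulr_ge0 // invr_ge0 ltW.
have t1 : t < 1 by rewrite /t l'E mulrC ltr_pdivrMr // mul1r; move: gx; rewrite /g; lra.
have -> : (g x)^-1 = B^-1 * (1 - t)^-1.
  rewrite -invfM; congr (_^-1); rewrite /t /g l'E; field; rewrite lt0r_neq0 //.
have := @cvg_geometric_series R B^-1 t; rewrite ger0_norm // => /(_ t1).
by apply: cvg_trans; apply: near_eq_cvg; near=> N; rewrite /series /= big_mkord.
Unshelve. all: by end_near. Qed.

End ExpSums.

Section RintegralSum.
Context {d : measure_display} {T : measurableType d} {R : realType}.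
Variables (mu : {measure set T -> \bar R}) (D : set T).
Hypothesis mD : measurable D.

Lemma integrable_Rsum (I : Type) (r : seq I) (F : I -> T -> R) :
  (forall i, mu.-integrable D (fun p => (F i p)%:E)) ->
  mu.-integrable D (fun p => (\sum_(i <- r) F i p)%:E).
Proof.
move=> h; apply: (eq_integrable mD _ _ _ (integrable_sum mD r (P := xpredT) (fun i _ => h i))).
by move=> p _; rewrite sumEFin.
Qed.

Lemma Rintegral_sum (I : Type) (r : seq I) (F : I -> T -> R) :
  (forall i, mu.-integrable D (fun p => (F i p)%:E)) ->
  \int[mu]_(p in D) (\sum_(i <- r) F i p) = \sum_(i <- r) \int[mu]_(p in D) F i p.
Proof.
move=> h; elim: r => [|i r IH].
  rewrite big_nil /Rintegral (eq_integral (cst 0%E)) ?integral0 // => p _.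
  by rewrite big_nil.
rewrite big_cons -IH -RintegralD //; [|exact: h|exact: integrable_Rsum].
by apply: eq_Rintegral => p _; rewrite big_cons.
Qed.

End RintegralSum.

Section Cells.
Context {R : realType}.
Implicit Types (t : R) (k N : nat) (c : nat -> R).

Definition cell k t : R := \1_(`[k%:R, k.+1%:R[%classic) t.

Lemma cellE k t : 0 <= t -> cell k t = (k == Num.truncn t)%:R.
Proof.
move=> t0; rewrite /cell indicE; congr (nat_of_bool _)%:R.
by rewrite eq_sym truncn_eq //; apply/idP/idP; rewrite inE /= in_itv.
Qed.

Lemma cell_ge0 k t : 0 <= cell k t.
Proof. by rewrite /cell indicE ler0n. Qed.

Lemma measurable_cell k : measurable_fun setT (cell k).
Proof. by apply: measurable_indic; exact: measurable_itv. Qed.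

Lemma sum_cell N c t : 0 <= t ->
  \sum_(k < N) cell k t * c k = (Num.truncn t < N)%:R * c (Num.truncn t).
Proof.
move=> t0; case: ltnP => tN.
  rewrite (bigD1 (Ordinal tN)) //= cellE // eqxx big1 ?addr0 // => i iN.
  rewrite cellE //; case: eqP => [E|]; last by rewrite mul0r.
  by case/eqP: iN; apply: val_inj.
rewrite mul0r big1 // => i _; rewrite cellE //; case: eqP => [E|]; last by rewrite mul0r.
by have := ltn_ord i; rewrite E ltnNge tN.
Qed.

End Cells.

(** * Discretisation of the Levy measure *)

Section LevyApprox.
Context {d : measure_display} {T : measurableType d} {R : realType}.
Variables (mu : {measure set T -> \bar R}) (D : set T).
Variables (y g : T -> R).
Hypothesis mD : measurable D.
Hypothesis my : measurable_fun D y.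
Hypothesis mg : measurable_fun D g.
Hypothesis y_ge0 : forall p, D p -> 0 <= y p.
Hypothesis g_ge0 : forall p, D p -> 0 <= g p.
Hypothesis g_le1 : forall p, D p -> g p <= 1.
Hypothesis hJ : forall x, 0 < x -> mu.-integrable D (fun p => (1 - expR (- (x * y p)))%:E).
Implicit Types (x : R) (p : T) (n k : nat).

(** At mesh 1/m, the mass of g mu in the cell [(k+1)/m, (k+2)/m) is moved to its left end point. The
    cell at 0 is omitted, since its mass may be infinite, and [N n] cells reach beyond y = m. *)
Let m n : R := n.+1%:R.
Let N n := ((n.+1 ^ 2).+1)%N.
Let e n k p : R := g p * cell k.+1 (m n * y p).
Let a n k : R := \int[mu]_(p in D) e n k p.
Let v n k x : R := 1 - expR (- (x * (k.+1%:R / m n))).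

Let m_gt0 n : 0 < m n. Proof. by rewrite /m ltr0n. Qed.

Let e_ge0 n k p : D p -> 0 <= e n k p.
Proof. by move=> Dp; rewrite /e mulr_ge0 ?cell_ge0 // g_ge0. Qed.

Let e_int n k : mu.-integrable D (fun p => (e n k p)%:E).
Proof.
(* On every cell that is kept y >= 1/m, so the indicator is at most (1 - exp (- y)) / (1 - exp (-
   1/m)). *)
have c0 : 0 < 1 - expR (- (m n)^-1) by rewrite subr_gt0 -expR0 ltr_expR oppr_lt0 invr_gt0.
apply: (le_integrable mD _ _ (integrableZl mD (1 - expR (- (m n)^-1))^-1 (hJ ltr01))).
  apply/measurable_EFinP; apply: measurable_funM => //.
  apply: (measurableT_comp (measurable_cell k.+1)).
  exact: measurable_funM.
move=> p Dp; rewrite -EFinM !abse_EFin lee_fin ger0_norm ?e_ge0 //.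
apply: le_trans (ler_norm _); rewrite mul1r.
have Dy := y_ge0 Dp; have my0 : 0 <= m n * y p by rewrite mulr_ge0 // ltW.
rewrite /e cellE //; case: eqP => [E|_]; last first.
  by rewrite mulr0 mulr_ge0 ?invr_ge0 ?(ltW c0) // subr_ge0 -expR0 ler_expR oppr_le0.
rewrite mulr1; apply: le_trans (g_le1 Dp) _; rewrite mulrC ler_pdivlMr // mul1r.
rewrite lerD2l lerN2 ler_expR lerN2 -[leLHS]mul1r ler_pdivrMr // mulrC.
have : (1 <= Num.truncn (m n * y p))%N by rewrite -E.
by rewrite -(ler_nat R) => /le_trans; apply; rewrite truncn_le.
Qed.

Let integral_step n x :
  \int[mu]_(p in D) (\sum_(k < N n) e n k p * v n k x) = \sum_(k < N n) a n k * v n k x.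
Proof.
have ie k : mu.-integrable D (fun p => (e n k p * v n k x)%:E).
  apply: (eq_integrable mD _ _ _ (integrableZl mD (v n k x) (e_int n k))).
  by move=> p _; rewrite -EFinM mulrC.
rewrite Rintegral_sum //; by apply: eq_bigr => k _; rewrite /a -RintegralZr //; exact: e_int.
Qed.

Let stepE n x p : D p ->
  \sum_(k < N n) e n k p * v n k x = g p * ((Num.truncn (m n * y p) < (N n).+1)%:R *
    (1 - expR (- (x * ((Num.truncn (m n * y p))%:R / m n))))).
Proof.
move=> Dp; have my0 : 0 <= m n * y p by rewrite mulr_ge0 ?y_ge0 // ltW.
(* The omitted cell can be added back, its term 1 - exp 0 being zero; the sum then runs over all
   cells from 0. *)
rewrite -(@sum_cell _ (N n).+1 (fun k => 1 - expR (- (x * (k%:R / m n))))) //.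
rewrite [X in _ * X]big_ord_recl /= mul0r mulr0 oppr0 expR0 subrr mulr0 add0r mulr_sumr.
by apply: eq_bigr => k _; rewrite /e /v /= mulrA.
Qed.

Let trunc_le n p : D p -> (Num.truncn (m n * y p))%:R / m n <= y p.
Proof.
move=> Dp; have my0 : 0 <= m n * y p by rewrite mulr_ge0 ?y_ge0 // ltW.
by rewrite ler_pdivrMr // [y p * _]mulrC truncn_le.
Qed.

Let trunc_ge n p : D p -> y p - (m n)^-1 <= (Num.truncn (m n * y p))%:R / m n.
Proof.
move=> Dp; rewrite ler_pdivlMr // mulrBl mulVf ?lt0r_neq0 // lerBlDr natr1 [y p * _]mulrC.
by apply: ltW; apply: truncnS_gt.
Qed.

Let one_sub_exp_ge0 (t : R) : 0 <= t -> 0 <= 1 - expR (- t).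
Proof. by move=> t0; rewrite subr_ge0 -expR0 ler_expR oppr_le0. Qed.

(** Left end points and g <= 1 keep every step function below 1 - exp (- x y), the dominating
    function for the passage to the limit. *)
Lemma bern_approx_levy : bern_approx (fun x => \int[mu]_(p in D) (g p * (1 - expR (- (x * y p))))).
Proof.
apply: (@bern_approx_lim _ _ (fun n => \sum_(k < N n) a n k)
  (fun n => [seq (a n k, - (k.+1%:R / m n)) | k <- iota 0 (N n)])).
  move=> n; apply/allP => _ /mapP[k _ ->] /=; apply: Rintegral_ge0 => p; exact: e_ge0.
move=> x x0.
have E n : \sum_(k < N n) a n k - expsum [seq (a n k, - (k.+1%:R / m n)) | k <- iota 0 (N n)] x =
    \int[mu]_(p in D) (\sum_(k < N n) e n k p * v n k x).
  rewrite integral_step /expsum big_map -[iota _ _]/(index_iota 0 (N n)) big_mkord -sumrB.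
  apply: eq_bigr => k _ /=; rewrite /v mulNr [x * _]mulrC; ring.
under eq_fun do rewrite E.
have cv : (\int[mu]_(p in D) (\sum_(k < N n) e n k p * v n k x)%:E)%E @[n --> \oo] -->
    (\int[mu]_(p in D) (g p * (1 - expR (- (x * y p))))%:E)%E.
  apply: (@dominated_cvg _ _ _ _ _ mD (fun n p => (\sum_(k < N n) e n k p * v n k x)%:E) _
    (fun p => (1 - expR (- (x * y p)))%:E)) => //.
  - move=> n; apply/measurable_EFinP; apply: measurable_sum => k.
    apply: measurable_funM => //; apply/measurable_EFinP; exact: measurable_int (e_int n k).
  - move=> p Dp; apply/fine_cvgP; split; first by near=> n.
    apply/cvgrPdist_le => eps eps0; near=> n.
    have yp := y_ge0 Dp.
    have h : n.+1%:R^-1 * x <= eps by near: n; apply: near_inv_mul.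
    rewrite /= stepE //; set t := _ / _.
    have tN : (Num.truncn (m n * y p) < (N n).+1)%N.
      have yn : y p <= m n.
        have : n.+1%:R^-1 * y p <= 1 by near: n; apply: near_inv_mul.
        by rewrite mulrC ler_pdivrMr // mul1r.
      rewrite ltnS ltnW // ltnS -(ler_nat R); apply: le_trans (_ : m n * y p <= _).
        by rewrite truncn_le mulr_ge0 // ltW.
      by rewrite natrX expr2 ler_wpM2l // ltW.
    rewrite tN mul1r -mulrBr normrM.
    apply: le_trans (_ : `|1 - expR (- (x * y p)) - (1 - expR (- (x * t)))| <= _).
      by rewrite ler_piMl // ger0_norm ?g_ge0 ?g_le1.
    have ty : t <= y p by apply: trunc_le.
    have yt : y p - (m n)^-1 <= t by apply: trunc_ge.
    have t0 : 0 <= t by rewrite /t divr_ge0 // ltW.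
    rewrite opprB addrC addrA subrK.
    have -> : expR (- (x * y p)) = expR (- (x * t)) * expR (- (x * (y p - t))).
      by rewrite -expRD; congr expR; ring.
    have xt0 : 0 <= x * t by rewrite mulr_ge0 // ltW.
    have xyt0 : 0 <= x * (y p - t) by rewrite mulr_ge0 ?subr_ge0 // ltW.
    have h1 := one_sub_exp_ge0 xt0; have h2 := one_sub_exp_ge0 xyt0.
    have h3 := expR_gt0 (- (x * t)).
    rewrite -[X in X - _]mulr1 -mulrBr ger0_norm; last by rewrite mulr_ge0 // ltW.
    apply: le_trans (_ : 1 - expR (- (x * (y p - t))) <= _).
      by rewrite ler_piMl // -subr_ge0.
    have := expR_ge1Dx (- (x * (y p - t))).
    have : x * (y p - t) <= x * (m n)^-1 by rewrite ler_pM2l // lerBlDl -lerBlDr.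
    move: h; rewrite -/(m n) [_ * x]mulrC; set u := x * (m n)^-1; set w := x * (y p - t).
    by move=> ue wu hw; apply: le_trans ue; apply: le_trans wu; rewrite lerBlDr -lerBlDl.
  - exact: hJ.
  move=> n p Dp; have yp := y_ge0 Dp.
  have t0 : 0 <= (Num.truncn (m n * y p))%:R / m n by rewrite divr_ge0 // ltW.
  have xt0 : 0 <= x * ((Num.truncn (m n * y p))%:R / m n) by rewrite mulr_ge0 // ltW.
  have h1 := one_sub_exp_ge0 xt0.
  rewrite /= lee_fin stepE // ger0_norm; last by rewrite mulr_ge0 ?g_ge0 // mulr_ge0.
  apply: le_trans (_ : 1 - expR (- (x * ((Num.truncn (m n * y p))%:R / m n))) <= _).
    apply: le_trans (ler_piMl _ (g_le1 Dp)) _; first by rewrite mulr_ge0.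
    by rewrite ler_piMl //; case: (_ < _)%N.
  by rewrite lerD2l lerN2 ler_expR lerN2 ler_pM2l // trunc_le.
have fl : (\int[mu]_(p in D) (g p * (1 - expR (- (x * y p))))%:E)%E \is a fin_num.
  apply: integrable_fin_num => //; apply: (le_integrable mD _ _ (hJ x0)).
    apply/measurable_EFinP; apply: measurable_funM => //.
    by apply/measurable_EFinP; exact: measurable_int (hJ x0).
  move=> p Dp; rewrite !abse_EFin lee_fin normrM ler_piMl // ger0_norm ?g_ge0 ?g_le1 //.
rewrite /Rintegral; rewrite -(fineK fl) in cv.
by move/fine_cvg : cv.
Unshelve. all: by end_near. Qed.

End LevyApprox.

(** Weights are rounded down to multiples of 1/m and become multiplicities. Dividing by the length
    of the list rather than by m gives total mass exactly one, at the price of a factor close to 1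
    because M 0 = 1. *)
Lemma exp_approx_uniform {R : realType} (A : pred R) (M : R -> R) :
  exp_approx A M -> A 0 -> M 0 = 1 -> forall (xs : seq R) (e : R), all A xs -> 0 < e ->
  exists2 l : seq R, (0 < size l)%N &
    forall x, x \in xs -> `|(size l)%:R^-1 * (\sum_(b <- l) expR (b * x)) - M x| <= e.
Proof.
move=> H A0 M0 xs e Axs e0.
(* The final error is at most d (1 + |M x|) / S 0, where S 0 >= 1 - d >= 1/2; this is the origin of
   the factor 2 and of the condition n > 0. *)
have [n [n1 Hn]] : exists n, (0 < n)%N /\
    forall x, x \in xs -> n.+1%:R^-1 * (2 * (1 + `|M x|)) <= e.
  apply: near_exists; apply: filterI; first by exists 1%N.
  by apply: near_seq => x _; apply: near_inv_mul.
pose d : R := n.+1%:R^-1.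
have d0 : 0 < d by rewrite invr_gt0.
have d2 : d <= 1 / 2 by rewrite div1r lef_pV2 ?posrE // ler_nat.
have A0xs : all A (0 :: xs) by rewrite /= A0.
have dd0 : 0 < d / 2 by rewrite divr_gt0.
have [l hl Hl] := H _ _ A0xs dd0.
have [N HN] : exists N, forall x, x \in 0 :: xs ->
    N.+1%:R^-1 * (\sum_(p <- l) expR (p.2 * x)) <= d / 2.
  by apply: near_exists; apply: near_seq => x _; apply: near_inv_mul.
set m : R := N.+1%:R in HN; have m0 : 0 < m by rewrite ltr0n.
pose T (p : R * R) : R := (Num.truncn (m * p.1))%:R.
pose L := flatten [seq nseq (Num.truncn (m * p.1)) p.2 | p <- l].
have LE x : \sum_(b <- L) expR (b * x) = \sum_(p <- l) T p * expR (p.2 * x).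
  rewrite big_flatten big_map; apply: eq_bigr => p _.
  by rewrite big_nseq iter_addr_0 /T mulr_natl.
pose S x := m^-1 * \sum_(b <- L) expR (b * x).
have HS x : x \in 0 :: xs -> `|S x - M x| <= d.
  move=> hx; have h1 := Hl x hx; have h2 := HN x hx.
  have h3 : 0 <= expsum l x - S x <= d / 2.
    have -> : expsum l x - S x = \sum_(p <- l) (p.1 - m^-1 * T p) * expR (p.2 * x).
      rewrite /expsum /S LE mulr_sumr -sumrB; apply: eq_bigr => p _; ring.
    have hp p : p \in l -> 0 <= p.1 - m^-1 * T p <= m^-1.
      move=> pl; have p0 : 0 <= p.1 := allP hl p pl.
      have mp0 : 0 <= m * p.1 by apply: mulr_ge0 => //; exact: ltW.
      have /andP[t1 t2] := truncn_itv mp0.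
      rewrite subr_ge0 ler_pdivrMl // t1 /=.
      rewrite lerBlDr -[X in _ <= X + _]mulr1 -mulrDr ler_pdivlMl // addrC natr1.
      exact: ltW.
    apply/andP; split.
      rewrite big_seq; apply: sumr_ge0 => p pl; apply: mulr_ge0; last exact: expR_ge0.
      by have /andP[] := hp p pl.
    apply: le_trans h2; rewrite mulr_sumr !big_seq; apply: ler_sum => p pl.
    by apply: ler_wpM2r; [exact: expR_ge0|have /andP[] := hp p pl].
  have [h4 h5] := andP h3.
  have -> : S x - M x = (expsum l x - M x) - (expsum l x - S x) by ring.
  apply: le_trans (ler_normB _ _) _; rewrite (ger0_norm h4) [leRHS]splitr; exact: lerD.
have S0 : S 0 = (size L)%:R / m.
  rewrite /S mulrC; congr (_ / _); under eq_bigr do rewrite mulr0 expR0.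
  by rewrite big_const_seq count_predT iter_addr_0.
have S0h : 1 / 2 <= S 0.
  have := HS 0 (mem_head _ _); rewrite M0 ler_norml => /andP[h _]; lra.
have S0p : 0 < S 0 by lra.
have L0 : (0 < size L)%N.
  by case: (size L) S0 S0p => // ->; rewrite mul0r ltxx.
exists L => // x hx; have hx' : x \in 0 :: xs by rewrite inE hx orbT.
have s0 : (0 : R) < (size L)%:R by rewrite ltr0n.
have -> : (size L)%:R^-1 * (\sum_(b <- L) expR (b * x)) - M x = (S x - M x * S 0) / S 0.
  by rewrite S0 /S; field; rewrite !lt0r_neq0.
rewrite normrM normfV (gtr0_norm S0p) ler_pdivrMr //.
have -> : S x - M x * S 0 = (S x - M x) - M x * (S 0 - M 0) by rewrite M0; ring.
apply: le_trans (ler_normB _ _) _; rewrite normrM.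
have h1 := HS x hx'; have h2 := HS 0 (mem_head _ _); have h3 := Hn x hx.
apply: le_trans (_ : d + `|M x| * d <= _).
  by apply: lerD => //; apply: ler_wpM2l.
have -> : d + `|M x| * d = d * (2 * (1 + `|M x|)) * (1 / 2) by field.
apply: ler_pM => //; apply: mulr_ge0; [exact: ltW|].
by apply: mulr_ge0 => //; apply: addr_ge0.
Qed.

(** * Exponential sums approximating W(q, 1 + x) *)

Section WeierstrassApprox.
Context {R : realType}.
Implicit Types (q x : R).
Variables (kappa : R[i] -> R[i] -> R[i]) (phi : R -> R).

Lemma eq_bern_approx (f f' : R -> R) : (forall x, 0 < x -> f x = f' x) ->
  bern_approx f -> bern_approx f'.
Proof.
move=> h H xs e xs0 e0; have [B [l [hl Hl]]] := H xs e xs0 e0; exists B, l; split => // x hx.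
by rewrite -h ?Hl //; apply: (allP xs0).
Qed.

Lemma bern_approx_kappa q : bivariate_bernstein kappa -> 0 <= q ->
  bern_approx (fun x => complex.Re (kappa q%:C x%:C)).
Proof.
move=> [d1 [d2 [mu [k0 d10 d20 _ Hk]]]] q0.
have [c c0 E] := levy_form k0 d10 Hk q0.
apply: (@eq_bern_approx (fun x => c + d2 * x +
  \int[mu]_(p in quadrant) (expR (- (q * p.1)) * (1 - expR (- (x * p.2)))))).
  by move=> x x0; rewrite E.
apply: bern_approxD; first by apply: bern_approxD; [apply: bern_approx_cst|apply: bern_approx_lin].
apply: (@bern_approx_levy _ _ _ mu quadrant snd (fun p => expR (- (q * p.1)))).
- exact: measurable_quadrant.
- exact: measurable_funTS.
- apply: measurableT_comp => //; apply: measurableT_comp => //.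
  by apply: measurable_funM => //; exact: measurable_funTS.
- by move=> p /quadrantP[_ /ltW].
- by move=> p _; apply: expR_ge0.
- move=> p /quadrantP[/ltW p1 _]; rewrite -expR0 ler_expR oppr_le0; exact: mulr_ge0.
move=> x x0; apply: (eq_integrable measurable_quadrant _ _ _ (levy_integrable Hk (lexx 0) x0)).
by move=> p _; rewrite mul0r oppr0 expR0 mul1r.
Qed.

Hypothesis K : kappa_facts kappa phi.

(** Exhibits a constant, an exponential in x and reciprocals 1 / f(j + x) with j >= 1: exactly the
    shapes for which approximations are available, on x > -1. *)
Lemma gauss_real q x (n : nat) : 0 <= q -> -1 < x -> (0 < n)%N ->
  let f y := complex.Re (kappa q%:C y%:C) in
  gauss_seq kappa q%:C (1 + x)%:C n / kappa q%:C (1 + x)%:C =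
  (expR (ln (f n%:R)) * expR (ln (f n%:R) * x) *
   (\prod_(k < n) (f k.+1%:R * (f (k.+2%:R + x))^-1)) * (f (1 + x))^-1)%:C.
Proof.
move=> q0 x1 n0 f.
have fE y : 0 < y -> kappa q%:C y%:C = (f y)%:C by move=> y0; apply: (kf_real K).
have natE k : (k%:R : R[i]) = (k%:R : R)%:C by rewrite (rmorph_nat (real_complex R)).
have p0 : (0 : R) < n%:R by rewrite ltr0n.
have fn : 0 < f n%:R by apply: (Re_kappa_gt0 K (z := n%:R%:C)).
have x10 : 0 < 1 + x by lra.
have E2 : \prod_(1 <= k < n.+1) (kappa q%:C k%:R / kappa q%:C (k%:R + (1 + x)%:C)) =
    (\prod_(k < n) (f k.+1%:R * (f (k.+2%:R + x))^-1))%:C.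
  rewrite big_add1 /= big_mkord (rmorph_prod (real_complex R)); apply: eq_bigr => k _ /=.
  have k0 : (0 : R) < k.+1%:R by rewrite ltr0n.
  have k0x : 0 < k.+2%:R + x by rewrite -natr1; lra.
  have -> : k.+1%:R + (1 + x)%:C = (k.+2%:R + x)%:C :> R[i].
    by rewrite natE -(rmorphD (real_complex R)) addrA natr1.
  by rewrite natE !fE // -[_^-1](fmorphV (real_complex R)) -(rmorphM (real_complex R)).
rewrite /gauss_seq E2 natE !fE // log0_real //.
rewrite -(rmorphM (real_complex R) (1 + x)) cexp_real -[_^-1](fmorphV (real_complex R)).
rewrite -!(rmorphM (real_complex R)) -expRD; congr ((expR _ * _ * _)%:C); ring.
Qed.

Lemma exp_approx_weierstrass q : bivariate_bernstein kappa -> 0 <= q ->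
  exp_approx (fun x => -1 < x) (fun x => complex.Re (weierstrass kappa q%:C (1 + x)%:C)).
Proof.
move=> hk q0; have H := bern_approx_kappa hk q0.
have f0 x : 0 < x -> 0 < complex.Re (kappa q%:C x%:C).
  by move=> x0; apply: (Re_kappa_gt0 K (z := x%:C)).
apply: (@exp_approx_lim _ _ (fun n x =>
  complex.Re (gauss_seq kappa q%:C (1 + x)%:C n / kappa q%:C (1 + x)%:C))); last first.
  move=> x /= x1; apply: ccvg_Re; apply: (weierstrass_gauss K) => //.
  by rewrite /half_plane /=; lra.
exists 1%N => // n /= n0; apply: (@eq_exp_approx _ (fun x => -1 < x) (fun x =>
  expR (ln (complex.Re (kappa q%:C n%:R%:C))) *
    expR (ln (complex.Re (kappa q%:C n%:R%:C)) * x) *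
  (\prod_(k < n) (complex.Re (kappa q%:C k.+1%:R%:C) *
    (complex.Re (kappa q%:C (k.+2%:R + x)%:C))^-1)) *
  (complex.Re (kappa q%:C (1 + x)%:C))^-1)).
  by move=> x x1; rewrite gauss_real.
apply: exp_approxM; last by apply: (exp_approx_inv f0 H).
apply: exp_approxM.
  by apply: exp_approxM; [apply: exp_approx_cst; exact: expR_ge0|exact: exp_approx_exp].
apply: exp_approx_prod => k; apply: exp_approxM.
  by apply: exp_approx_cst; apply: ltW; apply: f0; rewrite ltr0n.
by apply: (exp_approx_inv f0 H); rewrite ler1n.
Qed.

End WeierstrassApprox.

(** * A moment problem on the half-line *)

Section UnitInterval.
Context {R : realType}.
Notation mu := (@lebesgue_measure R).
Notation D := (`]0, 1[%classic : set R).
Implicit Types (h : R -> R) (u t K : R) (k m n : nat) (c : nat -> R).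

Let mD : measurable D. Proof. exact: measurable_itv. Qed.

Let D_fin : (mu D < +oo)%E.
Proof. by rewrite lebesgue_measure_itv /= lte01 -EFinB ltry. Qed.

Let DP u : D u -> 0 < u /\ u < 1.
Proof. by rewrite /= in_itv /= => /andP[]. Qed.

Lemma unit_integrable h K : measurable_fun D h -> (forall u, D u -> `|h u| <= K) ->
  mu.-integrable D (fun u => (h u)%:E).
Proof.
move=> mh hK; apply: (@measurable_bounded_integrable _ _ _ mu h D) => //.
exists K; split; first exact: num_real.
by move=> M KM u Du; apply: le_trans (hK u Du) (ltW KM).
Qed.

Let measurable_step n k : measurable_fun D (fun u => cell k (n%:R * u)).
Proof. by apply: (measurableT_comp (measurable_cell k)); exact: measurable_funM. Qed.

Lemma step_integrable n k : mu.-integrable D (fun u => (cell k (n%:R * u))%:E).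
Proof.
apply: (unit_integrable (K := 1)); first exact: measurable_step.
by move=> u _; rewrite /cell indicE; case: (_ \in _); rewrite ?normr1 ?normr0.
Qed.

Lemma integral_cell n k : (k < n)%N -> \int[mu]_(u in D) cell k (n%:R * u) = n%:R^-1.
Proof.
move=> kn; have n0 : (0 : R) < n%:R by rewrite ltr0n (leq_trans _ kn).
rewrite Rintegral_itv_obnd_cbnd; last exact: step_integrable.
pose A : set R := `[k%:R / n%:R, k.+1%:R / n%:R[%classic.
rewrite /Rintegral.
transitivity (fine (\int[mu]_(u in `[0%R, 1%R[) (\1_A u)%:E)%E).
  congr fine; apply: eq_integral => u _; congr (_%:E); rewrite /cell !indicE; congr (nat_of_bool _)%:R.
  by apply/idP/idP => /set_mem H; apply/mem_set; move: H;
    rewrite /A /= !in_itv /= ler_pdivrMr // ltr_pdivlMr // [(u : R) * _]mulrC.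
rewrite integral_indic //; try exact: measurable_itv.
have -> : A `&` `[0, 1[%classic = A.
  apply/setIidPl => u; rewrite /A /= !in_itv /= => /andP[h1 h2]; apply/andP; split.
    by apply: le_trans h1; rewrite divr_ge0 // ltW.
  by apply: lt_le_trans h2 _; rewrite ler_pdivrMr // mul1r ler_nat.
rewrite /A /= lebesgue_measure_itv /= lte_fin ltr_pM2r ?invr_gt0 // ltr_nat ltnSn /=.
by rewrite -mulrBl -natrB // subSnn mul1r.
Qed.

Let stepT_lt n u : D u -> (Num.truncn (n.+1%:R * u) < n.+1)%N.
Proof.
move=> /DP[u0 u1]; rewrite truncn_lt_nat; last by rewrite mulr_ge0 // ltW.
by rewrite gtr_pMr // ltr0n.
Qed.

Lemma step_value n c u : D u ->
  \sum_(k < n.+1) cell k (n.+1%:R * u) * c k = c (Num.truncn (n.+1%:R * u)).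
Proof.
move=> Du; have [u0 u1] := DP Du.
by rewrite sum_cell ?stepT_lt ?mul1r // mulr_ge0 // ltW.
Qed.

Lemma step_term_integrable n c k :
  mu.-integrable D (fun u => (cell k (n%:R * u) * c k)%:E).
Proof.
apply: (unit_integrable (K := `|c k|)).
  by apply: measurable_funM => //; exact: measurable_step.
move=> u _; rewrite normrM ler_piMl // /cell indicE.
by case: (_ \in _); rewrite ?normr1 ?normr0.
Qed.

Lemma integral_step n c :
  \int[mu]_(u in D) (\sum_(k < n.+1) cell k (n.+1%:R * u) * c k) =
  n.+1%:R^-1 * \sum_(k < n.+1) c k.
Proof.
rewrite Rintegral_sum //; last by move=> k; apply: step_term_integrable.
rewrite mulr_sumr; apply: eq_bigr => k _.
by rewrite RintegralZr // ?integral_cell //; exact: step_integrable.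
Qed.

(** The m interior nodes of the grid of mesh 1 / (m + 1): they stay inside (0, 1), where the
    quantile functions converge. *)
Definition riemann m h := m.+1%:R^-1 * \sum_(k < m) h (k.+1%:R / m.+1%:R).

Let grid_in m k : (k < m)%N -> D (k.+1%:R / m.+1%:R).
Proof.
by move=> km; rewrite /= in_itv /= divr_gt0 ?ltr0n //= ltr_pdivrMr ?ltr0n // mul1r ltr_nat ltnS.
Qed.

(** h lies between the step functions with its values at the left and at the right ends of the
    cells, where 0 and K replace the values at the two end points. Their integrals differ by K / (m
    + 1). *)
Lemma riemann_nondecreasing h K m : measurable_fun D h ->
  (forall u, D u -> 0 <= h u <= K) ->
  (forall u t, D u -> D t -> u <= t -> h u <= h t) ->
  0 <= \int[mu]_(u in D) h u - riemann m h <= K / m.+1%:R.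
Proof.
move=> mh hK hmono.
have m0 : (0 : R) < m.+1%:R by rewrite ltr0n.
have ih : mu.-integrable D (fun u => (h u)%:E).
  by apply: (unit_integrable mh (K := K)) => u /hK /andP[h0 h1]; rewrite ger0_norm.
have ist c : mu.-integrable D (fun u => (\sum_(k < m.+1) cell k (m.+1%:R * u) * c k)%:E).
  by apply: integrable_Rsum => // k; apply: step_term_integrable.
pose lo k : R := if k is k'.+1 then h (k'.+1%:R / m.+1%:R) else 0.
pose hi k : R := if (k < m)%N then h (k.+1%:R / m.+1%:R) else K.
have loE : riemann m h = m.+1%:R^-1 * \sum_(k < m.+1) lo k.
  by rewrite big_ord_recl add0r.
have hiE : riemann m h + K / m.+1%:R = m.+1%:R^-1 * \sum_(k < m.+1) hi k.
  rewrite big_ord_recr /= {2}/hi ltnn mulrDr [K / _]mulrC; congr (_ * _ + _).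
  by apply: eq_bigr => k _; rewrite /hi ltn_ord.
apply/andP; split.
  rewrite subr_ge0 loE -integral_step; apply: le_Rintegral; [exact: mD|exact: ist|exact: ih|move=> u Du].
  have [u0 u1] := DP Du; rewrite step_value //; set k := Num.truncn _.
  have : (k%:R : R) <= m.+1%:R * u by rewrite truncn_le mulr_ge0 // ltW.
  have : (k < m.+1)%N by apply: stepT_lt.
  case: k => [_ _|k km ku] /=; first by have /andP[] := hK u Du.
  by apply: hmono => //; [apply: grid_in|rewrite ler_pdivrMr // mulrC].
rewrite lerBlDl hiE -integral_step; apply: le_Rintegral; [exact: mD|exact: ih|exact: ist|move=> u Du].
have [u0 u1] := DP Du; rewrite step_value //; set k := Num.truncn _.
rewrite /hi; case: ltnP => km; last by have /andP[] := hK u Du.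
apply: hmono => //; first exact: grid_in.
by rewrite ler_pdivlMr // mulrC; apply: ltW; apply: truncnS_gt.
Qed.

(** The error depends on K and m alone, hence is the same for all quantile functions and for their
    limit. Nonincreasing functions are treated through K - h. *)
Lemma riemann_monotone h K m : measurable_fun D h ->
  (forall u, D u -> 0 <= h u <= K) ->
  (forall u t, D u -> D t -> u <= t -> h u <= h t) \/
  (forall u t, D u -> D t -> u <= t -> h t <= h u) ->
  `|\int[mu]_(u in D) h u - riemann m h| <= K / m.+1%:R.
Proof.
move=> mh hK [hmono|hmono].
  by have /andP[h1 h2] := riemann_nondecreasing m mh hK hmono; rewrite ger0_norm.
have ih : mu.-integrable D (fun u => (h u)%:E).
  by apply: (unit_integrable mh (K := K)) => u /hK /andP[h0 h1]; rewrite ger0_norm.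
have ic : mu.-integrable D (fun=> K%:E).
  by apply: (unit_integrable (K := `|K|)).
have mh' : measurable_fun D (fun u => K - h u) by exact: measurable_funB.
have hK' u : D u -> 0 <= K - h u <= K.
  by move=> /hK /andP[h0 h1]; rewrite subr_ge0 h1 lerBlDr lerDl.
have hmono' u t : D u -> D t -> u <= t -> K - h u <= K - h t.
  by move=> Du Dt ut; rewrite lerD2l lerN2; apply: hmono.
have /andP[] := riemann_nondecreasing m mh' hK' hmono'.
have -> : \int[mu]_(u in D) (K - h u) = K - \int[mu]_(u in D) h u.
  rewrite RintegralB //; congr (_ - _).
  by rewrite Rintegral_cst // /= lebesgue_measure_itv /= lte01 -EFinB /= subr0 mulr1.
have -> : riemann m (fun u => K - h u) = K - K / m.+1%:R - riemann m h.
  rewrite /riemann sumrB sumr_const card_ord -[K *+ m]mulr_natl -natr1.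
  by field; rewrite natr1 pnatr_eq0.
have K0 : 0 <= K / m.+1%:R.
  have h0 : D (2^-1 : R) by rewrite /= in_itv /= invr_gt0 ltr0n /= invf_lt1 ?ltr1n.
  have /andP[a b] := hK _ h0; apply: divr_ge0 => //; exact: le_trans a b.
move: K0; set I := \int[mu]_(u in _) _; set S := riemann m h; set k := K / _.
have -> : K - I - (K - k - S) = k - (I - S) by ring.
move=> k0 h1; rewrite lerBlDr lerDl => h2.
by rewrite ger0_norm // -subr_ge0.
Qed.

Lemma monotone_unit_measurable (h : R -> R) :
  (forall u t, D u -> D t -> u <= t -> h u <= h t) -> measurable_fun D h.
Proof.
move=> hmono; apply: (measurability (@RGenCInfty.G R)) => [|/= _ [_] [r] -> <-].
  exact: RGenCInfty.measurableE.
apply: is_interval_measurable => s t /= [Ds]; rewrite in_itv /= andbT => fs [Dt _] u /andP[su ut].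
have Du : D u.
  have [s0 _] := DP Ds; have [_ t1] := DP Dt.
  by rewrite /= in_itv /= (lt_le_trans s0 su) (le_lt_trans ut t1).
by split => //; rewrite in_itv /= andbT; apply: le_trans fs _; apply: hmono.
Qed.

End UnitInterval.

(** * Quantile functions of finite lists *)

Section Quantiles.
Context {R : realType}.
Notation mu := (@lebesgue_measure R).
Notation D := (`]0, 1[%classic : set R).
Implicit Types (l : seq R) (u t b x r : R) (g : R -> R).

Definition lmean g l := (size l)%:R^-1 * \sum_(b <- l) g b.

(** For nonempty l and u in (0, 1) the index is below the length, so the default is not read. Under
    the uniform law this function is distributed as a uniformly chosen entry of l. *)
Definition quantile l u := nth 0 l (Num.truncn ((size l)%:R * u)).

Lemma lmeanE g l : lmean g l = (size l)%:R^-1 * \sum_(k < size l) g (nth 0 l k).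
Proof. by rewrite /lmean (big_nth 0) big_mkord. Qed.

Let DP u : D u -> 0 < u /\ u < 1.
Proof. by rewrite /= in_itv /= => /andP[]. Qed.

Lemma quantile_index l u : (0 < size l)%N -> D u ->
  let T := Num.truncn ((size l)%:R * u) in
  [/\ (T < size l)%N, T%:R <= (size l)%:R * u & (size l)%:R * u < T.+1%:R].
Proof.
move=> l0 /DP[u0 u1] T.
have s0 : (0 : R) < (size l)%:R by rewrite ltr0n.
have su0 : 0 <= (size l)%:R * u by rewrite mulr_ge0 // ltW.
split; last exact: truncnS_gt; last by rewrite truncn_le.
by rewrite truncn_lt_nat // gtr_pMr.
Qed.

Lemma quantile_mono l u t : (0 < size l)%N -> sorted <=%R l -> D u -> D t -> u <= t ->
  quantile l u <= quantile l t.
Proof.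
move=> l0 sl Du Dt ut.
have [h1 _ _] := quantile_index l0 Du; have [h2 _ _] := quantile_index l0 Dt.
apply: (le_sorted_leq_nth 0 sl) => //.
by apply: le_truncn; apply: ler_wpM2l.
Qed.

(** Markov's inequality: a proportion at least 1 - u of the entries is not below the quantile. *)
Lemma quantile_upper l u : (0 < size l)%N -> sorted <=%R l -> D u ->
  expR (quantile l u) * (1 - u) <= lmean (fun b => expR (b * 1)) l.
Proof.
move=> l0 sl Du; have [Tn T1 T2] := quantile_index l0 Du; have [u0 u1] := DP Du.
have s0 : (0 : R) < (size l)%:R by rewrite ltr0n.
rewrite lmeanE -(big_mkord xpredT (fun k => expR (nth 0 l k * 1))).
rewrite ler_pdivlMl // (big_cat_nat _ (ltnW Tn)) //=.
apply: (@le_trans _ _ (\sum_(Num.truncn ((size l)%:R * u) <= k < size l) expR (quantile l u))).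
  rewrite sumr_const_nat -[X in _ <= X]mulr_natl natrB ?(ltnW Tn) //.
  rewrite [expR _ * _]mulrC mulrA ler_wpM2r ?expR_ge0 // mulrBr mulr1.
  by rewrite lerD2l lerN2.
apply: le_trans (_ : _ <= \sum_(Num.truncn ((size l)%:R * u) <= k < size l) expR (nth 0 l k * 1)) _.
  rewrite big_nat [X in _ <= X]big_nat; apply: ler_sum => k /andP[k1 k2].
  by rewrite mulr1 ler_expR; apply: (le_sorted_leq_nth 0 sl).
by rewrite lerDr; apply: sumr_ge0 => k _; apply: expR_ge0.
Qed.

(** A proportion at least u of the entries is not above the quantile. The negative exponent - 1/2 is
    within the range r > -1 of the moments under control. *)
Lemma quantile_lower l u : (0 < size l)%N -> sorted <=%R l -> D u ->
  expR (quantile l u * - 2^-1) * u <= lmean (fun b => expR (b * - 2^-1)) l.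
Proof.
move=> l0 sl Du; have [Tn T1 T2] := quantile_index l0 Du; have [u0 u1] := DP Du.
have s0 : (0 : R) < (size l)%:R by rewrite ltr0n.
rewrite lmeanE -(big_mkord xpredT (fun k => expR (nth 0 l k * - 2^-1))).
rewrite ler_pdivlMl // (big_cat_nat _ Tn) //=.
apply: (@le_trans _ _ (\sum_(0 <= k < (Num.truncn ((size l)%:R * u)).+1)
    expR (quantile l u * - 2^-1))).
  rewrite sumr_const_nat -[X in _ <= X]mulr_natl subn0.
  by rewrite [expR _ * _]mulrC mulrA ler_wpM2r ?expR_ge0 // ltW.
apply: le_trans (_ : _ <= \sum_(0 <= k < (Num.truncn ((size l)%:R * u)).+1)
    expR (nth 0 l k * - 2^-1)) _.
  rewrite big_nat [X in _ <= X]big_nat; apply: ler_sum => k /andP[k1 k2].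
  rewrite ler_expR !mulrN lerN2 ler_pM2r ?invr_gt0 //.
  by apply: (le_sorted_leq_nth 0 sl) => //; apply: leq_ltn_trans Tn.
by rewrite lerDl; apply: sumr_ge0 => k _; apply: expR_ge0.
Qed.

Lemma integral_quantile g l : (0 < size l)%N ->
  \int[mu]_(u in D) g (quantile l u) = lmean g l.
Proof.
rewrite lmeanE /quantile; case: (size l) => // n _.
rewrite -(integral_step n (fun k => g (nth 0 l k))); apply: eq_Rintegral => u /set_mem Du.
by rewrite (step_value n (fun k => g (nth 0 l k)) Du).
Qed.

(** A cut-off of exp (b r) that is bounded and still monotone in b, so that the uniform Riemann
    bound applies to it. *)
Definition tempered (r c b : R) := Num.min (expR (b * r)) (expR c).

Lemma tempered_ge0 r c b : 0 <= tempered r c b.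
Proof. by rewrite le_min !expR_ge0. Qed.

Lemma tempered_le r c b : tempered r c b <= expR c.
Proof. by rewrite ge_min lexx orbT. Qed.

Lemma tempered_monotone r c :
  (forall b b', b <= b' -> tempered r c b <= tempered r c b') \/
  (forall b b', b <= b' -> tempered r c b' <= tempered r c b).
Proof.
have [r0|r0] := leP 0 r; [left|right] => b b' bb'.
all: rewrite le_min !ge_min lexx orbT andbT ler_expR; apply/orP; left.
  exact: ler_wpM2r.
by rewrite ler_wnM2r // ltW.
Qed.

(* The cut-off part is controlled by the moment of order r (2 + r) = (1 + r)^2 - 1 > -1. *)
Lemma tempered_tail r c b : -1 < r ->
  tempered r c b <= expR (b * r) <=
  tempered r c b + expR (- ((1 + r) * c)) * expR (b * (r * (2 + r))).
Proof.
move=> r1; apply/andP; split; first by rewrite ge_min lexx.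
rewrite /tempered minEle ler_expR; case: ifPn => [_|]; first by rewrite lerDl mulr_ge0 ?expR_ge0.
rewrite -ltNge => cb; apply: le_trans (_ : expR (- ((1 + r) * c)) * expR (b * (r * (2 + r))) <= _).
  rewrite -expRD ler_expR; have : 0 <= (1 + r) * (b * r - c) by apply: mulr_ge0; lra.
  by move=> H; rewrite -subr_ge0; apply: le_trans H _; rewrite le_eqVlt; apply/orP; left; apply/eqP; ring.
by rewrite lerDr expR_ge0.
Qed.

Lemma tempered_continuous r c : continuous (tempered r c).
Proof.
apply: min_fun_continuous; last exact: cst_continuous.
move=> b; apply: continuous_comp; last exact: continuous_expR.
by apply: continuousM; [exact: cvg_id|exact: cvg_cst].
Qed.

End Quantiles.

(** * The limit law along an ultrafilter *)

Section MomentLimit.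
Context {R : realType}.
Notation mu := (@lebesgue_measure R).
Notation D := (`]0, 1[%classic : set R).
Implicit Types (l xs : seq R) (u t b x r c e : R).

Variable V : R -> R.
Let mom x l := lmean (fun b => expR (b * x)) l.

Hypothesis HV : forall xs e, all (fun x => -1 < x) xs -> 0 < e ->
  exists2 l, (0 < size l)%N & forall x, x \in xs -> `|mom x l - V x| <= e.

(** Sorted lists that match V at finitely many points to a given accuracy. These sets generate a
    proper filter; an ultrafilter refining it provides limits for all moments and all quantiles
    simultaneously. *)
Let good (i : seq R * R) : set (seq R) :=
  [set l | [/\ (0 < size l)%N, sorted <=%R l &
            forall x, x \in i.1 -> `|mom x l - V x| <= i.2]].
Let idx : set (seq R * R) := [set i | all (fun x => -1 < x) i.1 /\ 0 < i.2].

Let good_proper : ProperFilter (filter_from idx good).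
Proof.
apply: filter_from_proper; last first.
  move=> [xs e] [/= Axs e0]; have [l l0 Hl] := HV Axs e0; exists (sort <=%R l); split.
  - by rewrite size_sort.
  - exact: sort_le_sorted.
  move=> x xxs; have := Hl x xxs.
  by rewrite /mom /lmean size_sort (perm_big _ (permEl (perm_sort <=%R l))).
apply: filter_from_filter; first by exists ([::], 1); split => //=; exact: ltr01.
move=> [xs e] [ys e'] [/= Axs e0] [/= Ays e'0]; exists (xs ++ ys, Num.min e e').
  by split => /=; [rewrite all_cat Axs Ays|rewrite lt_min e0 e'0].
move=> l [/= l0 sl Hl]; split; split => //= x hx.
  by have := Hl x; rewrite mem_cat hx => /(_ isT); rewrite le_min => /andP[].
by have := Hl x; rewrite mem_cat hx orbT => /(_ isT); rewrite le_min => /andP[].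
Qed.

Section Ultralimit.
Variable U : set_system (seq R).
Context {UU : UltraFilter U}.
Hypothesis HU : forall xs e, all (fun x => -1 < x) xs -> 0 < e -> U (good (xs, e)).

(** Compactness of [- B, B] gives a cluster point, and an ultrafilter converges to each of its
    cluster points. *)
Lemma ultra_bounded_cvg (f : seq R -> R) (B : R) :
  U [set l | `|f l| <= B] -> exists p : R, f @ U --> p.
Proof.
move=> hB; have [p [_ Hp]] : (`[- B, B]%classic `&` cluster (f @ U)) !=set0.
  apply: segment_compact; have : U (f @^-1` `[- B, B]).
    by apply: filterS hB => l /=; rewrite in_itv /= ler_norml.
  by [].
exists p => A Ap /=; have [//|nA] := in_ultra_setVsetC (f @^-1` A) UU.
by have [y [ny Ay]] := Hp (~` A) A nA Ap.
Qed.

Let near_good : U [set l | (0 < size l)%N /\ sorted <=%R l].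
Proof. by apply: filterS (HU (xs := [::]) (e := 1) isT ltr01) => l [/= ? ? _]. Qed.

Let near_mom x e : -1 < x -> 0 < e -> U [set l | `|mom x l - V x| <= e].
Proof.
move=> x1 e0; have Axs : all (fun x => -1 < x) [:: x] by rewrite /= x1.
by apply: filterS (HU Axs e0) => l [/= _ _]; apply; rewrite mem_head.
Qed.

Let DP u : D u -> 0 < u /\ u < 1.
Proof. by rewrite /= in_itv /= => /andP[]. Qed.

(** Tightness: the moment of order 1 bounds the quantile above by ln B1 and the moment of order -
    1/2 bounds it below by - 2 ln B2, along the ultrafilter. *)
Let quantile_cvg u : D u -> exists p : R, quantile ^~ u @ U --> p.
Proof.
move=> Du; have [u0 u1] := DP Du; have u1' : 0 < 1 - u by rewrite subr_gt0.
have h1 := @near_mom 1 1 _ ltr01; have h2 := @near_mom (- 2^-1) 1 _ ltr01.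
have {}h1 := h1 (lt_trans (ltrN10 _) ltr01).
have {}h2 : U [set l | `|mom (- 2^-1) l - V (- 2^-1)| <= 1].
  by apply: h2; rewrite ltrN2 invf_lt1 ?ltr1n.
pose B1 := (V 1 + 1) / (1 - u); pose B2 := (V (- 2^-1) + 1) / u.
apply: (@ultra_bounded_cvg _ (`|ln B1| + 2 * `|ln B2|)).
apply: filterS (filterI near_good (filterI h1 h2)) => l /= [[l0 sl] [m1 m2]].
have := quantile_upper l0 sl Du; have := quantile_lower l0 sl Du.
rewrite -/(mom 1 l) -/(mom (- 2^-1) l); set Q := quantile l u => q2 q1.
have {}q1 : expR Q <= B1.
  rewrite ler_pdivlMr //; apply: le_trans q1 _; move: m1; rewrite ler_norml => /andP[_].
  by rewrite lerBlDl addrC.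
have {}q2 : expR (Q * - 2^-1) <= B2.
  rewrite ler_pdivlMr //; apply: le_trans q2 _; move: m2; rewrite ler_norml => /andP[_].
  by rewrite lerBlDl addrC.
have B10 : 0 < B1 := lt_le_trans (expR_gt0 _) q1.
have B20 : 0 < B2 := lt_le_trans (expR_gt0 _) q2.
rewrite -[B1]lnK ?posrE // ler_expR in q1; rewrite -[B2]lnK ?posrE // ler_expR in q2.
have a1 := ler_norm (ln B1); have a2 := ler_norm (ln B2).
have a3 := normr_ge0 (ln B1); have a4 := normr_ge0 (ln B2).
by rewrite ler_norml; apply/andP; split; lra.
Qed.

Let q u := lim (quantile ^~ u @ U).

Let q_cvg u : D u -> quantile ^~ u @ U --> q u.
Proof. by move=> /quantile_cvg[p hp]; apply: cvgP hp. Qed.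

Let q_mono u t : D u -> D t -> u <= t -> q u <= q t.
Proof.
move=> Du Dt ut; have C : (fun l => quantile l t - quantile l u) @ U --> q t - q u.
  exact: (cvgB (q_cvg Dt) (q_cvg Du)).
rewrite -subr_ge0 -(cvg_lim (@Rhausdorff R) C); apply: limr_ge; first exact: cvgP C.
by apply: filterS near_good => l [l0 sl]; rewrite subr_ge0; apply: quantile_mono.
Qed.

Let measurable_tempered_monotone (f : R -> R) r c : (forall u t, D u -> D t -> u <= t -> f u <= f t) ->
  measurable_fun D (fun u => tempered r c (f u)).
Proof.
move=> fm; have mf := monotone_unit_measurable fm.
have mt : measurable_fun setT (@tempered R r c).
  by apply: continuous_measurable_fun; exact: tempered_continuous.
exact: (measurableT_comp mt mf).
Qed.

Let riemann_tempered (f : R -> R) r c m : (forall u t, D u -> D t -> u <= t -> f u <= f t) ->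
  `|\int[mu]_(u in D) tempered r c (f u) - riemann m (fun u => tempered r c (f u))|
    <= expR c / m.+1%:R.
Proof.
move=> fm; apply: riemann_monotone; first exact: measurable_tempered_monotone.
  by move=> u _; rewrite tempered_ge0 tempered_le.
by have [h|h] := tempered_monotone r c; [left|right] => u t Du Dt ut; apply: h; apply: fm.
Qed.

Let sum_cvg (m : nat) (F : nat -> seq R -> R) (p : nat -> R) :
  (forall k, (k < m)%N -> F k @ U --> p k) ->
  (fun l => \sum_(k < m) F k l) @ U --> \sum_(k < m) p k.
Proof.
elim: m => [|m IH] h.
  by under eq_fun do rewrite big_ord0; rewrite big_ord0; exact: cvg_cst.
under eq_fun do rewrite big_ord_recr /=; rewrite big_ord_recr /=.
have h1 := h m (ltnSn m); have h2 := IH (fun k km => h k (ltnW km)).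
exact: (cvgD h2 h1).
Qed.

Let riemann_cvg r c m : (fun l => riemann m (fun u => tempered r c (quantile l u))) @ U -->
  riemann m (fun u => tempered r c (q u)).
Proof.
have h : (fun l => \sum_(k < m) tempered r c (quantile l (k.+1%:R / m.+1%:R))) @ U -->
    \sum_(k < m) tempered r c (q (k.+1%:R / m.+1%:R)).
  apply: (sum_cvg (F := fun k l => tempered r c (quantile l (k.+1%:R / m.+1%:R)))
    (p := fun k => tempered r c (q (k.+1%:R / m.+1%:R)))) => k km.
  apply: continuous_cvg; first exact: tempered_continuous.
  apply: q_cvg; rewrite /= in_itv /= divr_gt0 ?ltr0n //= ltr_pdivrMr ?ltr0n //.
  by rewrite mul1r ltr_nat ltnS.
exact: (cvgM (cvg_cst _) h).
Qed.

(** Up to e / 4 each, the truncated integral of q is its Riemann sum, then the Riemann sum of the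
    quantiles of a suitable l, then the truncated mean of l; finally the moment of l is within e / 4
    of V r. The tail term comes from [tempered_tail]. *)
Let tempered_integral r c : -1 < r ->
  V r - expR (- ((1 + r) * c)) * (V (r * (2 + r)) + 1) <=
    \int[mu]_(u in D) tempered r c (q u) <= V r.
Proof.
move=> r1; have r'1 : -1 < r * (2 + r).
  have : 0 < (1 + r) ^+ 2 by rewrite exprn_gt0 //; lra.
  by rewrite expr2; nra.
set A := expR (- _) * _; set I := \int[mu]_(u in D) _.
suff key e : 0 < e -> V r - A - e <= I <= V r + e.
  apply/andP; split; apply/ler_addgt0Pr => e /key /andP[].
    by rewrite lerBlDr.
  by [].
move=> e0; have e40 : 0 < e / 4 by rewrite divr_gt0.
(* The mesh is fixed before the list l: its error bound is common to q and to all quantile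
   functions. *)
have [m Hm] := near_exists (near_inv_mul (expR c) e40).
have hI := riemann_tempered r c m q_mono.
have h3 : U [set l | `|riemann m (fun u => tempered r c (q u)) -
    riemann m (fun u => tempered r c (quantile l u))| <= e / 4].
  by have /cvgrPdist_le/(_ _ e40) := @riemann_cvg r c m.
have [l [[l0 sl] [m1 [m2 m3]]]] := filter_ex (filterI near_good
  (filterI (near_mom r1 e40) (filterI (near_mom r'1 ltr01) h3))).
have hl := riemann_tempered r c m (fun u t => quantile_mono l0 sl (u := u) (t := t)).
rewrite (integral_quantile (tempered r c) l0) in hl.
have s0 : 0 < (size l)%:R^-1 :> R by rewrite invr_gt0 ltr0n.
have t1 : lmean (tempered r c) l <= mom r l.
  apply: ler_wpM2l; first exact: ltW.
  by apply: ler_sum => b _; have /andP[] := tempered_tail c b r1.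
have t2 : mom r l <= lmean (tempered r c) l + expR (- ((1 + r) * c)) * mom (r * (2 + r)) l.
  rewrite /mom /lmean mulrCA -mulrDr; apply: ler_wpM2l; first exact: ltW.
  rewrite mulr_sumr -big_split /=; apply: ler_sum => b _.
  by have /andP[] := tempered_tail c b r1.
have t3 : expR (- ((1 + r) * c)) * mom (r * (2 + r)) l <= A.
  apply: ler_wpM2l; first exact: expR_ge0.
  by move: m2 => /=; rewrite ler_norml => /andP[_]; rewrite lerBlDl addrC.
have Hm' : expR c / m.+1%:R <= e / 4 by rewrite mulrC.
have {}hI := le_trans hI Hm'; have {}hl := le_trans hl Hm'.
move: hI hl m1 m3 => /=; rewrite -/I; set S := riemann m _; set S' := riemann m _.
rewrite !ler_norml => /andP[a1 a2] /andP[a3 a4] /andP[a5 a6] /andP[a7 a8].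
by apply/andP; split; lra.
Qed.

(** The truncation level c = n tends to infinity: monotone convergence identifies the limit of the
    truncated integrals as the full moment, and the two bounds of [tempered_integral] identify it as
    V r. *)
Lemma ultra_moments : exists f : R -> R, (forall u t, D u -> D t -> u <= t -> f u <= f t) /\
  forall r, -1 < r -> (\int[mu]_(u in D) (expR (f u * r))%:E = (V r)%:E)%E.
Proof.
exists q; split; first exact: q_mono.
move=> r r1.
have mt c : measurable_fun D (fun u => (tempered r c (q u))%:E).
  by apply/measurable_EFinP; exact: measurable_tempered_monotone.
have it c : mu.-integrable D (fun u => (tempered r c (q u))%:E).
  apply: (unit_integrable (K := expR c)); first exact: measurable_tempered_monotone.
  by move=> u _; rewrite ger0_norm ?tempered_ge0 ?tempered_le.
have mono : (\int[mu]_(u in D) (tempered r n%:R (q u))%:E)%E @[n --> \oo] -->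
    (\int[mu]_(u in D) (expR (q u * r))%:E)%E.
  have H := @cvg_monotone_convergence _ _ _ mu D (measurable_itv _)
    (fun n u => (tempered r n%:R (q u))%:E) (fun n => mt n%:R).
  have E : (\int[mu]_(u in D) (limn (fun n => (tempered r n%:R (q u))%:E)))%E =
      (\int[mu]_(u in D) (expR (q u * r))%:E)%E.
    apply: eq_integral => u _; apply: cvg_lim => //.
    apply: cvg_near_cst; exists (Num.truncn (q u * r)).+1 => // n /= nn.
    rewrite /tempered minEle ler_expR ifT //; apply: ltW.
    by apply: lt_le_trans (truncnS_gt _) _; rewrite ler_nat.
  rewrite -E; apply: H.
    by move=> n u _; rewrite lee_fin tempered_ge0.
  move=> u _ n m nm; rewrite lee_fin /tempered le_min; apply/andP; split; first by rewrite ge_min lexx.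
  by rewrite ge_min; apply/orP; right; rewrite ler_expR ler_nat.
have cvV : (fun n => \int[mu]_(u in D) tempered r n%:R (q u)) @ \oo --> V r.
  apply/cvgrPdist_le => e e0.
  have r10 : 0 < 1 + r by lra.
  (* The tail factor exp (- (1 + r) n) is bounded by 1 / ((1 + r) n). *)
  have := near_inv_mul ((1 + r)^-1 * `|V (r * (2 + r)) + 1|) e0.
  move=> [N _ HN]; exists N.+1 => // -[//|n] /= nN; have {HN}:= HN n nN.
  have /andP[h1 h2] := tempered_integral n.+1%:R r1.
  move=> h3; rewrite ger0_norm ?subr_ge0 //; move: h1; rewrite lerBlDr => h1.
  rewrite lerBlDl; apply: le_trans h1 _; rewrite lerD2l; apply: le_trans h3.
  apply: le_trans (ler_wpM2l (expR_ge0 _) (ler_norm _)) _.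
  rewrite mulrA; apply: ler_wpM2r => //; rewrite -invfM [_ * (1 + r)]mulrC.
  have nr : 0 < (1 + r) * n.+1%:R by rewrite mulr_gt0.
  rewrite expRN lef_pV2 ?posrE ?expR_gt0 //.
  by apply: le_trans (expR_ge1Dx _); rewrite lerDr.
have cvE : (\int[mu]_(u in D) (tempered r n%:R (q u))%:E)%E @[n --> \oo] --> (V r)%:E.
  have E n : (\int[mu]_(u in D) (tempered r n%:R (q u))%:E)%E =
      (\int[mu]_(u in D) tempered r n%:R (q u))%:E.
    by rewrite /Rintegral fineK //; apply: integrable_fin_num.
  by under eq_fun do rewrite E; apply: cvg_EFin => //; near=> n.
exact: (cvg_unique _ mono cvE).
Unshelve. all: by end_near. Qed.

End Ultralimit.

Theorem moment_limit : exists f : R -> R, (forall u t, D u -> D t -> u <= t -> f u <= f t) /\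
  forall r, -1 < r -> (\int[mu]_(u in D) (expR (f u * r))%:E = (V r)%:E)%E.
Proof.
have [U [UU FU]] := ultraFilterLemma good_proper.
apply: (@ultra_moments U UU) => xs e Axs e0; apply: FU.
by exists (xs, e).
Qed.

End MomentLimit.

(** * Existence *)

Section Existence.
Context {R : realType}.
Variables (kappa : R[i] -> R[i] -> R[i]) (phi : R -> R).
Hypothesis K : kappa_facts kappa phi.
Hypothesis hkappa : bivariate_bernstein kappa.

Lemma weierstrass_real (q x : R) : 0 <= q -> -1 < x ->
  weierstrass kappa q%:C (1 + x)%:C = (complex.Re (weierstrass kappa q%:C (1 + x)%:C))%:C.
Proof.
move=> q0 x1; apply: complex_eqP => //=; apply/eqP; rewrite -normr_eq0 eq_le normr_ge0 andbT.
have x10 : half_plane (1 + x)%:C by rewrite /half_plane /=; lra.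
have cq : closed_half_plane q%:C by [].
apply/ler_addgt0Pr => e e0; rewrite add0r.
have [N HN] := weierstrass_gauss K cq x10 e0.
have := HN N.+1 (leqnSn N); rewrite (gauss_real K q0 x1) // => H; apply: le_trans H.
rewrite cmodBC; apply: le_trans (normIm_le _).
by rewrite ImB /= subr0.
Qed.

Lemma weierstrass_mellin (q : R) : 0 <= q -> mellin_of_positive_rv (weierstrass kappa q%:C).
Proof.
move=> q0; pose V x := complex.Re (weierstrass kappa q%:C (1 + x)%:C).
have cq : closed_half_plane q%:C by [].
have V0 : V 0 = 1 by rewrite /V addr0 (weierstrass1 K).
have HV := exp_approx_uniform (exp_approx_weierstrass K hkappa q0) (ltrN10 R) V0.
have [f [fmono fV]] := moment_limit HV.
pose D : set R := `]0, 1[%classic.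
(* f is monotone, hence measurable, on ]0, 1[ only. It is extended by 0; the end points of [0, 1]
   have measure zero for the uniform law. *)
pose l : R -> R := f \_ D.
have ml : measurable_fun setT l.
  apply/(measurable_restrictT _ _).1; first exact: measurable_itv.
  exact: monotone_unit_measurable.
have mY : measurable_fun setT (fun u => expR (l u)) by exact: measurableT_comp.
have mla (a : R) : measurable_fun setT (fun u => l u * a) by exact: measurable_funM.
have mcos (a b : R) : measurable_fun setT (fun u => expR (l u * a) * cos (l u * b)).
  apply: measurable_funM; first by apply: measurableT_comp => //; exact: mla.
  by apply: measurableT_comp (mla b); apply: continuous_measurable_fun; exact: continuous_cos.
have msin (a b : R) : measurable_fun setT (fun u => expR (l u * a) * sin (l u * b)).
  apply: measurable_funM; first by apply: measurableT_comp => //; exact: mla.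
  by apply: measurableT_comp (mla b); apply: continuous_measurable_fun; exact: continuous_sin.
pose P : probability _ R := uniform_prob (@ltr01 R).
have mexp (r : R) : measurable_fun setT (fun u => (expR (l u * r))%:E).
  by apply/measurable_EFinP; apply: measurableT_comp => //; exact: mla.
have momE (r : R) : -1 < r -> (\int[P]_u (expR (l u * r))%:E = (V r)%:E)%E.
  move=> r1; rewrite integral_uniform; [|exact: mexp|by move=> u; rewrite lee_fin expR_ge0].
  rewrite subr0 invr1 mul1e -integral_itv_bndo_bndc; last exact: measurable_funTS.
  rewrite -integral_itv_obnd_cbnd; last exact: measurable_funTS.
  rewrite -fV //; apply: eq_integral => u Du.
  by rewrite /l patchE Du.
have mY' : measurable_fun (setT : set (measurableTypeR R)) (fun u => expR (l u)) by exact: mY.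
pose YM := isMeasurableFun.Build _ _ _ _ (fun u : measurableTypeR R => expR (l u)) mY'.
pose Y : {RV P >-> R} := HB.pack (fun u : measurableTypeR R => expR (l u)) YM.
have lnY u : ln (Y u) = l u by rewrite expRK.
have iexp (r : R) : -1 < r -> P.-integrable setT (fun u => (expR (l u * r))%:E).
  move=> r1; apply/integrableP; split; first exact: mexp.
  under eq_integral => u _ do rewrite gee0_abs ?lee_fin ?expR_ge0 //.
  by rewrite momE // ltry.
have hM z : half_plane z -> cintegrable P setT (fun t => rcpow (Y t) (z - 1)).
  move=> z0; have z1 : -1 < complex.Re z - 1 by move: z0; rewrite /half_plane /=; lra.
  apply: (cintegrable_le measurableT _ _ (iexp _ z1)).
  - have -> : (fun t => complex.Re (rcpow (Y t) (z - 1))) =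
        (fun t => expR (l t * (complex.Re z - 1)) * cos (l t * complex.Im z)).
      apply/funext => t; rewrite /rcpow lnY Re_cexp; congr (expR _ * cos _).
        by rewrite ReM ReB /=; ring.
      by rewrite ImM ImB /=; ring.
    exact: mcos.
  - have -> : (fun t => complex.Im (rcpow (Y t) (z - 1))) =
        (fun t => expR (l t * (complex.Re z - 1)) * sin (l t * complex.Im z)).
      apply/funext => t; rewrite /rcpow lnY Im_cexp; congr (expR _ * sin _).
        by rewrite ReM ReB /=; ring.
      by rewrite ImM ImB /=; ring.
    exact: msin.
  move=> t _; rewrite /rcpow lnY cmod_cexp le_eqVlt; apply/orP; left; apply/eqP.
  by congr expR; rewrite ReM ReB /=; ring.
exists _, _, P, Y; split; first by move=> t; apply: expR_gt0.
move=> z z0; split; first exact: hM.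
apply/eqP; rewrite -subr_eq0; apply/eqP.
(* The law of Y was built from its moments of real order r > -1; both sides are holomorphic in z, so
   equality at real z = 1 + r extends to the half-plane. *)
apply: (@identity_theorem _ (fun z => weierstrass kappa q%:C z -
  cintegral P setT (fun t => rcpow (Y t) (z - 1)))) => //.
  move=> w w0; apply: holoB; first exact: (weierstrass_holo_z K).
  exact: (mellin_holo hM).
move=> x x0; have x1 : -1 < x - 1 by lra.
rewrite (mellin_realE _ x0) // -[X in weierstrass _ _ X%:C](subrK 1) [x - 1 + 1]addrC.
rewrite weierstrass_real // -rmorphB.
suff -> : \int[P]_t expR ((x - 1) * ln (Y t)) = V (x - 1) by rewrite subrr.
rewrite /Rintegral; transitivity (fine (V (x - 1))%:E) => //; rewrite -momE //; congr fine.
by apply: eq_integral => t _; rewrite lnY mulrC.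
Qed.

End Existence.

Unset Implicit Arguments.
Set Strict Implicit.
Set Printing Implicit Defensive.

(** [hkappa0] excludes kappa(0, .) = 0. In that case the recurrence would give W(0, z + 1) = 0,
    whereas the Mellin transform of a positive random variable is positive at real points. *)
Theorem theorem2p8 (R : realType) (kappa : R[i] -> R[i] -> R[i])
    (hkappa : bivariate_bernstein kappa)
    (hkappa0 : exists2 z, closed_half_plane z & kappa 0 z != 0) :
  (* existence and uniqueness of W *)
  (exists W : R[i] -> R[i] -> R[i],
    [/\ bernstein_gamma kappa W,
        boundary_continuous W,
        forall V : R[i] -> R[i] -> R[i], bernstein_gamma kappa V ->
          forall zeta z : R[i], closed_half_plane zeta -> half_plane z ->
          0 < complex.Re zeta \/ complex.Im zeta = 0 \/ boundary_continuous V ->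
          V zeta z = W zeta z,
        (* product representation *)
        forall zeta z : R[i], closed_half_plane zeta -> half_plane z ->
          W zeta z = weierstrass kappa zeta z
      & (* limit representation *)
        forall zeta z : R[i], closed_half_plane zeta -> half_plane z ->
          cvgn (gauss_seq kappa zeta z) /\
          W zeta z = (kappa zeta z)^-1 * limn (gauss_seq kappa zeta z)]) /\
  (* the limit gamma and the infinite product converge *)
  (forall zeta : R[i], closed_half_plane zeta -> cvgn (gamma_seq kappa zeta)) /\
  (forall zeta z : R[i], closed_half_plane zeta -> half_plane z ->
     cvgn (weierstrass_seq kappa zeta z)) /\
  (* recurrence for the product *)
  (forall zeta z : R[i], closed_half_plane zeta -> half_plane z ->
     weierstrass kappa zeta (z + 1) = kappa zeta z * weierstrass kappa zeta z) /\
  classA (gamma_kappa kappa).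
Proof.
have K := bernstein_kappa_facts hkappa hkappa0.
split; last first.
  split; first by move=> zeta hz; have [h _] := gamma_cvg K hz; exact: ccvg_cvgn h.
  split; first by move=> zeta z hz z0; exact: ccvg_cvgn (weierstrass_cvg K hz z0).
  split; first by move=> zeta z hz z0; exact: (weierstrass_rec K hz z0).
  exact: (gamma_classA K).
exists (weierstrass kappa); split.
- split.
  + by move=> zeta z hz z0; exact: (weierstrass_rec K hz z0).
  + by move=> zeta hz; exact: (weierstrass1 K hz).
  + by move=> zeta z hz z0; exact: (weierstrass_differentiable K hz z0).
  + by move=> q q0; exact: (weierstrass_mellin K hkappa q0).
- by move=> z z0; apply: hcts_within; exact: (weierstrass_hcts K z0).
- by move=> V hV zeta z hz z0 hor; exact: (bernstein_gamma_unique K hV hz z0 hor).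
- by [].
- move=> zeta z hz z0; have h := gauss_cvg K hz z0; split; first exact: ccvg_cvgn h.
  by rewrite (ccvg_limn h) (weierstrassE K hz z0) mulrAC mulrC.
Qed.
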